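(* Let $\Omega\subset\mathbb{R}^n$ be open, let $x_0\in\partial\Omega$, and assume that $\Omega$ satisfies the interior ball condition at $x_0$, with radius $r_0>0$ and balls $B_r(x_r)$, $r\in(0,r_0]$. Let $V\in L^1_{loc}(\Omega)$ with $V^-\in L^\infty(\Omega)$ and let $R>0$. Then there exist constants $\widetilde C>0$, $c>0$ and $r_1\in(0,r_0]$ such that the following holds. Let $u\in L^1_s(\mathbb{R}^n)$ be a lower semicontinuous function with $u(x_0)=0$, $u^-\in L^\infty(\mathbb{R}^n)$, and $$\mathcal{M}^-[u](x)+V(x)u\le 0\quad\text{in }\Omega$$ in the viscosity sense. Suppose that $u\ge0$ in $B_R(x_0)$, that $u>0$ in $\Omega\cap B_R(x_0)$, and that for some $r\in(0,r_1]$ $$\widetilde C\,\|u^-\|_{L^1_s(\mathbb{R}^n)}<\frac{\alpha_r}{r^{2s}}\,c,\qquad \alpha_r:=\inf_{B_{r/2}(x_r)}u .$$ Then, for every $\beta\in(0,\frac{\pi}{2})$, $$\liminf_{x\to x_0,\ x\in\Omega}\frac{u(x)}{|x-x_0|^{s}}>0,$$ where the limit is taken over those $x\in\Omega$ for which the angle between $x-x_0$ and the vector joining $x_0$ to the center of the interior ball is smaller than $\frac{\pi}{2}-\beta$.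
   Context: Let $n\ge1$, $s\in(0,1)$ and $0<\lambda\le\Lambda$ be fixed. $\mathcal{L}_*$ is the class of linear operators $$Lu(x)=C_{n,s}\int_{\mathbb{R}^n}\big(u(x+y)+u(x-y)-2u(x)\big)\,\mu\Big(\frac{y}{|y|}\Big)\frac{dy}{|y|^{n+2s}},$$ with $\mu:\mathbb{S}^{n-1}\to[\lambda,\Lambda]$ (measurable) satisfying $\mu(\theta)=\mu(-\theta)$, where $C_{n,s}>0$ is a fixed normalization constant. Set $\mathcal{M}^-[u](x)=\inf_{L\in\mathcal{L}_*}Lu(x)$. Norm: $\|u\|_{L^1_s(\mathbb{R}^n)}=\int_{\mathbb{R}^n}\frac{|u(x)|}{1+|x|^{n+2s}}dx$, and $u\in L^1_s(\mathbb{R}^n)$ if this is finite. Negative part: $v^-=\max\{-v,0\}$. Interior ball condition at $x_0\in\partial\Omega$: there is $r_0>0$ such that for every $r\in(0,r_0]$ there exists a ball $B_r(x_r)\subset\Omega$ with $x_0\in\partial B_r(x_r)\cap\partial\Omega$. Viscosity sense: a lower semicontinuous $u\in L^1_s(\mathbb{R}^n)$ satisfies $\mathcal{M}^-[u]+V(x)u\le 0$ in $\Omega$ if for every $x\in\Omega$, every neighborhood $N_x\subset\Omega$ of $x$ and every $\phi\in L^1_s(\mathbb{R}^n)$ with $\phi\in C^2(N_x)$, $\phi(x)=u(x)$ and $\phi\le u$ in $\mathbb{R}^n$, one has $\mathcal{M}^-[\phi](x)+V(x)u(x)\le 0$.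
   Formalization: The condition that V^- is in L^∞(Ω) is strengthened to V^- being bounded at every point of Ω, because the viscosity inequality reads V pointwise and the claim fails if V^- is bounded only almost everywhere. *)

(* Defs.v *)
From HB Require Import structures.
From mathcomp Require Import all_boot all_order all_algebra.
From mathcomp Require Import all_classical all_reals all_analysis.
From mathcomp Require Import ess_sup_inf.

Set Implicit Arguments.
Unset Strict Implicit.
Unset Printing Implicit Defensive.

Import Order.TTheory GRing.Theory Num.Theory.
Import numFieldNormedType.Exports.

Local Open Scope classical_set_scope.
Local Open Scope ring_scope.

(* R^n is the type 'rV[R]_n of row vectors. Its library topology is the usual
   one, but its library norm `|x| is the sup norm; the Euclidean norm is enorm
   below. *)

Definition measure_rV_display : measure_display -> measure_display.
Proof. exact. Qed.

(* The product sigma-algebra on R^n, that is, the Borel sigma-algebra; compare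
   the library's instance on n.-tuple T. *)
Section measurable_rV.
Context {R : realType} (n : nat).

Let coord : 'I_n -> 'rV[R]_n -> R := fun i x => x ord0 i.

Let rV_set0 : g_sigma_preimage coord set0.
Proof. exact: sigma_algebra0. Qed.

Let rV_setC A : g_sigma_preimage coord A -> g_sigma_preimage coord (~` A).
Proof. exact: sigma_algebraC. Qed.

Let rV_bigcup (F : _^nat) : (forall i, g_sigma_preimage coord (F i)) ->
  g_sigma_preimage coord (\bigcup_i (F i)).
Proof. exact: sigma_algebra_bigcup. Qed.

HB.instance Definition _ := @isMeasurable.Build (measure_rV_display default_measure_display)
  'rV[R]_n (g_sigma_preimage coord) rV_set0 rV_setC rV_bigcup.

Lemma measurable_coord (i : 'I_n) :
  measurable_fun [set: 'rV[R]_n] (fun x : 'rV[R]_n => x ord0 i : R).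
Proof.
move=> _ Y mY; rewrite setTI; apply: sub_sigma_algebra => /=.
rewrite -bigcup_seq/=; exists i => /=; first by rewrite mem_index_enum.
by exists Y => //; rewrite setTI.
Qed.

Lemma measurable_fun_rVP d (T : measurableType d) (f : T -> 'rV[R]_n) :
  (forall i, measurable_fun [set: T] (fun t => f t ord0 i : R)) ->
  measurable_fun [set: T] f.
Proof.
move=> mf; have : g_sigma_preimage coord `<=` image_set_system setT f measurable.
  apply: smallest_sub.
    exact: sigma_algebra_image (@sigma_algebra_measurable _ T).
  move=> A; rewrite -bigcup_seq => -[i _ [B mB <-]].
  rewrite /image_set_system/= !setTI -comp_preimage.
  by have := mf i measurableT _ mB; rewrite setTI.
by move=> h _ A /h; rewrite /image_set_system/= setTI.
Qed.

End measurable_rV.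

Section lebesgue_rV.
Context {R : realType}.

Definition consr n (p : R * 'rV[R]_n) : 'rV[R]_n.+1 :=
  \row_i oapp (p.2 ord0) p.1 (unlift ord0 i).

Lemma consr0 n (p : R * 'rV[R]_n) : consr p ord0 ord0 = p.1.
Proof. by rewrite mxE unlift_none. Qed.

Lemma consrS n (p : R * 'rV[R]_n) i : consr p ord0 (lift ord0 i) = p.2 ord0 i.
Proof. by rewrite mxE liftK. Qed.

Lemma measurable_consr n : measurable_fun [set: R * 'rV[R]_n] (@consr n).
Proof.
apply: measurable_fun_rVP => i; case: (unliftP ord0 i) => [j ->|->].
  under eq_fun do rewrite consrS.
  exact: (measurableT_comp (measurable_coord j) measurable_snd).
by under eq_fun do rewrite consr0; exact: measurable_fst.
Qed.

Section step.
Variables (n : nat) (m : {sigma_finite_measure set 'rV[R]_n -> \bar R}).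

Definition lebesgue_rVS : set 'rV[R]_n.+1 -> \bar R :=
  pushforward (lebesgue_measure \x m)%E (@consr n).

Let lebS0 : lebesgue_rVS set0 = 0%E.
Proof. by rewrite /lebesgue_rVS /pushforward preimage_set0 measure0. Qed.

Let lebS_ge0 A : (0 <= lebesgue_rVS A)%E.
Proof. by rewrite /lebesgue_rVS /pushforward; apply: measure_ge0. Qed.

Let lebS_sigma : semi_sigma_additive lebesgue_rVS.
Proof.
move=> F mF tF mUF; rewrite /lebesgue_rVS /pushforward preimage_bigcup.
have mc A : measurable A -> measurable (@consr n @^-1` A).
  by move=> mA; rewrite -[X in measurable X]setTI; exact: measurable_consr.
apply: measure_semi_sigma_additive.
- by move=> k; exact: mc.
- by move=> i j _ _ [x [Fi Fj]]; apply: (tF i j) => //; exists (consr x).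
- by rewrite -preimage_bigcup; exact: mc.
Qed.

HB.instance Definition _ := isMeasure.Build _ _ _ lebesgue_rVS
  lebS0 lebS_ge0 lebS_sigma.

Lemma lebesgue_rVSX (A : set R) (B : set 'rV[R]_n) :
  measurable A -> measurable B ->
  lebesgue_rVS [set x : 'rV[R]_n.+1 | A (x ord0 ord0) /\ B (\row_i x ord0 (lift ord0 i))] =
  (lebesgue_measure A * m B)%E.
Proof.
move=> mA mB; rewrite -(product_measure1E lebesgue_measure m mA mB).
congr ((_ \x _)%E _); apply/seteqP; split=> -[a b] /=;
  rewrite consr0 (_ : \row_i _ = b)//;
  by apply/rowP => i; rewrite mxE consrS.
Qed.

Let lebS_sigma_finite : sigma_finite setT lebesgue_rVS.
Proof.
have /sigma_finiteP[F [TF ndF Foo]] := sigma_finiteT (@lebesgue_measure R).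
have /sigma_finiteP[G [TG ndG Goo]] := sigma_finiteT m.
exists (fun k => [set x : 'rV[R]_n.+1 | F k (x ord0 ord0) /\ G k (\row_i x ord0 (lift ord0 i))]).
  apply/seteqP; split=> // x _.
  have [k _ Fk] : (\bigcup_i F i) (x ord0 ord0) by rewrite -TF.
  have [l _ Gl] : (\bigcup_i G i) (\row_i x ord0 (lift ord0 i)) by rewrite -TG.
  exists (maxn k l) => //; split.
    by move: Fk; exact/subsetPset/ndF/leq_maxl.
  by move: Gl; exact/subsetPset/ndG/leq_maxr.
move=> k; have [mF Fk] := Foo k; have [mG Gk] := Goo k; split.
  apply: measurableI.
    have := measurable_coord (R := R) (@ord0 n) measurableT mF.
    by rewrite setTI.
  have mt : measurable_fun [set: 'rV[R]_n.+1]
      (fun x : 'rV[R]_n.+1 => \row_i x ord0 (lift ord0 i)).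
    apply: measurable_fun_rVP => i; under eq_fun do rewrite mxE.
    exact: measurable_coord.
  by have := mt measurableT _ mG; rewrite setTI.
by rewrite lebesgue_rVSX// lte_mul_pinfty// ge0_fin_numE.
Qed.

HB.instance Definition _ := Measure_isSigmaFinite.Build _ _ _ lebesgue_rVS
  lebS_sigma_finite.

End step.

Fixpoint lebesgue_rV n : {sigma_finite_measure set 'rV[R]_n -> \bar R} :=
  if n is n'.+1 then lebesgue_rVS (lebesgue_rV n') else \d_(0 : 'rV[R]_0).

Lemma lebesgue_rV_box n (a b : 'rV[R]_n) : (forall i, a ord0 i <= b ord0 i) ->
  lebesgue_rV n [set x : 'rV[R]_n | forall i, x ord0 i \in `[a ord0 i, b ord0 i]] =
  (\prod_(i < n) (b ord0 i - a ord0 i))%:E.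
Proof.
elim: n a b => [|n IH] a b ab.
  by rewrite big_ord0 /= diracE mem_set// => -[].
pose tl (x : 'rV[R]_n.+1) : 'rV[R]_n := \row_i x ord0 (lift ord0 i).
pose B := [set y : 'rV[R]_n | forall i,
  y ord0 i \in `[tl a ord0 i, tl b ord0 i]].
have mB : measurable B.
  rewrite (_ : B = \bigcap_(i in [set: 'I_n])
      (fun y : 'rV[R]_n => y ord0 i) @^-1` `[tl a ord0 i, tl b ord0 i]).
    apply: fin_bigcap_measurable => // i _.
    by rewrite -[X in measurable X]setTI; exact: measurable_coord.
  by apply/seteqP; split=> y yB i => [_|]; [exact: yB|exact: (yB i I)].
transitivity (lebesgue_rVS (lebesgue_rV n)
    [set x : 'rV[R]_n.+1 | `[a ord0 ord0, b ord0 ord0]%classic (x ord0 ord0) /\ B (tl x)]).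
  congr (lebesgue_rVS _ _); apply/seteqP; split=> x /=.
    by move=> xab; split=> [|i]; [exact: xab|rewrite !mxE; exact: xab].
  by case=> x0 xB i; case: (unliftP ord0 i) => [j ->|->//]; have := xB j; rewrite !mxE.
rewrite lebesgue_rVSX// big_ord_recl EFinM IH => [|i]; last by rewrite !mxE.
rewrite lebesgue_measure_itv/= lte_fin lt_neqAle ab andbT.
congr (_ * _)%E; last by congr EFin; apply: eq_bigr => i _; rewrite !mxE.
by case: eqP => [->|_]; rewrite ?subrr// EFinB.
Qed.

End lebesgue_rV.

Section euclidean.
Context {R : realType} {n : nat}.
Implicit Types x y : 'rV[R]_n.

Definition dotp x y : R := \sum_(i < n) x ord0 i * y ord0 i.

Definition enorm x : R := Num.sqrt (dotp x x).

Definition eball x (r : R) : set 'rV[R]_n := [set y | enorm (y - x) < r].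

Definition esphere : set 'rV[R]_n := [set x | enorm x = 1].

Definition angle x y : R := acos (dotp x y / (enorm x * enorm y)).

Definition cone x v (gamma : R) : set 'rV[R]_n :=
  [set y | angle (y - x) v < gamma].

End euclidean.

Definition boundary {T : topologicalType} (A : set T) : set T :=
  closure A `\` A°.

Section nonlocal.
Context {R : realType} {n : nat}.
Local Notation Rn := 'rV[R]_n.
Local Notation leb := (@lebesgue_rV R n).
Implicit Types (Omega N : set Rn) (u V f phi mu : Rn -> R).

(* The sigma-algebra on R^n is not completed: a Lebesgue measurable function is
   one that agrees almost everywhere with a Borel function. *)
Definition lmeasurable (D : set Rn) f :=
  exists2 g : Rn -> R, measurable_fun D g & {ae leb, forall x, D x -> f x = g x}.

Definition L1loc Omega f := lmeasurable Omega f /\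
  forall K, K `<=` Omega -> compact K ->
    (\int[leb]_(x in K) `|f x|%:E < +oo)%E.

Definition L1s_norm (s : R) f : \bar R :=
  (\int[leb]_x (`|f x| / (1 + enorm x `^ (n%:R + 2 * s)))%:E)%E.

Definition L1s (s : R) f := lmeasurable setT f /\ (L1s_norm s f < +oo)%E.

Definition Linfty f := lmeasurable setT f /\
  (ess_sup leb (fun x => `|f x|%:E) < +oo)%E.

(* C^k on an open set N, through iterated partial derivatives. *)
Fixpoint Ck (k : nat) N f : Prop :=
  if k is k'.+1 then
    [/\ (forall x, N x -> {for x, continuous f}),
        (forall i x, N x -> derivable f x (delta_mx ord0 i)) &
        forall i, Ck k' N ('D_(delta_mx ord0 i) f)]
  else forall x, N x -> {for x, continuous f}.

(* A function on the sphere is represented by a function on R^n whose values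
   off the sphere are irrelevant. *)
Definition angular_kernel (lambda Lambda : R) mu :=
  [/\ measurable_fun esphere mu,
      (forall theta, esphere theta -> lambda <= mu theta <= Lambda) &
      (forall theta, esphere theta -> mu (- theta) = mu theta)].

Definition Lop (s C : R) mu u (x : Rn) : \bar R :=
  (C%:E * \int[leb]_y ((u (x + y)%R + u (x - y)%R - 2 * u x) *
    mu ((enorm y)^-1 *: y) / enorm y `^ (n%:R + 2 * s))%:E)%E.

Definition Mminus (s lambda Lambda C : R) u (x : Rn) : \bar R :=
  ereal_inf [set Lop s C mu u x | mu in angular_kernel lambda Lambda].

(* M^-[u] + V u <= 0 in Omega, in the viscosity sense. *)
Definition viscosity_supersolution (s lambda Lambda C : R) Omega V u :=
  forall (x : Rn) N phi, open N -> N x -> N `<=` Omega ->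
    L1s s phi -> Ck 2 N phi -> phi x = u x -> (forall z, phi z <= u z) ->
    (Mminus s lambda Lambda C phi x + (V x * u x)%:E <= 0)%E.

Definition interior_balls Omega (x0 : Rn) (r0 : R) (xc : R -> Rn) :=
  forall r, 0 < r <= r0 -> eball (xc r) r `<=` Omega /\
    (boundary (eball (xc r) r) `&` boundary Omega) x0.

(* The bound V^- <= M is required at every point of Omega: the viscosity
   inequality reads V pointwise, possibly on a null set only (there are Hoelder
   functions that a C^2 function can touch from below on a null set only), so
   V is a function, not a class modulo null sets, and an essential bound would
   impose nothing. *)
Definition bounded_neg_part Omega V :=
  exists M : R, forall x, Omega x -> V^\- x <= M.

End nonlocal.

(* Main.v *)
(* Let w = (r^2 - |x - c|^2)_+^s on the interior ball B_r(c). The subsolution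
   delta w + 1_{B_(r/4)(c)} - u^-, suitably scaled, is compared with u, and
   w >= k |x - x0|^s in every cone about the inner normal. The comparison needs
   a lower bound L w >= - K in B_r(c), with K independent of r and of the kernel;
   the indicator of B_(r/4)(c) then makes up for K and for V^-, and the tail of
   u^- is controlled by its weighted L^1 norm.

   Averaging over dilations reduces L w to one-dimensional integrals over rays,
     int_0^oo (Q(t)_+^s + Q(-t)_+^s - 2 q0^s) t^(-1-2s) dt,
   where Q(t) = q0 + q1 t - m t^2. With sigma = 1/t, the first integrand is
   (sigma^2 q0 + sigma q1 - m)_+^s dsigma / sigma, and the shift
   sigma -> sigma + q1 / q0 in the second one produces the same numerator. With
   P = q0 sigma^2 + q1 sigma, the sum of the two is at least
   (P^(s-1) - m P^(s-2)) dP, whose primitive is explicit. *)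
Require Import Defs.
From HB Require Import structures.
From mathcomp Require Import all_boot all_order all_algebra.
From mathcomp Require Import all_classical all_reals all_analysis.
From mathcomp Require Import measurable_realfun ring lra.

Set Implicit Arguments.
Unset Strict Implicit.
Unset Printing Implicit Defensive.

Import Order.TTheory GRing.Theory Num.Theory.
Import numFieldNormedType.Exports.

Local Open Scope classical_set_scope.
Local Open Scope ring_scope.

(** * Calculus on intervals *)

(** On one line each half of the integrand diverges at 0, so the work is done on [[e, +oo[]. The
    shift does not preserve this domain: it matches the cut [e] on one half-line with the cut
    [e / (1 - a e)] on the other, [a = q1 / q0], and the leftover piece is balanced against the
    growth of the primitive. In the limit only the value of the primitive at [P = m] survives, and
    [m = |z|^2 <= 4] on the annulus used for averaging: this is why K sees neither the radius nor
    the point. Integrals are extended, and an undefined difference has the value [-oo]. Lower bounds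
    therefore take the form: negative part at most positive part plus K. This form can be averaged
    over directions; the finiteness of the negative part is proved separately, with a bound that is
    not uniform. Scaling fixes the coefficients. Since w is at most [r^(2 s)], delta is a small
    multiple of the height of the indicator times [r^(- 2 s)]. The indicator contributes its height
    times [r^(- 2 s)], so K costs a fixed fraction of that gain, whereas [V^-] costs only a bounded
    multiple of the height, which is negligible for small r. *)

Section calculus.
Context {R : realType}.
Notation mu := (@lebesgue_measure R).
Implicit Types (F G f : R -> R) (a b : R).

Lemma within_continuous_for (A : set R) f :
  (forall x, A x -> {for x, continuous f}) -> {within A, continuous f}.
Proof.
move=> cf; apply: continuous_in_subspaceT => x /set_mem; exact: cf.
Qed.

Lemma is_derive_oo_LRcontinuous F f a b :
  (forall x, a <= x <= b -> is_derive x 1 F (f x)) -> a <= b ->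
  derivable_oo_LRcontinuous F a b.
Proof.
move=> dF ab.
have cF x : a <= x <= b -> F z @[z --> x] --> F x.
  move=> xab; apply: differentiable_continuous; apply/derivable1_diffP.
  by have [] := dF x xab.
split.
- move=> x /[!in_itv]/= /andP[ax xb].
  have axb : a <= x <= b by rewrite (ltW ax) (ltW xb).
  by have [] := dF x axb.
- by apply: cvg_at_right_filter; apply: cF; rewrite lexx.
- by apply: cvg_at_left_filter; apply: cF; rewrite lexx andbT.
Qed.

Lemma integral_is_derive F f a b : a <= b ->
  (forall x, a <= x <= b -> is_derive x 1 F (f x)) ->
  (forall x, a <= x <= b -> {for x, continuous f}) ->
  (\int[mu]_(x in `[a, b]) (f x)%:E = (F b - F a)%:E)%E.
Proof.
rewrite le_eqVlt => /predU1P[<- *|ab dF cf].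
  by rewrite set_itv1 integral_set1 subrr.
rewrite (continuous_FTC2 (F := F))//.
- by apply: within_continuous_for => x /=; rewrite in_itv/=; exact: cf.
- exact: is_derive_oo_LRcontinuous dF (ltW ab).
- move=> x /[!in_itv]/= /andP[ax xb]; rewrite derive1E.
  have axb : a <= x <= b by rewrite (ltW ax) (ltW xb).
  by have [_ ->] := dF x axb.
Qed.

Lemma integral_substitution F f G a b : a <= b ->
  (forall x, a <= x <= b -> is_derive x 1 F (f x)) ->
  (forall x, a <= x <= b -> {for x, continuous f}) ->
  (forall x, a <= x <= b -> 0 < f x) ->
  (forall y, F a <= y <= F b -> {for y, continuous G}) ->
  (\int[mu]_(x in `[F a, F b]) (G x)%:E =
   \int[mu]_(x in `[a, b]) (G (F x) * f x)%:E)%E.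
Proof.
rewrite le_eqVlt => /predU1P[<- *|ab dF cf f0 cG].
  by rewrite !set_itv1 !integral_set1.
have dF' := is_derive_oo_LRcontinuous dF (ltW ab).
have Ff x : x \in `]a, b[ -> F^`()%classic x = f x.
  move=> /[!in_itv]/= /andP[ax xb]; rewrite derive1E.
  have axb : a <= x <= b by rewrite (ltW ax) (ltW xb).
  by have [_ ->] := dF x axb.
have cF := derivable_oo_LRcontinuous_within dF'.
have [fa fb] : {for a, continuous f} /\ {for b, continuous f}.
  by split; apply: cf; rewrite ?lexx ?(ltW ab).
have [dF1 _ _] := dF'.
have dF2 x : x \in `]a, b[%R -> 0 < F^`()%classic x.
  move=> xab; rewrite Ff//; apply: f0.
  by move: xab; rewrite in_itv/= => /andP[/ltW-> /ltW->].
have hm := gtr0_derive1_lt_cc dF1 dF2 cF.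
apply: etrans; first apply: (@integration_by_substitution_increasing R F G a b
  (ltW ab) hm).
- move=> x xab; have xab' : a <= x <= b.
    by move: xab; rewrite in_itv/= => /andP[/ltW-> /ltW->].
  rewrite /continuous_at Ff//; apply: cvg_trans (cf x xab').
  apply: near_eq_cvg; near=> y; apply/esym/Ff; near: y.
  exact: near_in_itvoo.
- apply/cvg_ex; exists (f a); have := cvg_at_right_filter fa; apply: cvg_trans.
  apply: near_eq_cvg; near=> y; apply/esym/Ff; rewrite in_itv/=.
  apply/andP; split; first by near: y; exact: nbhs_right_gt.
  by near: y; exact: nbhs_right_lt.
- apply/cvg_ex; exists (f b); have := cvg_at_left_filter fb; apply: cvg_trans.
  apply: near_eq_cvg; near=> y; apply/esym/Ff; rewrite in_itv/=.
  apply/andP; split; first by near: y; exact: nbhs_left_gt.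
  by near: y; exact: nbhs_left_lt.
- exact: dF'.
- by apply: within_continuous_for => x /=; rewrite in_itv/=; exact: cG.
have mI : measurable_fun `]a, b[ (EFin \o (fun x : R => G (F x) * f x)).
  apply/measurable_EFinP; apply: open_continuous_measurable_fun => //.
  move=> x xab; have xab' : a <= x <= b.
    by move: xab; rewrite inE/= in_itv/= => /andP[/ltW-> /ltW->].
  have dFx := dF x xab'.
  apply: cvgM; last exact: cf.
  apply: continuous_comp.
    by apply: differentiable_continuous; apply/derivable1_diffP; case: dFx.
  apply: cG; have /andP[ax xb] := xab'.
  have F_le y z : y \in `[a, b] -> z \in `[a, b] -> y <= z -> F y <= F z.
    move=> yab zab; rewrite le_eqVlt => /predU1P[->//|yz].
    exact/ltW/hm.
  by rewrite !F_le// in_itv/= ?ax ?xb ?lexx ?(ltW ab).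
have eqI : {in `]a, b[, (fun x => (G (F x) * f x)%:E) =1
    (fun x => (((G \o F) * F^`()%classic) x)%:E)}.
  by move=> x xab; rewrite /= fctE /= Ff.
have mI' : measurable_fun `]a, b[ (EFin \o ((G \o F) * F^`()%classic)).
  by apply: eq_measurable_fun mI => x /[!inE]; exact: eqI.
(* The endpoints are dropped because the derivative of [F] is replaced by [f] on the open interval
   only. *)
have e1 := integral_itv_bndoo true false mI.
have e2 := integral_itv_bndoo true false mI'.
rewrite [LHS]e2 [RHS]e1.
by apply: eq_integral => x /[!inE] /= xab; rewrite -eqI.
Unshelve. all: by end_near. Qed.

Lemma continuous_powR (p x : R) : 0 < x -> {for x, continuous (@powR R ^~ p)}.
Proof.
move=> x0; apply: differentiable_continuous; apply/derivable1_diffP.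
by apply: derivable_powR; rewrite in_itv/= x0.
Qed.

Lemma integral_powR_tail (p e : R) : 0 < p -> 0 < e ->
  (\int[mu]_(t in `[e, +oo[) (t `^ (-1 - p))%:E = (e `^ (- p) / p)%:E)%E.
Proof.
move=> p0 e0.
have dF (t : R) : 0 < t ->
    is_derive t 1 (fun t => (- p^-1) * t `^ (- p)) (t `^ (-1 - p)).
  move=> t0; apply: is_derive_eq.
    exact: (is_deriveZ (- p^-1) (is_derive1_powR (- p) t0)).
  by rewrite /GRing.scale/= (addrC (- p)) mulrA mulrNN mulVf ?gt_eqF// mul1r.
have dc (t : R) : 0 < t -> {for t, continuous (fun t => (- p^-1) * t `^ (- p))}.
  move=> t0; apply: differentiable_continuous; apply/derivable1_diffP.
  by case: (dF t t0).
rewrite (@ge0_continuous_FTC2y _ _ (fun t => (- p^-1) * t `^ (- p)) e 0).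
- by rewrite sub0e mulNr EFinN oppeK mulrC.
- by move=> *; exact: powR_ge0.
- apply: within_continuous_for => x /=; rewrite in_itv/= andbT => ex.
  by apply: continuous_powR; exact: lt_le_trans ex.
- rewrite -[X in _ --> X](mulr0 (- p^-1)); apply: cvgMr.
  apply/cvgrPdist_le => eps eps0; near=> t.
  have e1 : 0 < eps `^ (- p^-1) by exact: powR_gt0.
  have t1 : eps `^ (- p^-1) <= t.
    by near: t; apply: nbhs_pinfty_ge; exact: num_real.
  rewrite sub0r normrN ger0_norm ?powR_ge0// powRN.
  rewrite -[leRHS]invrK lef_pV2 ?posrE ?invr_gt0// ?powR_gt0 ?(lt_le_trans
    e1)//.
  rewrite -(powR_inv1 (ltW eps0)) (_ : -1 = (- p^-1) * p); last first.
    by field; rewrite gt_eqF.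
  by rewrite powRrM ge0_ler_powR ?nnegrE ?(ltW p0) ?powR_ge0// (le_trans _ t1)
    ?powR_ge0.
- by move=> x ex; case: (dF x (lt_trans e0 ex)).
- exact/cvg_at_right_filter/dc.
- move=> x /[!in_itv]/= /andP[ex _].
  by have [_ <-] := dF x (lt_trans e0 ex); rewrite derive1E.
Unshelve. all: by end_near. Qed.

(* [x `^ p] has the junk value [1] for [x < 0], hence the [Num.max x 0]. *)
Lemma continuous_pospowR (p : R) : 0 < p ->
  continuous (fun x : R => Num.max x 0 `^ p).
Proof.
move=> p0 x; have [x0|x0|<-] := ltgtP 0 x.
- rewrite /continuous_at max_l ?(ltW x0)//.
  apply: cvg_trans (@continuous_powR p x x0); apply: near_eq_cvg; near=> y.
  by rewrite max_l// ltW//; near: y; exact: lt_nbhsr.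
- rewrite /continuous_at (max_r (ltW x0)).
  apply: cvg_trans (@cvg_cst _ (0 `^ p) _ (nbhs x) _); apply: near_eq_cvg;
    near=> y.
  by rewrite max_r// ltW//; near: y; exact: lt_nbhsl.
- rewrite /continuous_at maxxx powR0 ?gt_eqF//.
  apply/cvgrPdist_le => eps eps0; near=> y.
  rewrite sub0r normrN ger0_norm ?powR_ge0//.
  have e1 : 0 < eps `^ p^-1 by exact: powR_gt0.
  have -> : eps = (eps `^ p^-1) `^ p.
    by rewrite -powRrM mulVf ?gt_eqF// powRr1// ltW.
  rewrite ge0_ler_powR ?nnegrE ?(ltW p0) ?(ltW e1) ?le_max ?lexx ?orbT//.
  rewrite ge_max (ltW e1) andbT; apply/ltW; near: y; exact/lt_nbhsl/powR_gt0.
Unshelve. all: by end_near. Qed.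

(** For [P > m], factor out [P^s]: the ratio [1 - m / P] lies in (0, 1], where [x <= x^s]. For
    [P <= m] the left side is nonpositive. *)
Lemma pospowR_ge (s m P : R) : 0 < s < 1 -> 0 <= m -> 0 < P ->
  P `^ s - m * P `^ (s - 1) <= Num.max (P - m) 0 `^ s.
Proof.
move=> /andP[s0 s1] m0 P0.
have -> : P `^ s = P * P `^ (s - 1) by rewrite mulr_powRB1// ltW.
rewrite -mulrBl; have [Pm|mP] := leP P m.
  apply: le_trans (powR_ge0 _ _).
  by rewrite mulr_le0_ge0 ?powR_ge0// subr_le0.
have d0 : 0 < P - m by rewrite subr_gt0.
rewrite max_l ?(ltW d0)//.
have -> : P - m = P * ((P - m) / P) by field; rewrite gt_eqF.
rewrite powRM ?(ltW P0) ?divr_ge0 ?(ltW P0) ?(ltW d0)//.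
rewrite mulrAC mulr_powRB1 ?(ltW P0)// ler_wpM2l ?powR_ge0//.
rewrite ger1_powR ?(ltW s1)// divr_gt0//= ler_pdivrMr// mul1r.
by rewrite gerBl.
Qed.

(** The step [sigma = 1 / t] of the overview: taking [t^2] out of the positive part yields
    [t^(2 s)], which reduces the weight to [1 / t]. *)
Lemma pospowR_rescale (s q m t : R) : 0 < s -> 0 < t ->
  Num.max (q - m * t ^+ 2) 0 `^ s * t `^ (-1 - 2 * s) =
  Num.max (q / t ^+ 2 - m) 0 `^ s / t.
Proof.
move=> s0 t0; have t20 : 0 < t ^+ 2 by rewrite exprn_gt0.
have -> : Num.max (q - m * t ^+ 2) 0 = t ^+ 2 * Num.max (q / t ^+ 2 - m) 0.
  rewrite maxr_pMr ?(ltW t20)// mulr0; congr (Num.max _ _).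
  by field; rewrite gt_eqF.
rewrite powRM ?le_max ?lexx ?orbT ?(ltW t20)//.
rewrite -powR_mulrn ?(ltW t0)// -powRrM.
rewrite mulrAC -powRD; last by rewrite (gt_eqF t0) implybT.
rewrite (_ : 2 * s + (-1 - 2 * s) = -1); last by ring.
by rewrite powR_inv1 ?(ltW t0)// mulrC.
Qed.

End calculus.

(** * The fractional Laplacian of a truncated parabola *)

Section line.
Context {R : realType}.
Notation mu := (@lebesgue_measure R).

Lemma itv_continuous_measurable (f : R -> R) (a b : R) :
  (forall x, a <= x <= b -> {for x, continuous f}) ->
  measurable_fun `[a, b] (EFin \o f).
Proof.
move=> cf; apply/measurable_EFinP.
apply: subspace_continuous_measurable_fun; first exact: measurable_itv.
by apply: within_continuous_for => x /=; rewrite in_itv/=; exact: cf.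
Qed.

Lemma is_derive_continuous (f : R -> R) (x d : R) :
  is_derive x 1 f d -> {for x, continuous f}.
Proof.
by move=> [df _]; apply: differentiable_continuous; apply/derivable1_diffP.
Qed.

Lemma is_derive_ext (f g : R -> R) (x d d' : R) :
  is_derive x 1 f d -> f =1 g -> d = d' -> is_derive x 1 g d'.
Proof. by move=> df /funext <- <-. Qed.

(** The polynomial [P] of the overview at [sigma = 1 / t]; [t] is kept as the variable. *)
Definition inv_quad (q0 q1 t : R) : R := q0 * t^-1 ^+ 2 + q1 * t^-1.

Lemma is_derive_inv (t : R) : t != 0 -> is_derive t 1 (fun t => t^-1) (- t^-1
  ^+ 2).
Proof.
move=> t0; apply: is_derive_eq; first exact: (is_deriveV t0 (is_derive_id t 1)).
by rewrite /GRing.scale/= mulr1 exprVn.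
Qed.

Lemma is_derive_inv_quad (q0 q1 t : R) : t != 0 ->
  is_derive t 1 (inv_quad q0 q1) (- (t^-1 ^+ 2 * (2 * q0 * t^-1 + q1))).
Proof.
move=> t0; have h := is_derive_inv t0; apply: (is_derive_ext (is_deriveD
  (is_deriveZ q0 (is_deriveX 2 h)) (is_deriveZ q1 h))) => //.
by rewrite /GRing.scale/=; ring.
Qed.

Lemma inv_quad_gt0 (q0 q1 t : R) : 0 < q0 -> 0 <= q1 -> 0 < t -> 0 < inv_quad
  q0 q1 t.
Proof.
move=> q00 q10 t0; rewrite /inv_quad ltr_pwDl//.
  by rewrite mulr_gt0// exprn_gt0 ?invr_gt0.
by rewrite mulr_ge0 ?invr_ge0// ltW.
Qed.

(* The primitive [P^s / s + m P^(s-1) / (1 - s)] of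
   [(P^(s-1) - m P^(s-2)) P'] is what survives after the change of variable
   [t / (1 + (q1 / q0) t)] has matched the two half-lines. *)
Lemma ray_window (s q0 q1 m e th : R) : 0 < s < 1 -> 0 < q0 -> 0 <= q1 ->
  0 < m -> 0 < e -> e <= th -> inv_quad q0 q1 th = m ->
  ((inv_quad q0 q1 e `^ s / s - m `^ s * (s^-1 + (1 - s)^-1))%R%:E <=
   \int[mu]_(t in `[e, th]) (Num.max (inv_quad q0 q1 t - m) 0 `^ s / t)%R%:E +
   \int[mu]_(t in `[(e / (1 + q1 / q0 * e))%R, (th / (1 + q1 / q0 * th))%R])
     (Num.max (inv_quad q0 (- q1) t - m) 0 `^ s / t)%R%:E)%E.
Proof.
move=> /andP[s0 s1] q00 q10 m0 e0 eth Pth.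
set a := q1 / q0.
have a0 : 0 <= a by rewrite divr_ge0// ltW.
have q1E : q1 = a * q0 by rewrite /a divfK// gt_eqF.
(* [F] is the translation by [a] in the variable [1 / t], and [f] is its derivative in [t]. *)
pose F t : R := t / (1 + a * t); pose f t : R := (1 + a * t)^-1 ^+ 2.
pose G t : R := Num.max (inv_quad q0 (- q1) t - m) 0 `^ s / t.
have tpos t : e <= t <= th -> 0 < t by move=> /andP[et _]; exact: lt_le_trans
  et.
have at0 t : e <= t <= th -> 0 < 1 + a * t.
  by move=> /tpos t0; rewrite ltr_pwDl// mulr_ge0// ltW.
have dlin (t : R) : is_derive t 1 (fun t : R => 1 + a * t) a.
  apply: (is_derive_ext (is_deriveD (is_derive_cst (1 : R) t 1) (is_deriveZ a
    (is_derive_id t 1)))) => //.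
  by rewrite /GRing.scale/= mulr1 add0r.
have cV (t : R) : e <= t <= th -> {for t, continuous (fun t : R => (1 + a *
  t)^-1)}.
  move=> tth; have n0 : 1 + a * t != 0 by rewrite gt_eqF// at0.
  exact: is_derive_continuous (@is_deriveV _ (fun t : R => 1 + a * t) _ _ _ n0
    (dlin t)).
have dF (t : R) : e <= t <= th -> is_derive t 1 F (f t).
  move=> tth; have n0 : 1 + a * t != 0 by rewrite gt_eqF// at0.
  have h1 := @is_deriveV _ (fun t : R => 1 + a * t) _ _ _ n0 (dlin t).
  have h2 := is_deriveM (is_derive_id t 1) h1.
  apply: (is_derive_ext h2) => //.
  by rewrite /f /GRing.scale/= exprVn; field.
have cG (p q t : R) : 0 < t -> {for t, continuous (fun t : R => Num.max
  (inv_quad p q t - m) 0 `^ s / t)}.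
  move=> t0; apply: cvgM.
    apply: (continuous_comp (f := fun t : R => inv_quad p q t - m) (g := fun x
      => Num.max x 0 `^ s)).
      apply: cvgB; last exact: cvg_cst.
      by apply: is_derive_continuous; apply: is_derive_inv_quad; rewrite gt_eqF.
    exact: continuous_pospowR.
  by apply: is_derive_continuous; apply: is_derive_inv; rewrite gt_eqF.
have -> : (\int[mu]_(t in `[(e / (1 + a * e))%R, (th / (1 + a * th))%R]) (G
  t)%:E =
   \int[mu]_(t in `[e, th]) (G (F t) * f t)%R%:E)%E.
  apply: (@integral_substitution R F f G e th) => //.
  - by move=> t tth; exact: (cvgM (cV _ tth) (cV _ tth)).
  - by move=> t tth; rewrite exprn_gt0// invr_gt0 at0.
  - move=> y /andP[Fy _]; apply: cG; apply: lt_le_trans Fy.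
    by rewrite divr_gt0// at0// lexx.
(* [(P^(s-1) - m P^(s-2)) P'] with the sign reversed, since [P] decreases in [t]. *)
pose g t : R := (inv_quad q0 q1 t `^ (s - 1) - m * inv_quad q0 q1 t `^ (s - 2))
  *
  (t^-1 ^+ 2 * (2 * q0 * t^-1 + q1)).
have dE (t : R) : e <= t <= th -> is_derive t 1
    (fun t : R => - s^-1 * inv_quad q0 q1 t `^ s + - (m / (1 - s)) * inv_quad
      q0 q1 t `^ (s - 1)) (g t).
  move=> tth; have t0 := tpos _ tth.
  have P0 := inv_quad_gt0 q00 q10 t0.
  have dP := is_derive_inv_quad q0 q1 (lt0r_neq0 t0).
  apply: (is_derive_ext (is_deriveD (is_deriveZ (- s^-1) (is_derive1_comp
    (is_derive1_powR s P0) dP))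
      (is_deriveZ (- (m / (1 - s))) (is_derive1_comp (is_derive1_powR (s - 1)
        P0) dP)))) => //.
  rewrite /GRing.scale/= /g (_ : s - 1 - 1 = s - 2); last by ring.
  by field; rewrite subr_eq0 !gt_eqF.
have Pm t : e <= t <= th -> m <= inv_quad q0 q1 t.
  move=> tth; rewrite -Pth /inv_quad; have t0 := tpos _ tth.
  have th0 := lt_le_trans e0 eth; case/andP: tth => _ tth.
  have tV : th^-1 <= t^-1 by rewrite lef_pV2.
  rewrite lerD// ler_wpM2l ?(ltW q00)//.
  by rewrite lerXn2r// nnegrE invr_ge0 ltW.
have powB2 t : e <= t <= th ->
    inv_quad q0 q1 t `^ (s - 1) = inv_quad q0 q1 t * inv_quad q0 q1 t `^ (s -
      2).
  move=> tth; have P0 := lt_le_trans m0 (Pm _ tth).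
  rewrite -[X in X * _ `^ _]powRr1 ?(ltW P0)// -powRD; last by rewrite (gt_eqF
    P0) implybT.
  by congr (_ `^ _); ring.
have g0 t : e <= t <= th -> 0 <= g t.
  move=> tth; have t0 := tpos _ tth.
  rewrite /g powB2// -mulrBl; apply: mulr_ge0.
    by rewrite mulr_ge0 ?powR_ge0 ?subr_ge0 ?Pm.
  rewrite mulr_ge0 ?sqr_ge0// addr_ge0// mulr_ge0 ?invr_ge0 ?(ltW t0)//.
  by rewrite mulr_ge0// ltW.
have cg (t : R) : e <= t <= th -> {for t, continuous g}.
  move=> tth; have t0 := tpos _ tth.
  have P0 := inv_quad_gt0 q00 q10 t0.
  have cP : {for t, continuous (inv_quad q0 q1)}.
    exact: is_derive_continuous (is_derive_inv_quad q0 q1 (lt0r_neq0 t0)).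
  have cPp p : {for t, continuous (fun t : R => inv_quad q0 q1 t `^ p)}.
    apply: (continuous_comp (f := inv_quad q0 q1) (g := fun x : R => x `^ p))
      => //.
    exact: continuous_powR.
  have cV' : {for t, continuous (fun t : R => t^-1)}.
    exact: is_derive_continuous (is_derive_inv (lt0r_neq0 t0)).
  apply: cvgM.
    apply: cvgB; first exact: cPp.
    by apply: cvgM; [exact: cvg_cst|exact: cPp].
  apply: cvgM; first exact: (cvgM cV' cV').
  apply: cvgD; last exact: cvg_cst.
  by apply: cvgM; [exact: cvg_cst|exact: cV'].
have ig : (\int[mu]_(t in `[e, th]) (g t)%:E =
    (inv_quad q0 q1 e `^ s / s + m / (1 - s) * inv_quad q0 q1 e `^ (s - 1)
     - m `^ s * (s^-1 + (1 - s)^-1))%R%:E)%E.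
  rewrite (integral_is_derive eth dE cg) Pth; congr EFin.
  have -> : m `^ s = m * m `^ (s - 1) by rewrite mulr_powRB1// ltW.
  by ring.
(* The nonnegative term [m / (1 - s) * P(e)^(s-1)] is dropped; the value at [th], where [P = m],
   gives the constant. *)
apply: (@le_trans _ _ (\int[mu]_(t in `[e, th]) (g t)%:E)%E).
  rewrite ig lee_fin lerD2r lerDl mulr_ge0 ?powR_ge0// divr_ge0 ?(ltW m0)//.
  by rewrite subr_ge0 ltW.
(* [P] with slope [- q1] at [sigma + a] equals [P] with slope [q1] at [sigma], because
   [q1 = a q0]. *)
have GF t : e <= t <= th -> G (F t) * f t =
    Num.max (inv_quad q0 q1 t - m) 0 `^ s / t * (1 + a * t)^-1.
  move=> tth; have t0 := tpos _ tth; have b0 := at0 _ tth.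
  have -> : G (F t) = Num.max (inv_quad q0 q1 t - m) 0 `^ s / F t.
    rewrite /G; congr (Num.max (_ - _) _ `^ _ / _).
    by rewrite /inv_quad /F q1E; field; rewrite !gt_eqF.
  by rewrite /F /f; field; rewrite !gt_eqF.
have nn t : e <= t <= th -> 0 <= Num.max (inv_quad q0 q1 t - m) 0 `^ s / t.
  by move=> /tpos t0; rewrite divr_ge0 ?powR_ge0// ltW.
have cFf (t : R) : e <= t <= th -> {for t, continuous (fun t : R => G (F t) * f
  t)}.
  move=> tth; apply: cvgM.
    apply: (continuous_comp (f := F) (g := G)).
      exact: is_derive_continuous (dF _ tth).
    by apply: cG; rewrite divr_gt0 ?at0// (tpos _ tth).
  exact: (cvgM (cV _ tth) (cV _ tth)).
have mf1 : measurable_fun `[e, th]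
    (EFin \o (fun t : R => Num.max (inv_quad q0 q1 t - m) 0 `^ s / t)).
  by apply: itv_continuous_measurable => t /tpos t0; exact: cG.
have mf2 := itv_continuous_measurable cFf.
have nn1 t : `[e, th]%classic t ->
    (0 <= (EFin \o (fun t => Num.max (inv_quad q0 q1 t - m) 0 `^ s / t)%R) t)%E.
  by rewrite /= in_itv/= lee_fin => /nn.
have nn2 t : `[e, th]%classic t -> (0 <= (EFin \o (fun t => (G (F t) * f t)%R))
  t)%E.
  rewrite /= in_itv/= lee_fin => tth; rewrite GF// mulr_ge0 ?nn//.
  by rewrite invr_ge0 ltW// at0.
rewrite -[leRHS](ge0_integralD mu (measurable_itv _) nn1 mf1 nn2 mf2).
apply: ge0_le_integral => //.
- exact: itv_continuous_measurable cg.
- exact: emeasurable_funD.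
- move=> t; rewrite /= in_itv/= => tth; rewrite lee_fin GF//.
  have t0 := tpos _ tth; have b0 := at0 _ tth.
  have P0 := lt_le_trans m0 (Pm _ tth).
  have s01 : 0 < s < 1 by rewrite s0.
  (* With [q1 = a q0], [- P' / P = (1 + 1 / (1 + a t)) / t], which is the total weight of the two
     matched integrands. *)
  have -> : g t = (inv_quad q0 q1 t `^ s - m * inv_quad q0 q1 t `^ (s - 1)) *
      (t^-1 * (1 + (1 + a * t)^-1)).
    have -> : inv_quad q0 q1 t `^ s = inv_quad q0 q1 t * inv_quad q0 q1 t `^ (s
      - 1).
      by rewrite mulr_powRB1// ltW.
    rewrite /g powB2//; set p := _ `^ (s - 2).
    by rewrite /inv_quad q1E; field; rewrite !gt_eqF.
  have -> : Num.max (inv_quad q0 q1 t - m) 0 `^ s / t +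
      Num.max (inv_quad q0 q1 t - m) 0 `^ s / t / (1 + a * t) =
      Num.max (inv_quad q0 q1 t - m) 0 `^ s * (t^-1 * (1 + (1 + a * t)^-1)).
    by ring.
  rewrite ler_wpM2r ?(pospowR_ge s01 (ltW m0) P0)//.
  by rewrite mulr_ge0 ?addr_ge0// ?invr_ge0 ltW.
Qed.
End line.

(** * Truncation of the two rays at the same point *)

Section line_cut.
Context {R : realType}.
Notation mu := (@lebesgue_measure R).

(* The restriction of [(r^2 - |.|^2)_+^s] to a line, in the variable [t],
   against the kernel of the one-dimensional fractional Laplacian. *)
Definition ray_term (s q0 q1 m t : R) : R :=
  Num.max (q0 + q1 * t - m * t ^+ 2) 0 `^ s * t `^ (-1 - 2 * s).

Lemma measurable_ray_term (s q0 q1 m : R) (D : set R) : 0 < s ->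
  measurable_fun D (EFin \o ray_term s q0 q1 m).
Proof.
move=> s0; apply: measurable_funTS; apply/measurable_EFinP.
apply: measurable_funM; last exact: measurable_powR.
apply: continuous_measurable_fun => t.
apply: (continuous_comp (f := fun t : R => q0 + q1 * t - m * t ^+ 2)
  (g := fun x : R => Num.max x 0 `^ s)); last exact: continuous_pospowR.
apply: cvgB; first by apply: cvgD; [exact: cvg_cst|apply: cvgM; [exact:
  cvg_cst|]].
by apply: cvgM; [exact: cvg_cst|exact: exprn_continuous].
Qed.

Lemma ray_term_ge0 (s q0 q1 m t : R) : 0 <= ray_term s q0 q1 m t.
Proof. by rewrite mulr_ge0 ?powR_ge0. Qed.

Lemma ray_termE (s q0 q1 m t : R) : 0 < s -> 0 < t ->
  ray_term s q0 q1 m t = Num.max (inv_quad q0 q1 t - m) 0 `^ s / t.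
Proof.
move=> s0 t0; rewrite /ray_term pospowR_rescale//.
by congr (Num.max (_ - _) _ `^ _ / _); rewrite /inv_quad; field; rewrite gt_eqF.
Qed.

(** The primitive of [ray_window] at [P = m], where the rays leave the ball; neither [q0] nor [q1]
    enters. *)
Definition ray_const (s m : R) : R := m `^ s * (s^-1 + (1 - s)^-1).

(* With [N = 1 / e] and [a = q1 / q0], the boundary terms at the truncation
   add up to [- q0^s (N^s - (N - a)^s)^2 / (2 s)], which tends to [0]. *)
Lemma ray_cut (s q0 q1 m : R) : 0 < s < 1 -> 0 < q0 -> 0 <= q1 -> 0 < m ->
  exists2 e0, 0 < e0 & forall e, 0 < e < e0 ->
  ((q0 `^ s * (e `^ (- (2 * s)) / s))%R%:E <=
   \int[mu]_(t in `[e, +oo[) (ray_term s q0 q1 m t)%:E +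
   \int[mu]_(t in `[e, +oo[) (ray_term s q0 (- q1) m t)%:E +
   (ray_const s m + 1)%R%:E)%E.
Proof.
move=> s01 q00 q10 m0; have /andP[s0 s1] := s01.
set a := q1 / q0.
have a0 : 0 <= a by rewrite divr_ge0// ltW.
have q1E : q1 = a * q0 by rewrite /a divfK// gt_eqF.
(* The positive root of [m t^2 = q1 t + q0]. *)
pose th := (q1 + Num.sqrt (q1 ^+ 2 + 4 * m * q0)) / (2 * m).
have D0 : 0 < q1 ^+ 2 + 4 * m * q0 by rewrite ltr_wpDl ?sqr_ge0// !mulr_gt0.
have th0 : 0 < th by rewrite divr_gt0 ?mulr_gt0// ltr_wpDl// sqrtr_gt0.
have thE : inv_quad q0 q1 th = m.
  have : m * th ^+ 2 = q0 + q1 * th.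
    have := sqr_sqrtr (ltW D0); rewrite /th; set r := Num.sqrt _ => rE.
    apply: (@mulfI _ (4 * m)); first by rewrite gt_eqF// mulr_gt0.
    transitivity ((q1 + r) ^+ 2); first by field; rewrite gt_eqF.
    rewrite sqrrD rE; field; by rewrite gt_eqF.
  by move=> h; rewrite /inv_quad -[RHS](@mulfK _ (th ^+ 2)) ?gt_eqF
    ?exprn_gt0// h; field; rewrite gt_eqF.
(* For [e < e1] one has [(a e^(1-s))^2 <= 2 s / q0^s], which bounds the boundary error by the [1] of
   the statement. *)
pose e1 := (2 * s / (q0 `^ s * (a ^+ 2 + 1))) `^ (2 - 2 * s)^-1.
have a21 : 0 < a ^+ 2 + 1 by rewrite ltr_wpDl ?sqr_ge0.
have e10 : 0 < e1 by rewrite powR_gt0// divr_gt0 ?mulr_gt0 ?powR_gt0.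
(* For [t <= q1 / m] one has [m t^2 <= q1 t], so the integrand on [[e, e'[] is at least
   [q0^s t^(-1-2s)]. The factor 1/2 accounts for [e' <= 2 e]; if [q1 = 0] this interval is empty. *)
pose e2 := if q1 == 0 then 1 else q1 / m / 2.
have e20 : 0 < e2.
  by rewrite /e2; case: eqP => // /eqP q1n; rewrite !divr_gt0// lt_neqAle
    eq_sym q1n.
exists (Num.min (Num.min e1 e2) (Num.min (th / 2) (2 * a + 1)^-1)).
  by rewrite !lt_min e10 e20 divr_gt0//= invr_gt0 ltr_wpDl// mulr_ge0.
move=> e /andP[e0]; rewrite !lt_min => /andP[/andP[ee1 ee2] /andP[eth eea]].
have ae : a * e <= 2^-1.
  have : e * (2 * a + 1) < 1 by rewrite -ltr_pdivlMr ?div1r// ltr_wpDl//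
    mulr_ge0.
  by move=> h; rewrite -(@ler_pM2l _ 2)// mulfV// (le_trans _ (ltW h))//; nra.
have ae1 : 0 < 1 - a * e by rewrite subr_gt0 (le_lt_trans ae)// invf_lt1 ?ltr1n.
(* The preimage of [e] under [t / (1 + a t)]: the window on the second ray then starts exactly at
   [e], and [[e, e'[] on the first ray is estimated apart. *)
have [e' e'E] : exists e', e' = e / (1 - a * e) by exists (e / (1 - a * e)).
have ee' : e <= e' by rewrite e'E ler_pdivlMr// ler_piMr ?(ltW e0)// gerBl
  mulr_ge0// ltW.
have e'0 : 0 < e' by rewrite e'E divr_gt0.
have e'2 : e' <= 2 * e by rewrite e'E ler_pdivrMr//; nra.
have e'th : e' <= th by apply: le_trans e'2 _; lra.
have Fe' : e' / (1 + a * e') = e.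
  rewrite e'E; field; rewrite gt_eqF//=.
  by rewrite (_ : _ + _ = 1) ?oner_eq0//; ring.
have w := ray_window s01 q00 q10 m0 e'0 e'th thE.
have i0 : ((q0 `^ s * ((e `^ (- (2 * s)) - e' `^ (- (2 * s))) / (2 * s)))%R%:E
  <=
    \int[mu]_(t in `[e, e'[) (ray_term s q0 q1 m t)%:E)%E.
  have c t : e <= t <= e' -> {for t, continuous (fun t : R => q0 `^ s * t `^
    (-1 - 2 * s))}.
    move=> /andP[et _]; apply: cvgM; first exact: cvg_cst.
    by apply: continuous_powR; exact: lt_le_trans et.
  have -> : (q0 `^ s * ((e `^ (- (2 * s)) - e' `^ (- (2 * s))) / (2 * s)))%R%:E
    =
      (\int[mu]_(t in `[e, e']) (q0 `^ s * t `^ (-1 - 2 * s))%R%:E)%E.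
    have dE (t : R) : e <= t <= e' -> is_derive t 1
        (fun t : R => - (q0 `^ s / (2 * s)) * t `^ (- (2 * s)))
        (q0 `^ s * t `^ (-1 - 2 * s)).
      move=> /andP[et _]; have t0 := lt_le_trans e0 et.
      apply: (is_derive_ext (is_deriveZ (- (q0 `^ s / (2 * s)))
        (is_derive1_powR (- (2 * s)) t0))) => //.
      rewrite /GRing.scale/= (addrC (- (2 * s))); field.
      by rewrite gt_eqF.
    by rewrite (integral_is_derive ee' dE c); congr EFin; ring.
  have mc := itv_continuous_measurable c.
  apply: (@le_trans _ _ (\int[mu]_(t in `[e, e'[) (q0 `^ s * t `^ (-1 - 2 *
    s))%R%:E)%E).
    rewrite le_eqVlt; apply/orP; left; apply/eqP/esym.
    apply: integral_itv_bndo_bndc; apply: measurable_funS mc => // t /=.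
    by rewrite !in_itv/= => /andP[-> /ltW].
  apply: ge0_le_integral => //.
  - by move=> t _; rewrite lee_fin mulr_ge0 ?powR_ge0.
  - apply: measurable_funS mc => // t /=.
    by rewrite !in_itv/= => /andP[-> /ltW].
  - exact: measurable_ray_term.
  - move=> t; rewrite /= in_itv/= => /andP[et te'].
    have t0 := lt_le_trans e0 et.
    rewrite lee_fin ler_wpM2r ?powR_ge0// ge0_ler_powR ?nnegrE ?(ltW s0) ?(ltW
      q00)//.
      by rewrite le_max lexx orbT.
    rewrite le_max; apply/orP; left.
    have mt : m * t <= q1.
      move: ee2 te' e'2; rewrite /e2 e'E; case: eqP => [q1z|_].
        by rewrite /a q1z !mul0r subr0 divr1 => _ te; rewrite leNgt te in et.
      rewrite ltr_pdivlMr// ltr_pdivlMr// => ee te e2'; rewrite mulrC.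
      by rewrite mulrC; nra.
    by nra.
have i1 : (\int[mu]_(t in `[e, e'[) (ray_term s q0 q1 m t)%:E +
    \int[mu]_(t in `[e', th]) (Num.max (inv_quad q0 q1 t - m) 0 `^ s / t)%R%:E
      <=
    \int[mu]_(t in `[e, +oo[) (ray_term s q0 q1 m t)%:E)%E.
  have -> : (\int[mu]_(t in `[e', th]) (Num.max (inv_quad q0 q1 t - m) 0 `^ s /
    t)%R%:E =
      \int[mu]_(t in `[e', th]) (ray_term s q0 q1 m t)%:E)%E.
    apply: eq_integral => t /[!inE]; rewrite /= in_itv/= => /andP[e't _].
    by rewrite ray_termE// (lt_le_trans e'0).
  rewrite -[leLHS]ge0_integral_setU//; last 3 first.
  - exact: measurable_ray_term.
  - by move=> t _; rewrite lee_fin ray_term_ge0.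
  - apply/disj_setPS => t [/=]; rewrite !in_itv/= => /andP[_ te'] /andP[e't _].
    by rewrite leNgt te' in e't.
  apply: ge0_subset_integral => //.
  - exact: measurableU.
  - exact: measurable_ray_term.
  - by move=> t _; rewrite lee_fin ray_term_ge0.
  - move=> t [|] /=; rewrite !in_itv/= andbT => /andP[] //.
    by move=> e't _; exact: le_trans e't.
have i2 : (\int[mu]_(t in `[(e' / (1 + q1 / q0 * e'))%R, (th / (1 + q1 / q0 *
  th))%R])
     (Num.max (inv_quad q0 (- q1) t - m) 0 `^ s / t)%R%:E <=
    \int[mu]_(t in `[e, +oo[) (ray_term s q0 (- q1) m t)%:E)%E.
  rewrite Fe'.
  set J := `[e, _]%classic.
  have -> : (\int[mu]_(t in J) (Num.max (inv_quad q0 (- q1) t - m) 0 `^ s /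
    t)%R%:E =
      \int[mu]_(t in J) (ray_term s q0 (- q1) m t)%:E)%E.
    apply: eq_integral => t /[!inE]; rewrite /J /= in_itv/= => /andP[et _].
    by rewrite ray_termE// (lt_le_trans e0).
  apply: ge0_subset_integral => //.
  - exact: measurable_itv.
  - exact: measurable_ray_term.
  - by move=> t _; rewrite lee_fin ray_term_ge0.
  - by move=> t; rewrite /J /= !in_itv/= andbT => /andP[].
have key : q0 `^ s * (e `^ (- (2 * s)) / s) <=
   q0 `^ s * ((e `^ (- (2 * s)) - e' `^ (- (2 * s))) / (2 * s)) +
   inv_quad q0 q1 e' `^ s / s + 1.
  (* [1 / e' = 1 / e - a], so [P(e') = q0 (1/e - a) (1/e - a + a)]. *)
  have -> : inv_quad q0 q1 e' = q0 * (e^-1 * e'^-1).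
    rewrite -[in RHS]Fe' /inv_quad q1E; field.
    by rewrite !gt_eqF// ltr_pwDl// mulr_ge0// ltW.
  rewrite powRM ?(ltW q00) ?mulr_ge0 ?invr_ge0 ?(ltW e0) ?(ltW e'0)//.
  rewrite (@powRM _ e^-1 e'^-1) ?invr_ge0 ?(ltW e0) ?(ltW e'0)//.
  have sq (x : R) : 0 < x -> x `^ (- (2 * s)) = (x^-1 `^ s) ^+ 2.
    move=> x0; rewrite -powR_mulrn ?powR_ge0// -powRrM -powR_inv1 ?(ltW x0)//.
    by rewrite -powRrM; congr (_ `^ _); ring.
  rewrite (sq e e0) (sq e' e'0); set X := e^-1 `^ s; set Y := e'^-1 `^ s.
  have XY : 0 <= X - Y <= a * e * X.
    have -> : Y = X * (1 - a * e) `^ s.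
      rewrite /Y e'E invf_div mulrC powRM ?invr_ge0 ?(ltW e0) ?(ltW ae1)//.
    have le1 : 1 - a * e <= 1 by rewrite gerBl mulr_ge0// ltW.
    have X0 : 0 <= X by exact: powR_ge0.
    have u1 : (1 - a * e) `^ s <= 1.
      apply: (@le_trans _ _ (1 `^ s)); last by rewrite powR1.
      by rewrite ge0_ler_powR ?nnegrE ?(ltW s0) ?(ltW ae1).
    have u2 : 1 - a * e <= (1 - a * e) `^ s by rewrite ger1_powR ?ae1 ?(ltW s1).
    by apply/andP; split; nra.
  have XY2 : (X - Y) ^+ 2 <= 2 * s / q0 `^ s.
    apply: (@le_trans _ _ ((a * e * X) ^+ 2)).
      by case/andP: XY => h1 h2; rewrite lerXn2r// nnegrE// (le_trans h1).
    have -> : (a * e * X) ^+ 2 = a ^+ 2 * e `^ (2 - 2 * s).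
      rewrite exprMn exprMn /X -(sq e e0) -(powR_mulrn 2 (ltW e0)) -mulrA
        -powRD//.
      by rewrite (gt_eqF e0) implybT.
    have : e `^ (2 - 2 * s) <= 2 * s / (q0 `^ s * (a ^+ 2 + 1)).
      have p0 : 0 < 2 - 2 * s by lra.
      have Z0 : 0 <= 2 * s / (q0 `^ s * (a ^+ 2 + 1)).
        by rewrite divr_ge0 ?mulr_ge0 ?powR_ge0 ?(ltW s0) ?(ltW a21).
      have e1E : e1 `^ (2 - 2 * s) = 2 * s / (q0 `^ s * (a ^+ 2 + 1)).
        by rewrite /e1 -powRrM mulVf ?gt_eqF// powRr1.
      by rewrite -e1E ge0_ler_powR ?nnegrE ?(ltW p0) ?(ltW e0) ?(ltW e10) ?(ltW
        ee1).
    rewrite invfM mulrA => h.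
    apply: (@le_trans _ _ ((a ^+ 2 + 1) * e `^ (2 - 2 * s))).
      by rewrite ler_wpM2r ?powR_ge0// lerDl.
    by rewrite mulrC -ler_pdivlMr.
  rewrite -subr_ge0.
  have -> : q0 `^ s * ((X ^+ 2 - Y ^+ 2) / (2 * s)) + q0 `^ s * (X * Y) / s + 1
    -
    q0 `^ s * (X ^+ 2 / s) = 1 - q0 `^ s / (2 * s) * (X - Y) ^+ 2.
    by field; rewrite gt_eqF.
  rewrite subr_ge0 -ler_pdivlMl ?divr_gt0 ?powR_gt0 ?mulr_gt0//.
  by rewrite mulr1 invf_div.
rewrite EFinD addeA.
apply: (@le_trans _ _ ((q0 `^ s * ((e `^ (- (2 * s)) - e' `^ (- (2 * s))) / (2
  * s)))%R%:E +
    (inv_quad q0 q1 e' `^ s / s - ray_const s m)%R%:E + (ray_const s m)%:E +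
      1%:E)%E).
  by rewrite -!EFinD lee_fin (le_trans key)// le_eqVlt; apply/orP; left;
    apply/eqP; ring.
rewrite leeD2r// leeD2r//.
apply: le_trans (leeD (le_trans (leeD i0 (le_refl _)) i1) i2).
by rewrite -addeA leeD2l.
Qed.
End line_cut.

(** * Negative part against positive part on a line *)

Section ray_diff_neg_le.
Context {R : realType}.
Notation mu := (@lebesgue_measure R).

Lemma ge0_integral_tail_le (h : R -> R) (c : \bar R) (e0 : R) : 0 < e0 ->
  measurable_fun setT h -> (forall t, 0 <= h t) ->
  (forall e, 0 < e < e0 -> (\int[mu]_(t in `[e, +oo[) (h t)%:E <= c)%E) ->
  (\int[mu]_(t in `]0%R, +oo[) (h t)%:E <= c)%E.
Proof.
move=> e00 mh h0 hc.
(* [k + 2] keeps every cut strictly below [e0]. *)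
pose u (k : nat) : R := e0 / k.+2%:R.
have u0 k : 0 < u k by rewrite divr_gt0.
have -> : `]0%R, +oo[%classic = \bigcup_k (`[u k, +oo[%classic : set R).
  apply/seteqP; split => [t|t [k _]]/=; last first.
    by rewrite !in_itv/= !andbT; exact: lt_le_trans.
  rewrite in_itv/= andbT => t0; exists (Num.bound (e0 / t)) => //=.
  rewrite in_itv/= andbT /u ler_pdivrMr// mulrC -ler_pdivrMr//.
  apply: (@le_trans _ _ (Num.bound (e0 / t))%:R).
    by apply/ltW/archi_boundP; rewrite divr_ge0// ltW.
  by rewrite ler_nat; do 2 apply: leqW.
have mE k : measurable_fun (`[u k, +oo[%classic : set R) (EFin \o h).
  exact/measurable_EFinP/measurable_funTS.
have cv : (\int[mu]_(t in `[u k, +oo[) (h t)%:E @[k --> \oo] -->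
    \int[mu]_(t in \bigcup_k (`[u k, +oo[%classic : set R)) (h t)%:E)%E.
  apply: ge0_nondecreasing_set_cvg_integral => //.
  - move=> i j ij; apply/subsetPset => t /=; rewrite !in_itv/= !andbT.
    apply: le_trans; rewrite /u ler_pM2l// lef_pV2 ?posrE// ler_nat.
    by rewrite ltnS.
  - by move=> i t _; rewrite lee_fin.
rewrite -(cvg_lim _ cv)//; apply: lime_le; first by apply/cvg_ex; eexists;
  exact: cv.
apply: nearW => k; apply: hc; rewrite u0/= /u ltr_pdivrMr// ltr_pMr//.
by rewrite ltr1n.
Qed.

Definition ray_diff (s q0 q1 m t : R) : R :=
  (Num.max (q0 + q1 * t - m * t ^+ 2) 0 `^ s + Num.max (q0 - q1 * t - m * t ^+
    2) 0 `^ s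
   - 2 * q0 `^ s) * t `^ (-1 - 2 * s).

Lemma ray_diffE (s q0 q1 m t : R) : ray_diff s q0 q1 m t =
  ray_term s q0 q1 m t + ray_term s q0 (- q1) m t - 2 * q0 `^ s * t `^ (-1 - 2
    * s).
Proof. by rewrite /ray_diff /ray_term mulNr; ring. Qed.

Lemma measurable_ray_diff (s q0 q1 m : R) (D : set R) : 0 < s ->
  measurable_fun D (ray_diff s q0 q1 m).
Proof.
move=> s0; rewrite (_ : ray_diff _ _ _ _ = fun t => ray_term s q0 q1 m t +
    ray_term s q0 (- q1) m t - 2 * q0 `^ s * t `^ (-1 - 2 * s)); last first.
  by apply/funext => t; rewrite ray_diffE.
apply: measurable_funB.
  by apply: measurable_funD; apply/measurable_EFinP; exact: measurable_ray_term.
by apply: measurable_funM => //; apply: measurable_funTS; exact: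
  measurable_powR.
Qed.

Lemma integral_ray_term_fin (s q0 q1 m e : R) : 0 < s < 1 -> 0 < q0 -> 0 < m ->
  0 < e -> (\int[mu]_(t in `[e, +oo[) (ray_term s q0 q1 m t)%:E < +oo)%E.
Proof.
move=> /andP[s0 s1] q00 m0 e0.
(* [q0 + q1^2 / (4 m)] is the maximum of the quadratic, so the term is dominated by a multiple of
   [t^(-1-2s)]. *)
pose c := (q0 + q1 ^+ 2 / (4 * m)) `^ s.
apply: (@le_lt_trans _ _ (\int[mu]_(t in `[e, +oo[) (c * t `^ (-1 - 2 *
  s))%R%:E)%E).
  apply: ge0_le_integral => //.
  - by move=> t _; rewrite lee_fin ray_term_ge0.
  - exact: measurable_ray_term.
  - apply/measurable_EFinP; apply: measurable_funM => //; apply: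
    measurable_funTS.
    exact: measurable_powR.
  - move=> t _; rewrite lee_fin ler_wpM2r ?powR_ge0//.
    have c0 : 0 <= q0 + q1 ^+ 2 / (4 * m).
      by rewrite addr_ge0 ?(ltW q00)// divr_ge0 ?sqr_ge0// mulr_ge0// ltW.
    rewrite ge0_ler_powR ?nnegrE ?(ltW s0) ?le_max ?lexx ?orbT//.
    rewrite ge_max c0 andbT -addrA lerD2l -subr_ge0.
    have -> : q1 ^+ 2 / (4 * m) - (q1 * t - m * t ^+ 2) = m * (t - q1 / (2 *
      m)) ^+ 2.
      by field; rewrite gt_eqF.
    by rewrite mulr_ge0 ?sqr_ge0// ltW.
have mp : measurable_fun (`[e, +oo[%classic : set R) (EFin \o (@powR R ^~ (-1 -
  2 * s))).
  by apply/measurable_EFinP/measurable_funTS; exact: measurable_powR.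
under eq_integral do rewrite EFinM.
rewrite (ge0_integralZl_EFin mu (measurable_itv _) _ mp (powR_ge0 _ _)); last
  first.
  by move=> t _; rewrite lee_fin powR_ge0.
by rewrite integral_powR_tail ?mulr_gt0// -EFinM ltry.
Qed.

(** [N] and [P] stand for the integrals of the negative and positive parts of a difference and may
    be infinite; only the finite [I1 + I2] is cancelled. *)
Lemma fin_num_leeD_cancel (N P I1 I2 X K : \bar R) :
  I1 \is a fin_num -> I2 \is a fin_num -> (N + (I1 + I2) = P + X)%E ->
  (X <= I1 + I2 + K)%E -> (N <= P + K)%E.
Proof.
move=> I1f I2f eqI hI; have If : (I1 + I2)%E \is a fin_num by rewrite fin_numD
  I1f.
rewrite -(leeD2rE _ _ If) eqI -addeA leeD2l//.
by rewrite (addeC K).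
Qed.

(** The difference is the two ray terms minus [2 q0^s t^(-1-2s)], whose integral over [[e, +oo[] is
    the left side of [ray_cut]. With the parts on opposite sides, the limit as [e] tends to 0 is
    monotone convergence. *)
Lemma ray_diff_neg_le (s q0 q1 m : R) : 0 < s < 1 -> 0 < q0 -> 0 < m ->
  (\int[mu]_(t in `]0%R, +oo[) (Num.max (- ray_diff s q0 q1 m t) 0)%:E <=
   \int[mu]_(t in `]0%R, +oo[) (Num.max (ray_diff s q0 q1 m t) 0)%:E +
   (ray_const s m + 1)%R%:E)%E.
Proof.
move=> s01; have /andP[s0 s1] := s01.
wlog q10 : q1 / 0 <= q1.
  move=> H q00 m0; have [?|q10] := leP 0 q1; first exact: H.
  have e t : ray_diff s q0 q1 m t = ray_diff s q0 (- q1) m t.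
    by rewrite !ray_diffE opprK; ring.
  under eq_integral do rewrite e.
  under [X in (_ <= X + _)%E]eq_integral do rewrite e.
  by apply: H => //; rewrite oppr_ge0 ltW.
move=> q00 m0.
have [e0 e00 he] := ray_cut s01 q00 q10 m0.
have mG D := @measurable_ray_diff s q0 q1 m D s0.
have mN : measurable_fun setT (fun t => Num.max (- ray_diff s q0 q1 m t) 0).
  by apply: measurable_maxr => //; apply: measurableT_comp.
have mP : measurable_fun setT (fun t => Num.max (ray_diff s q0 q1 m t) 0).
  exact: measurable_maxr.
apply: (ge0_integral_tail_le e00 mN) => [t|e ee0]; first by rewrite le_max lexx
  orbT.
have /andP[ep _] := ee0.
apply: (@le_trans _ _ (\int[mu]_(t in `[e, +oo[) (Num.max (ray_diff s q0 q1 m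
  t) 0)%:E +
    (ray_const s m + 1)%R%:E)%E); last first.
  rewrite leeD2r//; apply: ge0_subset_integral => //.
  - exact/measurable_EFinP/measurable_funTS.
  - by move=> t _; rewrite lee_fin le_max lexx orbT.
  - by move=> t /=; rewrite !in_itv/= !andbT; exact: lt_le_trans.
have F1 := integral_ray_term_fin q1 s01 q00 m0 ep.
have F2 := integral_ray_term_fin (- q1) s01 q00 m0 ep.
have := he _ ee0.
set D := `[e, +oo[%classic in F1 F2 *.
set I1 := (\int[mu]_(t in D) (ray_term s q0 q1 m t)%:E)%E in F1 *.
set I2 := (\int[mu]_(t in D) (ray_term s q0 (- q1) m t)%:E)%E in F2 *.
set N := (\int[mu]_(t in D) (Num.max (- ray_diff s q0 q1 m t) 0)%:E)%E.
set P := (\int[mu]_(t in D) (Num.max (ray_diff s q0 q1 m t) 0)%:E)%E.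
move=> hI.
have I1f : I1 \is a fin_num.
  rewrite ge0_fin_numE; first exact: F1.
  by apply: integral_ge0 => t _; rewrite lee_fin ray_term_ge0.
have I2f : I2 \is a fin_num.
  rewrite ge0_fin_numE; first exact: F2.
  by apply: integral_ge0 => t _; rewrite lee_fin ray_term_ge0.
have mD : measurable D by exact: measurable_itv.
have mI1 := @measurable_ray_term R s q0 q1 m D s0.
have mI2 := @measurable_ray_term R s q0 (- q1) m D s0.
have mND : measurable_fun D (EFin \o (fun t => Num.max (- ray_diff s q0 q1 m t)
  0)).
  exact/measurable_EFinP/measurable_funTS.
have mPD : measurable_fun D (EFin \o (fun t => Num.max (ray_diff s q0 q1 m t)
  0)).
  exact/measurable_EFinP/measurable_funTS.
have mp : measurable_fun D (EFin \o (@powR R ^~ (-1 - 2 * s))).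
  by apply/measurable_EFinP/measurable_funTS; exact: measurable_powR.
have mp2 : measurable_fun D (EFin \o (fun t => 2 * q0 `^ s * t `^ (-1 - 2 *
  s))).
  apply/measurable_EFinP; apply: measurable_funM => //; apply: measurable_funTS.
  exact: measurable_powR.
have p0 t : D t -> (0 <= (EFin \o (@powR R ^~ (-1 - 2 * s))%R) t)%E.
  by move=> _; rewrite lee_fin powR_ge0.
have F3 : (\int[mu]_(t in D) (2 * q0 `^ s * t `^ (-1 - 2 * s))%R%:E =
    (q0 `^ s * (e `^ (- (2 * s)) / s))%R%:E)%E.
  under eq_integral do rewrite EFinM.
  have c0 : 0 <= 2 * q0 `^ s by rewrite mulr_ge0// powR_ge0.
  rewrite (ge0_integralZl_EFin mu mD p0 mp c0).
  rewrite integral_powR_tail ?mulr_gt0// -EFinM; congr EFin.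
  by field; rewrite gt_eqF.
have nI1 t : D t -> (0 <= (EFin \o ray_term s q0 q1 m) t)%E.
  by move=> _; rewrite lee_fin ray_term_ge0.
have nI2 t : D t -> (0 <= (EFin \o ray_term s q0 (- q1) m) t)%E.
  by move=> _; rewrite lee_fin ray_term_ge0.
have nN t : D t -> (0 <= (EFin \o (fun t => Num.max (- ray_diff s q0 q1 m t)
  0)%R) t)%E.
  by move=> _; rewrite lee_fin le_max lexx orbT.
have nP t : D t -> (0 <= (EFin \o (fun t => Num.max (ray_diff s q0 q1 m t)
  0)%R) t)%E.
  by move=> _; rewrite lee_fin le_max lexx orbT.
have np2 t : D t -> (0 <= (EFin \o (fun t => 2 * q0 `^ s * t `^ (-1 - 2 *
  s))%R) t)%E.
  by move=> _; rewrite lee_fin !mulr_ge0 ?powR_ge0.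
have eqI : (N + (I1 + I2) = P + (q0 `^ s * (e `^ (- (2 * s)) / s))%R%:E)%E.
  rewrite -F3 /N /P /I1 /I2.
  rewrite -(ge0_integralD mu mD nI1 mI1 nI2 mI2).
  rewrite -(ge0_integralD mu mD nP mPD np2 mp2).
  have mI12 := emeasurable_funD mI1 mI2.
  have nI12 t : D t -> (0 <= ((EFin \o ray_term s q0 q1 m) t + (EFin \o
    ray_term s q0 (- q1) m) t))%E.
    by move=> Dt; rewrite adde_ge0 ?nI1 ?nI2.
  rewrite -(ge0_integralD mu mD nN mND nI12 mI12).
  apply: eq_integral => t _ /=; rewrite -!EFinD; congr EFin.
  rewrite ray_diffE; set x := ray_term _ _ _ _ _; set y := ray_term _ _ _ _ _;
    set z := _ * _ `^ _.
  by rewrite opprB; case: ltP => h; case: ltP => h'; lra.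
exact: (fin_num_leeD_cancel I1f I2f eqI hI).
Qed.

End ray_diff_neg_le.

(** * Finiteness of the negative part on a line *)

Section line_neg.
Context {R : realType}.
Notation mu := (@lebesgue_measure R).

(** [(1 + x)^s >= 1 + s ln (1 + x)] and [ln (1 + x) >= x / (1 + x) = x - x^2 / (1 + x)], both from
    [exp y >= 1 + y]; conclude with [1 + x >= 1/2]. *)
Lemma powR1D_ge (s x : R) : 0 < s < 1 -> - 2^-1 <= x ->
  1 + s * x - 2 * x ^+ 2 <= (1 + x) `^ s.
Proof.
move=> /andP[s0 s1] hx.
have x1 : 0 < 1 + x by lra.
have lnx : x / (1 + x) <= ln (1 + x).
  have := expR_ge1Dx (ln (1 + x)^-1); rewrite lnK ?posrE ?invr_gt0// lnV
    ?posrE// => h.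
  have -> : x / (1 + x) = 1 - (1 + x)^-1 by field; rewrite gt_eqF.
  lra.
rewrite /powR gt_eqF//; apply: le_trans (expR_ge1Dx _).
apply: (@le_trans _ _ (1 + s * (x / (1 + x)))); last by rewrite lerD2l
  ler_wpM2l// ltW.
have -> : x / (1 + x) = x - x ^+ 2 / (1 + x) by field; rewrite gt_eqF.
have : x ^+ 2 / (1 + x) <= 2 * x ^+ 2.
  rewrite ler_pdivrMr//; have := sqr_ge0 x; nra.
have : 0 <= x ^+ 2 / (1 + x) by rewrite divr_ge0 ?sqr_ge0// ltW.
nra.
Qed.

(** The first order terms [q1 t] and [- q1 t] cancel, which leaves [O(t^2)] against [t^(-1-2s)]. The
    condition [4 b t <= q0] keeps the relative increments within 1/2, as [powR1D_ge] requires. *)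
Lemma ray_diff_ge (s q0 b q1 m t : R) : 0 < s < 1 -> 0 < q0 -> 0 < b ->
  `|q1| <= b -> 0 <= m <= b -> 0 < t -> t <= 1 -> 4 * b * t <= q0 ->
  - (q0 `^ s * (2 * b / q0 + 16 * (b / q0) ^+ 2) * t `^ (1 - 2 * s)) <=
  ray_diff s q0 q1 m t.
Proof.
move=> s01 q00 b0 q1b /andP[m0 mb] t0 t1 tb.
have -> : t `^ (1 - 2 * s) = t ^+ 2 * t `^ (-1 - 2 * s).
  rewrite -powR_mulrn ?(ltW t0)// -powRD; last by rewrite (gt_eqF t0) implybT.
  by congr (_ `^ _); ring.
rewrite mulrA -mulNr /ray_diff ler_wpM2r ?powR_ge0//.
have lb (q : R) : `|q| <= b ->
   q0 `^ s * (1 + s * ((q * t - m * t ^+ 2) / q0) - 2 * (2 * b / q0 * t) ^+ 2)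
     <=
   Num.max (q0 + q * t - m * t ^+ 2) 0 `^ s.
  move=> qb; set x := (q * t - m * t ^+ 2) / q0.
  have xb : `|x| <= 2 * b / q0 * t.
    rewrite /x normrM (gtr0_norm (_ : 0 < q0^-1)) ?invr_gt0//.
    rewrite mulrAC ler_wpM2r ?invr_ge0 ?(ltW q00)//.
    apply: le_trans (ler_normB _ _) _; rewrite (normrM q t) (normrM m (t ^+ 2))
      (gtr0_norm t0) (ger0_norm m0).
    rewrite (ger0_norm (sqr_ge0 t)).
    have := ler_wpM2r (ltW t0) qb.
    have : m * t ^+ 2 <= b * t by rewrite ler_pM ?sqr_ge0// expr2 ler_piMr//
      ltW.
    by lra.
  have xh : `|x| <= 2^-1.
    by apply: le_trans xb _; rewrite mulrAC ler_pdivrMr//; lra.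
  have xl : - 2^-1 <= x by move: xh; rewrite ler_norml => /andP[].
  have -> : q0 + q * t - m * t ^+ 2 = q0 * (1 + x).
    by rewrite /x; field; rewrite gt_eqF.
  rewrite max_l; last by rewrite mulr_ge0 ?(ltW q00)//; lra.
  rewrite powRM ?(ltW q00)//; last by lra.
  rewrite ler_wpM2l ?powR_ge0//; apply: le_trans (powR1D_ge s01 xl).
  rewrite lerD2l lerN2 ler_pM2l// -(real_normK (num_real x)).
  by rewrite lerXn2r// nnegrE (le_trans _ xb).
have h1 := lb _ q1b.
have nq1b : `|- q1| <= b by rewrite normrN.
have h2 := lb _ nq1b; rewrite mulNr in h2.
apply: le_trans (lerB (lerD h1 h2) (le_refl _)).
rewrite -subr_ge0.
have -> : q0 `^ s * (1 + s * ((q1 * t - m * t ^+ 2) / q0) - 2 * (2 * b / q0 *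
  t) ^+ 2) +
  q0 `^ s * (1 + s * ((- (q1 * t) - m * t ^+ 2) / q0) - 2 * (2 * b / q0 * t) ^+
    2) -
  2 * q0 `^ s - - (q0 `^ s * (2 * b / q0 + 16 * (b / q0) ^+ 2) * t ^+ 2) =
  2 * q0 `^ s * t ^+ 2 / q0 * (b - s * m).
  by field; rewrite gt_eqF.
have /andP[s0 s1] := s01.
apply: mulr_ge0; last by rewrite subr_ge0; nra.
by rewrite divr_ge0 ?(ltW q00)// !mulr_ge0 ?powR_ge0 ?(ltW t0).
Qed.

(** Serves for finiteness only: [C] grows as [q0] tends to 0, that is, near the boundary of the
    ball, in contrast with [ray_const]. *)
Lemma integral_ray_diff_neg (s q0 b : R) : 0 < s < 1 -> 0 < q0 -> 0 < b ->
  exists C : R, forall q1 m, `|q1| <= b -> 0 <= m <= b ->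
  (\int[mu]_(t in `]0%R, +oo[) (Num.max (- ray_diff s q0 q1 m t) 0)%:E <=
    C%:E)%E.
Proof.
move=> s01 q00 b0; have /andP[s0 s1] := s01.
(* Below [t1] the second order bound applies; beyond it the negative part is at most
   [2 q0^s t^(-1-2s)]. *)
pose t1 := Num.min 1 (q0 / (4 * b)).
have t10 : 0 < t1 by rewrite lt_min ltr01 divr_gt0// mulr_gt0.
pose c := q0 `^ s * (2 * b / q0 + 16 * (b / q0) ^+ 2).
have c0 : 0 <= c.
  rewrite mulr_ge0 ?powR_ge0// addr_ge0// ?mulr_ge0 ?sqr_ge0 ?invr_ge0//;
    exact: ltW.
pose C := c / (2 - 2 * s) * t1 `^ (2 - 2 * s) + 2 * q0 `^ s * (t1 `^ (- (2 *
  s)) / (2 * s)).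
exists C => q1 m q1b mb.
have mN : measurable_fun setT (fun t => Num.max (- ray_diff s q0 q1 m t) 0).
  by apply: measurable_maxr => //; apply: measurableT_comp => //; exact:
    measurable_ray_diff.
apply: (ge0_integral_tail_le t10 mN) => [t|e /andP[e0 et1]].
  by rewrite le_max lexx orbT.
have mND (D : set R) : measurable_fun D (EFin \o (fun t => Num.max (- ray_diff
  s q0 q1 m t) 0)).
  exact/measurable_EFinP/measurable_funTS.
have -> : `[e, +oo[%classic = `[e, t1[%classic `|` `[t1, +oo[%classic :> set R.
  apply/seteqP; split => [t|t [|]]/=; rewrite !in_itv/= ?andbT.
  - by move=> et; case: (ltP t t1) => h; [left|right]; rewrite ?et.
  - by case/andP.
  - by move=> h; rewrite (le_trans (ltW et1)).
rewrite [leLHS]ge0_integral_setU//; last 3 first.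
- exact: mND.
- by move=> t _; rewrite lee_fin le_max lexx orbT.
- apply/disj_setPS => t [/=]; rewrite !in_itv/= andbT => /andP[_ h1] h2.
  by rewrite leNgt h1 in h2.
rewrite /C EFinD leeD//.
  have ct t : e <= t <= t1 -> {for t, continuous (fun t : R => c * t `^ (1 - 2
    * s))}.
    move=> /andP[et _]; apply: cvgM; first exact: cvg_cst.
    by apply: continuous_powR; exact: lt_le_trans et.
  have mc := itv_continuous_measurable ct.
  have sub : `[e, t1[%classic `<=` (`[e, t1]%classic : set R).
    by move=> t /=; rewrite !in_itv/= => /andP[-> /ltW].
  apply: (@le_trans _ _ (\int[mu]_(t in `[e, t1[) (c * t `^ (1 - 2 *
    s))%R%:E)%E).
    apply: ge0_le_integral => //.
    - by move=> t _; rewrite lee_fin le_max lexx orbT.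
    - exact: mND.
    - exact: measurable_funS mc.
    - move=> t; rewrite /= in_itv/= => /andP[et tt1].
      have t0 := lt_le_trans e0 et.
      rewrite lee_fin ge_max; apply/andP; split; last by rewrite mulr_ge0
        ?powR_ge0.
      rewrite lerNl; apply: ray_diff_ge => //.
        by move: tt1; rewrite lt_min => /andP[/ltW].
      move: tt1; rewrite lt_min => /andP[_]; rewrite ltr_pdivlMr ?mulr_gt0// =>
        h.
      by rewrite mulrC ltW.
  apply: (@le_trans _ _ (\int[mu]_(t in `[e, t1]) (c * t `^ (1 - 2 *
    s))%R%:E)%E).
    apply: ge0_subset_integral => //.
    by move=> t _; rewrite lee_fin mulr_ge0 ?powR_ge0.
  have p0 : 0 < 2 - 2 * s by lra.
  have dE (t : R) : e <= t <= t1 -> is_derive t 1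
      (fun t : R => c / (2 - 2 * s) * t `^ (2 - 2 * s)) (c * t `^ (1 - 2 * s)).
    move=> /andP[et _]; have t0 := lt_le_trans e0 et.
    apply: (is_derive_ext (is_deriveZ (c / (2 - 2 * s))
      (is_derive1_powR (2 - 2 * s) t0))) => //.
    rewrite /GRing.scale/= (_ : 2 - 2 * s - 1 = 1 - 2 * s); last by ring.
    by rewrite mulrA divfK// gt_eqF.
  rewrite (integral_is_derive (ltW et1) dE ct) lee_fin gerBl.
  by rewrite mulr_ge0 ?powR_ge0 ?divr_ge0 ?(ltW p0).
have mD : measurable (`[t1, +oo[%classic : set R) by exact: measurable_itv.
have mp : measurable_fun (`[t1, +oo[%classic : set R) (EFin \o (@powR R ^~ (-1
  - 2 * s))).
  by apply/measurable_EFinP/measurable_funTS; exact: measurable_powR.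
have p0 t : (`[t1, +oo[%classic : set R) t -> (0 <= (EFin \o (@powR R ^~ (-1 -
  2 * s))%R) t)%E.
  by move=> _; rewrite lee_fin powR_ge0.
have c1 : 0 <= 2 * q0 `^ s by rewrite mulr_ge0// powR_ge0.
apply: (@le_trans _ _ (\int[mu]_(t in `[t1, +oo[) ((2 * q0 `^ s)%R%:E * (t `^
  (-1 - 2 * s))%R%:E))%E).
  apply: ge0_le_integral => //.
  - by move=> t _; rewrite lee_fin le_max lexx orbT.
  - exact: mND.
  - exact: (measurable_funeM (2 * q0 `^ s)%:E mp).
  - move=> t _; rewrite -EFinM lee_fin ge_max mulr_ge0 ?powR_ge0// andbT.
    rewrite ray_diffE opprB gerBl addr_ge0//; exact: ray_term_ge0.
rewrite (ge0_integralZl_EFin mu mD p0 mp c1).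
rewrite integral_powR_tail ?mulr_gt0// -EFinM.

Qed.
End line_neg.

(** * Lebesgue measure on R^n *)

Section affine.
Context {R : realType}.
Notation mu := (@lebesgue_measure R).

Lemma measurable_affine (t v : R) : measurable_fun setT (fun x :
  measurableTypeR R => (t * x + v : measurableTypeR R)).
Proof.
apply: (@measurable_funD _ R R setT); last exact: measurable_cst.
apply: (@measurable_funM _ R R setT); first exact: measurable_cst.
exact: measurable_id.
Qed.

(** By uniqueness it suffices to compare on the intervals []a, b]]; a negative [t] exchanges the
    open and the closed end, whence two cases. *)
Lemma lebesgue_measure_affine (t v : R) (A : set R) : t != 0 -> measurable A ->
  pushforward (mscale (NngNum (normr_ge0 t)) mu)
    (fun x : measurableTypeR R => (t * x + v : measurableTypeR R)) A = mu A.
Proof.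
move=> t0 mA; have mphi := measurable_affine t v.
apply/esym/lebesgue_measure_unique => //= _ [[a b]] _ <-.
have [tp|tn|t00] := ltgtP 0 t; last by rewrite -t00 eqxx in t0.
- rewrite /pushforward /mscale /= (_ : _ @^-1` _ = `](a - v) / t, (b - v) /
  t]%classic); last first.
    apply/seteqP; split => x /=; rewrite !in_itv/= ltr_pdivrMr// ler_pdivlMr//;
      by rewrite ltrBlDr lerBrDr (mulrC x).
  rewrite !lebesgue_measure_itv/= !lte_fin ltr_pM2r ?invr_gt0// ltrD2r.
  case: ifPn => _; last by rewrite mule0.
  rewrite gtr0_norm// -!EFinB -EFinM; congr EFin; field.
  by rewrite gt_eqF.
- rewrite /pushforward /mscale /= (_ : _ @^-1` _ = `[(b - v) / t, (a - v) /
  t[%classic); last first.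
    apply/seteqP; split => x /=; rewrite !in_itv/= ler_ndivrMr// ltr_ndivlMr//;
      by rewrite ltrBlDr lerBrDr (mulrC x) andbC.
  rewrite !lebesgue_measure_itv/= !lte_fin ltr_nM2r ?invr_lt0// ltrD2r.
  case: ifPn => _; last by rewrite mule0.
  rewrite ltr0_norm// -!EFinB -EFinM; congr EFin; field.
  by rewrite lt_eqF.
Qed.

Lemma ge0_integral_affine (t v : R) (h : R -> \bar R) : t != 0 ->
  measurable_fun setT h -> (forall x, 0 <= h x)%E ->
  (`|t|%R%:E * \int[mu]_x h (t * x + v)%R = \int[mu]_x h x)%E.
Proof.
move=> t0 mh h0; have mphi := measurable_affine t v.
transitivity (\int[pushforward (mscale (NngNum (normr_ge0 t)) mu)
    (fun x : measurableTypeR R => (t * x + v : measurableTypeR R)%R)]_x h x)%E.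
  rewrite ge0_integral_pushforward// ?preimage_setT.
  rewrite ge0_integral_mscale//=.
  apply: (measurableT_comp mh); exact: mphi.
by apply: eq_measure_integral => A mA _; exact: lebesgue_measure_affine.
Qed.

End affine.

Section rV.
Context {R : realType}.
Notation mu := (@lebesgue_measure R).
Notation leb := (@lebesgue_rV R).

Lemma ge0_integral_rVS n (f : 'rV[R]_n.+1 -> \bar R) :
  measurable_fun setT f -> (forall x, 0 <= f x)%E ->
  (\int[leb n.+1]_x f x = \int[mu]_a \int[leb n]_b f (consr (a, b)))%E.
Proof.
move=> mf f0; have mc := @measurable_consr R n.
transitivity (\int[pushforward (lebesgue_measure \x leb n)%E (@consr R n)]_x f
  x)%E.
  by [].
rewrite ge0_integral_pushforward// preimage_setT.
have mfc : measurable_fun setT (f \o @consr R n) by exact: measurableT_comp.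
exact: (fubini_tonelli1 (m1 := mu) (m2 := leb n) (f \o @consr R n) mfc
  (fun x => f0 _)).
Qed.

Lemma measurable_rV_affine n (t : R) (v : 'rV[R]_n) :
  measurable_fun setT (fun z : 'rV[R]_n => t *: z + v).
Proof.
apply: measurable_fun_rVP => i; under eq_fun do rewrite !mxE.
apply: measurable_funD => //; apply: measurable_funM => //.
exact: measurable_coord.
Qed.

(** Induction on the dimension: by Tonelli the first coordinate undergoes an affine map of the line
    and contributes one factor [|t|]. *)
Lemma ge0_integral_rV_affine n (t : R) (v : 'rV[R]_n) (f : 'rV[R]_n -> \bar R) :
  t != 0 -> measurable_fun setT f -> (forall x, 0 <= f x)%E ->
  ((`|t| ^+ n)%R%:E * \int[leb n]_x f (t *: x + v)%R = \int[leb n]_x f x)%E.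
Proof.
move=> t0; elim: n v f => [|n IH] v f mf f0.
  rewrite expr0 mul1e; apply: eq_integral => x _.
  by congr f; rewrite [LHS]thinmx0 [RHS]thinmx0.
pose v0 := v ord0 ord0; pose v' : 'rV[R]_n := \row_i v ord0 (lift ord0 i).
have E a b : t *: consr (a, b) + v = consr (t * a + v0, t *: b + v').
  apply/rowP => i; rewrite 2!mxE; case: (unliftP ord0 i) => [j ->|->].
    by rewrite !consrS/= !mxE.
  by rewrite !consr0.
have mfc : measurable_fun setT (fun p : R * 'rV[R]_n => f (consr p)).
  exact: measurableT_comp mf (@measurable_consr R n).
rewrite !ge0_integral_rVS//; last first.
  exact: (measurableT_comp mf (measurable_rV_affine _ _)).
pose H (a : R) := (\int[leb n]_b f (consr (a, b)))%E.
have mH : measurable_fun setT H.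
  exact: (measurable_fun_fubini_tonelli_F (m2 := leb n) (fun p : R * 'rV[R]_n
    => f (consr p))).
have H0 a : (0 <= H a)%E by apply: integral_ge0.
rewrite -[RHS](ge0_integral_affine v0 t0 mH H0) exprS EFinM -muleA; congr (_ *
  _)%E.
have mHa : measurable_fun setT (fun a : R => H (t * a + v0)).
  exact: (measurableT_comp mH (measurable_affine t v0)).
rewrite -ge0_integralZl_EFin//; last 2 first.
- by move=> a _; apply: integral_ge0.
- have mg : measurable_fun setT (fun p : R * 'rV[R]_n => f (t *: consr p + v)).
    exact: (measurableT_comp (measurableT_comp mf (measurable_rV_affine t v))
      (@measurable_consr R n)).
  exact: (measurable_fun_fubini_tonelli_F (m2 := leb n) _ mg).
apply: eq_integral => a _; rewrite /H -(IH v' (fun b => f (consr ((t * a +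
  v0)%R, b))))//; last first.
  exact: (measurableT_comp mfc (pair1_measurable _)).
by congr (_ * _)%E; apply: eq_integral => b _; rewrite E.
Qed.

End rV.

(** * The Euclidean norm and Borel sets *)

Section enorm.
Context {R : realType} {n : nat}.
Implicit Types (x y z : 'rV[R]_n) (t : R).

Lemma dotp_ge0 x : 0 <= dotp x x.
Proof. by apply: sumr_ge0 => i _; rewrite -expr2 sqr_ge0. Qed.

Lemma enorm_ge0 x : 0 <= enorm x.
Proof. exact: sqrtr_ge0. Qed.

Lemma enormE2 x : enorm x ^+ 2 = dotp x x.
Proof. by rewrite sqr_sqrtr// dotp_ge0. Qed.

Lemma dotpC x y : dotp x y = dotp y x.
Proof. by apply: eq_bigr => i _; rewrite mulrC. Qed.

Lemma dotpDl x y z : dotp (x + y) z = dotp x z + dotp y z.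
Proof. by rewrite -big_split/=; apply: eq_bigr => i _; rewrite mxE mulrDl. Qed.

Lemma dotpZl t x y : dotp (t *: x) y = t * dotp x y.
Proof. by rewrite mulr_sumr; apply: eq_bigr => i _; rewrite mxE mulrA. Qed.

Lemma dotpDr x y z : dotp z (x + y) = dotp z x + dotp z y.
Proof. by rewrite !(dotpC z) dotpDl. Qed.

Lemma dotpZr t x y : dotp x (t *: y) = t * dotp x y.
Proof. by rewrite !(dotpC x) dotpZl. Qed.

Lemma dotp0l x : dotp 0 x = 0.
Proof. by rewrite -(scale0r 0) dotpZl mul0r. Qed.

Lemma dotpNl x y : dotp (- x) y = - dotp x y.
Proof. by rewrite -scaleN1r dotpZl mulN1r. Qed.

Lemma dotpNr x y : dotp x (- y) = - dotp x y.
Proof. by rewrite !(dotpC x) dotpNl. Qed.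

Lemma enormZ t x : enorm (t *: x) = `|t| * enorm x.
Proof. by rewrite /enorm dotpZl dotpZr mulrA -expr2 sqrtrM ?sqr_ge0//
  sqrtr_sqr. Qed.

Lemma enormN x : enorm (- x) = enorm x.
Proof. by rewrite -scaleN1r enormZ normrN1 mul1r. Qed.

Lemma enormB x y : enorm (x - y) = enorm (y - x).
Proof. by rewrite -enormN opprB. Qed.

Lemma enorm0 : enorm (0 : 'rV[R]_n) = 0.
Proof. by rewrite /enorm dotp0l sqrtr0. Qed.

Lemma enorm_coord x i : `|x ord0 i| <= enorm x.
Proof.
rewrite -(@ler_pXn2r _ 2) ?nnegrE ?enorm_ge0// enormE2 real_normK ?num_real//.
rewrite /dotp (bigD1 i)//= -expr2 lerDl; apply: sumr_ge0 => j _.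
by rewrite -expr2 sqr_ge0.
Qed.

Lemma enorm_eq0 x : (enorm x == 0) = (x == 0).
Proof.
apply/eqP/eqP => [x0|->]; last exact: enorm0.
apply/rowP => i; rewrite mxE; apply/eqP; rewrite -normr_le0.
by rewrite (le_trans (enorm_coord x i))// x0.
Qed.

(** Cauchy-Schwarz, from the squared norm of [<y, y> x - <x, y> y]. *)
Lemma dotp_enorm_le x y : `|dotp x y| <= enorm x * enorm y.
Proof.
have [->|y0] := eqVneq y 0; first by rewrite dotpC dotp0l normr0 enorm0 mulr0.
have y2 : 0 < dotp y y by rewrite -enormE2 exprn_gt0// lt_neqAle enorm_ge0
  eq_sym enorm_eq0 y0.
rewrite -(@ler_pXn2r _ 2) ?nnegrE ?mulr_ge0 ?enorm_ge0// real_normK ?num_real//.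
rewrite exprMn !enormE2 -subr_ge0 -(pmulr_rge0 _ y2).
have := dotp_ge0 (dotp y y *: x - dotp x y *: y).
rewrite !(dotpDl, dotpDr, dotpNl, dotpNr, dotpZl, dotpZr) (dotpC y x) => h.
by apply: le_trans h _; rewrite le_eqVlt; apply/orP; left; apply/eqP; ring.
Qed.

Lemma enormD x y : enorm (x + y) <= enorm x + enorm y.
Proof.
rewrite -(@ler_pXn2r _ 2) ?nnegrE ?addr_ge0 ?enorm_ge0//.
rewrite sqrrD !enormE2 dotpDl !dotpDr (dotpC y x).
have := dotp_enorm_le x y; rewrite ler_norml => /andP[_ h].
by rewrite mulr2n; lra.
Qed.

Lemma enorm_le_sum x : enorm x <= \sum_(i < n) `|x ord0 i|.
Proof.
rewrite -(@ler_pXn2r _ 2) ?nnegrE ?enorm_ge0 ?sumr_ge0// enormE2 expr2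
  mulr_suml.
apply: ler_sum => i _; rewrite -expr2 -(real_normK (num_real _)) expr2.
rewrite ler_wpM2l// (bigD1 i)//= lerDl; exact: sumr_ge0.
Qed.

Lemma rV_ballE x e y : 0 < e -> (forall i, `|x ord0 i - y ord0 i| < e) -> ball
  x e y.
Proof.
by move=> e0 h; split=> // i j; rewrite ord1; exact: h.
Qed.

Lemma eball_nbhs x e : 0 < e -> nbhs x (eball x e).
Proof.
move=> e0; have d0 : 0 < e / n.+1%:R by rewrite divr_gt0.
apply/nbhs_ballP; exists (e / n.+1%:R) => //= y [_ h].
rewrite /eball/= (le_lt_trans (enorm_le_sum _))//.
apply: (@le_lt_trans _ _ (\sum_(i < n) (e / n.+1%:R))).
  by apply: ler_sum => i _; have := h ord0 i; rewrite !mxE /ball/= distrC =>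
    /ltW.
rewrite sumr_const card_ord -[X in X < _]mulr_natr mulrAC ltr_pdivrMr//
  ltr_pM2l// ltr_nat//.
Qed.

Lemma measurable_enorm : measurable_fun setT (@enorm R n).
Proof.
rewrite (_ : @enorm R n = (fun t => t `^ 2^-1) \o (fun x => dotp x x)); last
  first.
  by apply/funext => x /=; rewrite powR12_sqrt// dotp_ge0.
apply: measurableT_comp; first exact: measurable_powR.
by apply: measurable_sum => i; apply: measurable_funM; exact: measurable_coord.
Qed.

(** The sigma-algebra is generated by the coordinates, so an open set is written as the countable
    union of the cubes with rational centre and half-side [1 / (k + 1)] that it contains. *)
Lemma open_measurable_rV (A : set 'rV[R]_n) : open A -> measurable A.
Proof.
move=> oA.
pose box (p : 'rV[rat]_n * nat) := [set y : 'rV[R]_n |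
  forall i, `|y ord0 i - ratr (p.1 ord0 i)| < p.2.+1%:R^-1].
have mbox p : measurable (box p).
  rewrite (_ : box p = \bigcap_(i in [set: 'I_n]) (fun y : 'rV[R]_n => y ord0
    i) @^-1`
      (`](ratr (p.1 ord0 i) - p.2.+1%:R^-1), (ratr (p.1 ord0 i) +
        p.2.+1%:R^-1)[)).
    apply: fin_bigcap_measurable => // i _.
    by rewrite -[X in measurable X]setTI; exact: measurable_coord.
  apply/seteqP; split=> y yB.
    by move=> i _; rewrite /= in_itv/= -ltr_distl; exact: yB.
  by move=> i; have := yB i I; rewrite /= in_itv/= -ltr_distl.
rewrite (_ : A = \bigcup_p (if pselect (box p `<=` A) then box p else set0)).
  apply: countable_bigcupT_measurable => // p.
  by case: pselect => h; [exact: mbox|exact: measurable0].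
apply/seteqP; split => [x Ax|x [p _]]; last by case: pselect => // h /h.
have [e e0 eA] : exists2 e, 0 < e & ball x e `<=` A.
  have /nbhs_ballP[e e0 eA] : nbhs x A by apply: open_nbhs_nbhs; split.
  by exists e.
pose k := Num.bound (2 / e).
have k0 : 0 < (k.+1%:R : R)^-1 by rewrite invr_gt0.
have ke : 2 * (k.+1%:R : R)^-1 < e.
  rewrite -ltr_pdivlMr ?invr_gt0// invrK mulrC -ltr_pdivrMr//.
  apply: (lt_le_trans (archi_boundP _)); first by rewrite divr_ge0// ltW.
  by rewrite ler_nat.
have [q qx] : exists q : 'rV[rat]_n, forall i, `|x ord0 i - ratr (q ord0 i)| <
  k.+1%:R^-1.
  have h i : exists r : rat, `|x ord0 i - ratr r| < k.+1%:R^-1.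
    have /rat_in_itvoo[r] : x ord0 i - k.+1%:R^-1 < x ord0 i + k.+1%:R^-1.
      by rewrite ltrBlDr -addrA ltrDl addr_gt0.
    rewrite in_itv/= => rx; exists r; rewrite distrC ltr_distl.
    exact: rx.
  exists (\row_i projT1 (cid (h i))) => i; rewrite mxE; exact: (projT2 (cid (h
    i))).
exists (q, k) => //; case: pselect => [_ //|[]] y yb.
apply: eA; apply: rV_ballE => // i.
have := yb i; have := qx i; rewrite /= => h1 h2.
apply: le_lt_trans ke.
have := ler_distD (ratr (q ord0 i)) (x ord0 i) (y ord0 i).
rewrite (distrC (ratr _)) => h; apply: (le_trans h).
by rewrite mulr_natl mulr2n lerD ?(ltW h1) ?(ltW h2) // distrC ltW.
Qed.

(** [L1s] grants only agreement almost everywhere with a Borel function; semicontinuity makes [u]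
    itself Borel, since its superlevel sets are open. *)
Lemma lower_semicontinuous_measurable_rV (u : 'rV[R]_n -> R) :
  lower_semicontinuous (EFin \o u) -> measurable_fun setT u.
Proof.
move=> /lower_semicontinuousP lu.
apply: (measurability _ (RGenOInfty.measurableE R)) => //.
move=> _ [_ [a ->] <-]; rewrite setTI; apply: open_measurable_rV.
rewrite (_ : _ @^-1` _ = [set x | (a%:E < (EFin \o u) x)%E]); first exact: lu.
by apply/seteqP; split => x /=; rewrite in_itv/= andbT lte_fin.
Qed.

End enorm.

(** * Integration along rays *)

Section polar.
Context {R : realType} {n : nat}.
Notation mu := (@lebesgue_measure R).
Notation leb := (@lebesgue_rV R n).
Notation Rn := 'rV[R]_n.

(** The density [1 / |z|] makes the average over dilations in [integral_shell_dilate] elementary: it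
    gives each [y != 0] the weight 1/2, whose inverse is the factor 2 of [ge0_integral_rays]. *)
Definition shell (z : Rn) : R := if 1 <= enorm z <= 2 then enorm z `^ (-1) else
  0.

Lemma shell_ge0 z : 0 <= shell z.
Proof. by rewrite /shell; case: ifP => // _; exact: powR_ge0. Qed.

Lemma measurable_shell : measurable_fun setT shell.
Proof.
apply: measurable_fun_ifT => //.
  apply: measurable_and; apply: measurable_fun_ler => //; exact:
    measurable_enorm.
apply: (measurableT_comp (f := fun t : R => t `^ (-1))); first exact:
  measurable_powR.
exact: measurable_enorm.
Qed.

Lemma measurable_rV_scale d (T : measurableType d) (f : T -> R) (g : T -> Rn) :
  measurable_fun setT f -> measurable_fun setT g ->
  measurable_fun setT (fun x => f x *: g x).
Proof.
move=> mf mg; apply: measurable_fun_rVP => i; under eq_fun do rewrite !mxE.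
apply: measurable_funM => //.
exact: (measurableT_comp (measurable_coord i) mg).
Qed.

(** For [y != 0] the integrand is [c / |y|] on [[|y| / 2, |y|]] and 0 elsewhere. At [y = 0] it
    vanishes identically, hence the condition on [c]. *)
Lemma integral_shell_dilate (y : Rn) (c : R) : 0 <= c -> (y = 0 -> c = 0) ->
  (\int[mu]_t (if 0 < t then t `^ (-1) * shell (t `^ (-1) *: y) * c else
    0)%R%:E =
   (c / 2)%R%:E)%E.
Proof.
move=> c0 yc; have [y0|y0] := eqVneq y 0.
  rewrite (yc y0) mul0r; under eq_integral do rewrite mulr0 if_same.
  by rewrite integral0.
set a := enorm y.
have a0 : 0 < a by rewrite lt_neqAle enorm_ge0 eq_sym enorm_eq0 y0.
transitivity (\int[mu]_(t in `[(a / 2)%R, a]) (c / a)%R%:E)%E.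
  rewrite [RHS]integral_mkcond; apply: eq_integral => t _.
  rewrite patchE; case: (boolP (t \in (`[a / 2, a]%classic : set R))) => [|].
    rewrite inE/= in_itv/= => /andP[at1 ta].
    have t0 : 0 < t by apply: lt_le_trans at1; rewrite divr_gt0.
    rewrite t0 powR_inv1 ?(ltW t0)// /shell enormZ gtr0_norm ?invr_gt0// -/a.
    rewrite (mulrC t^-1 a) ler_pdivlMr// mul1r ta ler_pdivrMr// (mulrC 2 t)
      -ler_pdivrMr// at1/=.
    rewrite powR_inv1; last by rewrite divr_ge0 ?(ltW a0) ?(ltW t0).
    by congr EFin; field; rewrite !gt_eqF.
  move=> /negP nt; case: ifPn => // t0.
  rewrite /shell enormZ powR_inv1 ?(ltW t0)// gtr0_norm ?invr_gt0// -/a.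
  case: ifPn; last by rewrite mulr0 mul0r.
  rewrite (mulrC t^-1 a) ler_pdivlMr// mul1r ler_pdivrMr// => /andP[ta at2].
  case: nt; rewrite inE/= in_itv/= ta andbT.
  by rewrite ler_pdivrMr// mulrC.
rewrite integral_cst//= lebesgue_measure_itv/= lte_fin ltr_pdivrMr//.
rewrite ltr_pMr// ltr1n -EFinB -EFinM; congr EFin.
by field; rewrite gt_eqF.
Qed.

Section rays.
Variable F : Rn -> R.
Hypotheses (mF : measurable_fun setT F) (F0 : forall y, 0 <= F y).

Let Psi (p : R * Rn) : R :=
  if 0 < p.1 then shell p.2 * (F (p.1 *: p.2) * p.1 `^ (n%:R - 1)) else 0.

Let m1 := @measurable_fst _ _ (measurableTypeR R) Rn.
Let m2 := @measurable_snd _ _ (measurableTypeR R) Rn.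
Let mp q : measurable_fun setT (fun p : R * Rn => p.1 `^ q).
Proof. exact: (measurableT_comp (measurable_powR q) m1). Qed.

Let mPsi : measurable_fun setT (EFin \o Psi).
Proof.
apply/measurable_EFinP; apply: measurable_fun_ifT => //.
  exact: measurable_fun_ltr.
apply: measurable_funM; first exact: (measurableT_comp measurable_shell m2).
apply: measurable_funM; last exact: mp.
exact: (measurableT_comp mF (measurable_rV_scale m1 m2)).
Qed.

Let Psi0 p : (0 <= (EFin \o Psi) p)%E.
Proof.
rewrite lee_fin /Psi; case: ifP => // _.
by rewrite !mulr_ge0 ?powR_ge0 ?shell_ge0.
Qed.

Let int_Psi z : (\int[mu]_t (Psi (t, z))%:E = (shell z)%:E *
  \int[mu]_(t in `]0%R, +oo[) (F (t *: z) * t `^ (n%:R - 1))%R%:E)%E.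
Proof.
rewrite -ge0_integralZl_EFin ?shell_ge0//; last 2 first.
- by move=> t _; rewrite lee_fin mulr_ge0 ?powR_ge0.
- apply/measurable_EFinP; apply: measurable_funTS; apply: measurable_funM.
    by apply: (measurableT_comp mF); exact: measurable_rV_scale.
  exact: measurable_powR.
rewrite [RHS]integral_mkcond; apply: eq_integral => t _.
rewrite patchE /Psi /= mem_setE in_itv/= andbT.
by case: ifP => // t0; rewrite EFinM.
Qed.

Lemma measurable_rays : measurable_fun setT (fun z : Rn => (shell z)%:E *
  \int[mu]_(t in `]0%R, +oo[) (F (t *: z) * t `^ (n%:R - 1))%R%:E)%E.
Proof.
under eq_fun do rewrite -int_Psi.
exact: (measurable_fun_fubini_tonelli_G (m1 := mu) (EFin \o Psi) mPsi Psi0).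
Qed.

(* A substitute for polar coordinates: averaging over the dilations
   [y = t z] with respect to [dt / t] turns an integral over [R^n] into an
   average of integrals over rays. *)
Lemma ge0_integral_rays : F 0 = 0 ->
  (\int[leb]_y (F y)%:E = 2%:E * \int[leb]_z ((shell z)%:E *
     \int[mu]_(t in `]0%R, +oo[) (F (t *: z) * t `^ (n%:R - 1))%R%:E))%E.
Proof.
move=> F00.
(* [Phi] inserts the average over dilations into the integral of [F]; for fixed [t] the substitution
   [y = t z] turns it into [Psi], and Tonelli exchanges the integrals on both sides. *)
pose Phi (p : R * Rn) : R :=
  if 0 < p.1 then p.1 `^ (-1) * shell (p.1 `^ (-1) *: p.2) * F p.2 else 0.
have mPhi : measurable_fun setT (EFin \o Phi).
  apply/measurable_EFinP; apply: measurable_fun_ifT => //.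
    exact: measurable_fun_ltr.
  apply: measurable_funM; last exact: (measurableT_comp mF m2).
  apply: measurable_funM => //.
  exact: (measurableT_comp measurable_shell (measurable_rV_scale (mp _) m2)).
have Phi0 p : (0 <= (EFin \o Phi) p)%E.
  rewrite lee_fin /Phi; case: ifP => // _.
  by rewrite !mulr_ge0 ?powR_ge0 ?shell_ge0.
have e1 : (\int[leb]_y \int[mu]_t (Phi (t, y))%:E = 2^-1%:E * \int[leb]_y (F
  y)%:E)%E.
  rewrite -ge0_integralZl_EFin//; last 2 first.
  - by move=> y _; rewrite lee_fin.
  - exact/measurable_EFinP.
  apply: eq_integral => y _; rewrite /Phi /= integral_shell_dilate//.
    by rewrite -EFinM mulrC.
  by move=> ->.
have e2 : (\int[mu]_t \int[leb]_y (Phi (t, y))%:E = \int[mu]_t \int[leb]_y (Psi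
  (t, y))%:E)%E.
  apply: eq_integral => t _; rewrite /Phi /Psi /=.
  case: ltP => // t0.
  have mg : measurable_fun setT (fun y : Rn => (t `^ (-1) * shell (t `^ (-1) *:
    y) * F y)%:E).
    apply/measurable_EFinP; apply: measurable_funM => //; apply:
      measurable_funM => //.
    by apply: (measurableT_comp measurable_shell); exact: measurable_rV_scale.
  have g0 (y : Rn) : (0 <= (t `^ (-1) * shell (t `^ (-1) *: y) * F y)%R%:E)%E.
    by rewrite lee_fin !mulr_ge0 ?powR_ge0 ?shell_ge0.
  rewrite -(ge0_integral_rV_affine 0 (lt0r_neq0 t0) mg g0).
  rewrite -ge0_integralZl_EFin ?exprn_ge0//; last first.
    exact: (measurableT_comp mg (measurable_rV_affine _ _)).
  apply: eq_integral => y _; rewrite addr0 -EFinM; congr EFin.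
  rewrite scalerA powR_inv1 ?(ltW t0)// mulVf ?gt_eqF// scale1r gtr0_norm//.
  rewrite powRB; last by rewrite (gt_eqF t0) implybT.
  by rewrite powRr1 ?(ltW t0)// powR_mulrn ?(ltW t0)//; ring.
under [in RHS]eq_integral do rewrite -int_Psi.
rewrite -[in RHS](fubini_tonelli (m1 := mu) (m2 := leb) (EFin \o Psi) mPsi
  Psi0).
rewrite -e2 (fubini_tonelli (m1 := mu) (m2 := leb) (EFin \o Phi) mPhi Phi0) e1.
by rewrite muleA -EFinM mulfV// mul1e.
Qed.

End rays.

End polar.

(** * The power of the paraboloid *)

Section cap.
Context {R : realType} {n : nat}.
Notation mu := (@lebesgue_measure R).
Notation leb := (@lebesgue_rV R n).
Notation Rn := 'rV[R]_n.

Lemma lebesgue_rV_enorm_le (a : R) : 0 <= a ->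
  (leb [set z : Rn | enorm z <= a]%R <= ((2 * a) ^+ n)%R%:E)%E.
Proof.
move=> a0.
have h := @lebesgue_rV_box R n (const_mx (- a)) (const_mx a).
have -> : ((2 * a) ^+ n)%:E = leb [set z : Rn | forall i, z ord0 i \in
    `[(const_mx (- a) : Rn) ord0 i, (const_mx a : Rn) ord0 i]].
  rewrite h; last by move=> i; rewrite !mxE; lra.
  under eq_bigr do rewrite !mxE.
  by rewrite prodr_const card_ord; congr ((_ ^+ _)%:E); ring.
apply: le_measure; rewrite ?inE.
- rewrite (_ : [set _ | _] = @enorm R n @^-1` `]-oo, a]%classic).
    by rewrite -[X in measurable X]setTI; exact: measurable_enorm.
  by apply/seteqP; split => z /=; rewrite in_itv.
- rewrite (_ : [set _ | _] = \bigcap_(i in [set: 'I_n])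
      (fun y : 'rV[R]_n => y ord0 i) @^-1` `[(- a), a]%classic).
    apply: fin_bigcap_measurable => // i _.
    by rewrite -[X in measurable X]setTI; exact: measurable_coord.
  apply/seteqP; split=> y /= yB i.
    by move=> _; have := yB i; rewrite !mxE.
  by have := yB i I; rewrite !mxE.
- move=> z /= za i; rewrite !mxE in_itv/= -ler_norml.
  exact: le_trans (enorm_coord z i) za.
Qed.

Definition cap (s r : R) (c z : Rn) : R := Num.max (r ^+ 2 - enorm (z - c) ^+
  2) 0 `^ s.

Lemma cap_ge0 s r c z : 0 <= cap s r c z.
Proof. exact: powR_ge0. Qed.

Lemma cap_out s r c z : 0 < s -> r <= enorm (z - c) -> 0 <= r -> cap s r c z =
  0.
Proof.
move=> s0 rz r0; rewrite /cap max_r ?powR0 ?gt_eqF//.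
by rewrite subr_le0 lerXn2r// nnegrE ?enorm_ge0.
Qed.

Lemma cap_le s r c z : 0 <= s -> 0 <= r -> cap s r c z <= r `^ (2 * s).
Proof.
move=> s0 r0; rewrite powRrM (powR_mulrn 2 r0) ge0_ler_powR ?nnegrE ?le_max
  ?lexx ?orbT ?sqr_ge0//.
by rewrite ge_max sqr_ge0 andbT gerBl sqr_ge0.
Qed.

Lemma measurable_cap s r c : 0 < s -> measurable_fun setT (cap s r c).
Proof.
move=> s0; apply: (measurableT_comp (measurable_powR s)).
apply: measurable_maxr => //; apply: measurable_funB => //.
apply: measurable_funX; apply: (measurableT_comp measurable_enorm).
have := measurable_rV_affine 1 (- c); apply: eq_measurable_fun => z _.
by rewrite scale1r.
Qed.

Lemma measurable_shiftl (f : Rn -> R) (x : Rn) : measurable_fun setT f ->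
  measurable_fun setT (fun y : Rn => f (x + y)).
Proof.
move=> mf; apply: (measurableT_comp mf).
have := measurable_rV_affine 1 x; apply: eq_measurable_fun => z _.
by rewrite scale1r addrC.
Qed.

Lemma measurable_shiftr (f : Rn -> R) (x : Rn) : measurable_fun setT f ->
  measurable_fun setT (fun y : Rn => f (x - y)).
Proof.
move=> mf; apply: (measurableT_comp mf).
have := measurable_rV_affine (-1) x; apply: eq_measurable_fun => z _.
by rewrite scaleN1r addrC.
Qed.

Lemma measurable_kernel (p : R) : measurable_fun setT (fun y : Rn => (enorm y
  `^ p)^-1).
Proof.
under eq_fun do rewrite -powRN.
exact: (measurableT_comp (measurable_powR (- p)) measurable_enorm).
Qed.

Definition diff2 (f : Rn -> R) (x y : Rn) : R := f (x + y) + f (x - y) - 2 * f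
  x.

Lemma measurable_diff2 (f : Rn -> R) (x : Rn) : measurable_fun setT f ->
  measurable_fun setT (diff2 f x).
Proof.
move=> mf; apply: measurable_funB => //; apply: measurable_funD.
  exact: measurable_shiftl.
exact: measurable_shiftr.
Qed.

Lemma diff2_cap_line (s r : R) (c x z : Rn) (t : R) : 0 < t -> enorm (x - c) <
  r ->
  diff2 (cap s r c) x (t *: z) * t `^ (-1 - 2 * s) =
  ray_diff s (r ^+ 2 - enorm (x - c) ^+ 2) (- (2 * dotp (x - c) z)) (enorm z ^+
    2) t.
Proof.
move=> t0 xr; rewrite /ray_diff /diff2 /cap.
have r0 : 0 <= r by rewrite (le_trans _ (ltW xr)) ?enorm_ge0.
have q0 : 0 <= r ^+ 2 - enorm (x - c) ^+ 2.
  by rewrite subr_ge0 lerXn2r ?nnegrE ?enorm_ge0// ltW.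
have -> : x + t *: z - c = (x - c) + t *: z by rewrite addrAC.
have -> : x - t *: z - c = (x - c) + (- t) *: z by rewrite addrAC scaleNr.
have e (u : R) : r ^+ 2 - enorm (x - c + u *: z) ^+ 2 =
    r ^+ 2 - enorm (x - c) ^+ 2 + (- (2 * dotp (x - c) z)) * u - enorm z ^+ 2 *
      u ^+ 2.
  move: (x - c) => a; rewrite !enormE2 !(dotpDl, dotpDr, dotpZl, dotpZr) (dotpC
    z a).
  by ring.
rewrite !e (max_l q0) sqrrN mulrN; congr ((_ + _ - _) * _).
Qed.

(** * The operator on the cap, averaged over rays *)

Section kernel.
Variables (s r Lam : R) (c x : Rn) (kap : Rn -> R).
Hypothesis s01 : 0 < s < 1.
Hypothesis xr : enorm (x - c) < r.
Hypothesis mkap : measurable_fun setT kap.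
Hypothesis kap0 : forall y, 0 <= kap y <= Lam.
Hypothesis kapZ : forall t y, 0 < t -> kap (t *: y) = kap y.

Let F (y : Rn) : R := diff2 (cap s r c) x y * kap y / enorm y `^ (n%:R + 2 * s).

Let mF : measurable_fun setT F.
Proof.
have /andP[s0 s1] := s01.
apply: measurable_funM; last exact: measurable_kernel.
by apply: measurable_funM => //; apply: measurable_diff2; exact: measurable_cap.
Qed.

Let p0 : 0 < n%:R + 2 * s.
Proof. by have /andP[s0 s1] := s01; rewrite ltr_wpDl// mulr_gt0. Qed.

(** The kernel has degree [- n - 2 s]; times [t^(n-1)] there remains [t^(-1-2s)], the kernel in
    dimension one. *)
Let F_ray (t : R) (z : Rn) : 0 < t -> F (t *: z) * t `^ (n%:R - 1) =
  kap z / enorm z `^ (n%:R + 2 * s) *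
  ray_diff s (r ^+ 2 - enorm (x - c) ^+ 2) (- (2 * dotp (x - c) z)) (enorm z ^+
    2) t.
Proof.
move=> t0; rewrite -diff2_cap_line// /F kapZ// enormZ gtr0_norm//.
rewrite powRM ?(ltW t0) ?enorm_ge0// invfM.
have -> : t `^ (-1 - 2 * s) = (t `^ (n%:R + 2 * s))^-1 * t `^ (n%:R - 1).
  rewrite -powRN -powRD; last by rewrite (gt_eqF t0) implybT.
  by congr (_ `^ _); ring.
by ring.
Qed.

Let maxM (a b : R) : 0 <= a -> Num.max (a * b) 0 = a * Num.max b 0.
Proof. by move=> a0; rewrite maxr_pMr// mulr0. Qed.

Let kz (z : Rn) := kap z / enorm z `^ (n%:R + 2 * s).

Let kz0 z : 0 <= kz z.
Proof. by rewrite divr_ge0 ?powR_ge0//; case/andP: (kap0 z). Qed.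

Let Fpos y := Num.max (F y) 0.
Let Fneg y := Num.max (- F y) 0.

Let mFpos : measurable_fun setT Fpos. Proof. exact: measurable_maxr. Qed.
Let mFneg : measurable_fun setT Fneg.
Proof. by apply: measurable_maxr => //; apply: measurableT_comp. Qed.

Let F00 : F 0 = 0.
Proof. by rewrite /F enorm0 powR0 ?gt_eqF// invr0 mulr0. Qed.

Let rayP (z : Rn) := (\int[mu]_(t in `]0%R, +oo[)
  (Num.max (ray_diff s (r ^+ 2 - enorm (x - c) ^+ 2) (- (2 * dotp (x - c) z))
    (enorm z ^+ 2) t) 0)%:E)%E.
Let rayN (z : Rn) := (\int[mu]_(t in `]0%R, +oo[)
  (Num.max (- ray_diff s (r ^+ 2 - enorm (x - c) ^+ 2) (- (2 * dotp (x - c) z))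
    (enorm z ^+ 2) t) 0)%:E)%E.

Let mG z := @measurable_ray_diff R s (r ^+ 2 - enorm (x - c) ^+ 2) (- (2 * dotp
  (x - c) z)) (enorm z ^+ 2) `]0%R, +oo[%classic.

Let rayPE z : (\int[mu]_(t in `]0%R, +oo[) (Fpos (t *: z) * t `^ (n%:R -
  1))%R%:E =
  (kz z)%:E * rayP z)%E.
Proof.
have /andP[s0 s1] := s01.
rewrite -ge0_integralZl_EFin//; last 2 first.
- by move=> t _; rewrite lee_fin le_max lexx orbT.
- by apply/measurable_EFinP; apply: measurable_maxr => //; exact: mG.
apply: eq_integral => t; rewrite inE/= in_itv/= andbT => t0.
rewrite -EFinM; congr EFin; rewrite -maxM// -F_ray// /Fpos.
by rewrite mulrC -maxM ?powR_ge0// mulrC.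
Qed.

Let rayNE z : (\int[mu]_(t in `]0%R, +oo[) (Fneg (t *: z) * t `^ (n%:R -
  1))%R%:E =
  (kz z)%:E * rayN z)%E.
Proof.
have /andP[s0 s1] := s01.
rewrite -ge0_integralZl_EFin//; last 2 first.
- by move=> t _; rewrite lee_fin le_max lexx orbT.
- apply/measurable_EFinP; apply: measurable_maxr => //.
  by apply: measurableT_comp => //; exact: mG.
apply: eq_integral => t; rewrite inE/= in_itv/= andbT => t0.
rewrite -EFinM; congr EFin; rewrite -maxM// mulrN -F_ray// /Fneg.
by rewrite mulrC -maxM ?powR_ge0// mulrN mulrC.
Qed.

Let intP : (\int[leb]_y (Fpos y)%:E =
  2%:E * \int[leb]_z ((shell z)%:E * ((kz z)%:E * rayP z)))%E.
Proof.
have F0' y : 0 <= Fpos y by rewrite le_max lexx orbT.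
have F00' : Fpos 0 = 0 by rewrite /Fpos F00 maxxx.
rewrite [LHS](ge0_integral_rays mFpos F0' F00'); congr (_ * _)%E.
by apply: eq_integral => z _; rewrite rayPE.
Qed.

Let intN : (\int[leb]_y (Fneg y)%:E =
  2%:E * \int[leb]_z ((shell z)%:E * ((kz z)%:E * rayN z)))%E.
Proof.
have F0' y : 0 <= Fneg y by rewrite le_max lexx orbT.
have F00' : Fneg 0 = 0 by rewrite /Fneg F00 oppr0 maxxx.
rewrite [LHS](ge0_integral_rays mFneg F0' F00'); congr (_ * _)%E.
by apply: eq_integral => z _; rewrite rayNE.
Qed.

Let Lam0 : 0 <= Lam.
Proof. by have /andP[h1 h2] := kap0 0; exact: le_trans h2. Qed.

Let S : set Rn := [set z | enorm z <= 2].

Let mS : measurable S.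
Proof.
rewrite (_ : S = @enorm R n @^-1` `]-oo, 2]%classic).
  by rewrite -[X in measurable X]setTI; exact: measurable_enorm.
by apply/seteqP; split => z /=; rewrite in_itv.
Qed.

Let shell_kz z : shell z * kz z <= Lam.
Proof.
have /andP[k0 kL] := kap0 z.
rewrite /shell /kz; case: ifPn => [/andP[z1 z2]|_]; last by rewrite mul0r.
have z0 : 0 < enorm z by exact: lt_le_trans z1.
have u1 : enorm z `^ (-1) <= 1.
  by rewrite powR_inv1 ?(ltW z0)// invf_le1.
have u2 : (enorm z `^ (n%:R + 2 * s))^-1 <= 1.
  rewrite invf_le1 ?powR_gt0// (le_trans _ (ler_powR z1 (ltW p0)))//.
  by rewrite powRr0.
rewrite (le_trans _ kL)// mulrC -mulrA ler_piMr// mulr_ile1 ?invr_ge0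
  ?powR_ge0//.
Qed.

Let shell_le (z : Rn) (C : R) (G : \bar R) : 0 <= C -> (0 <= G)%E ->
  (1 <= enorm z <= 2 -> (G <= C%:E)%E) ->
  ((shell z)%:E * ((kz z)%:E * G) <= (Lam * C)%R%:E * (\1_S z)%:E)%E.
Proof.
move=> C0 G0 GC; case: (boolP (1 <= enorm z <= 2)) => hz.
  have zS : z \in S by rewrite inE /S/=; case/andP: hz.
  rewrite indicE zS mule1 muleA -EFinM [leRHS]EFinM.
  apply: lee_pmul => //; last exact: GC.
    by rewrite lee_fin mulr_ge0 ?shell_ge0 ?kz0.
  by rewrite lee_fin shell_kz.
by rewrite /shell (negbTE hz) mul0e -EFinM lee_fin mulr_ge0// mulr_ge0.
Qed.

Let int_S (C : R) : 0 <= C ->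
  (\int[leb]_z ((Lam * C)%R%:E * (\1_S z)%:E) <= (Lam * C * 4 ^+ n)%R%:E)%E.
Proof.
move=> C0; rewrite ge0_integralZl_EFin ?mulr_ge0//; last first.
  by apply/measurable_EFinP; exact: measurable_indic.
rewrite integral_indic// setIT [leRHS]EFinM; apply: lee_pmul => //.
  by rewrite lee_fin mulr_ge0.
have := lebesgue_rV_enorm_le (ler0n R 2).
by rewrite (_ : 2 * 2 = 4 :> R)//; ring.
Qed.

Let mrayP : measurable_fun setT (fun z => (shell z)%:E * ((kz z)%:E * rayP
  z))%E.
Proof.
have F0' y : 0 <= Fpos y by rewrite le_max lexx orbT.
have := measurable_rays mFpos F0'; apply: eq_measurable_fun => z _.
by rewrite rayPE.
Qed.

Let mrayN : measurable_fun setT (fun z => (shell z)%:E * ((kz z)%:E * rayN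
  z))%E.
Proof.
have F0' y : 0 <= Fneg y by rewrite le_max lexx orbT.
have := measurable_rays mFneg F0'; apply: eq_measurable_fun => z _.
by rewrite rayNE.
Qed.

Let mind (C : R) : measurable_fun setT (fun z => ((Lam * C)%R%:E * (\1_S
  z)%:E)%E).
Proof.
by apply: measurable_funeM; apply/measurable_EFinP; exact: measurable_indic.
Qed.

Let q0 : 0 < r ^+ 2 - enorm (x - c) ^+ 2.
Proof.
have r0 : 0 <= r by rewrite (le_trans _ (ltW xr)) ?enorm_ge0.
by rewrite subr_gt0 ltr_pXn2r// nnegrE enorm_ge0.
Qed.

Let m_gt0 (z : Rn) : 1 <= enorm z -> 0 < enorm z ^+ 2.
Proof. by move=> z1; rewrite exprn_gt0// (lt_le_trans _ z1). Qed.

Let m_le4 (z : Rn) : enorm z <= 2 -> enorm z ^+ 2 <= 4.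
Proof. by move=> z2; have := enorm_ge0 z; nra. Qed.

Let rayN_ge0 z : (0 <= rayN z)%E.
Proof. by apply: integral_ge0 => t _; rewrite lee_fin le_max lexx orbT. Qed.

Let rayP_ge0 z : (0 <= rayP z)%E.
Proof. by apply: integral_ge0 => t _; rewrite lee_fin le_max lexx orbT. Qed.

Lemma cap_neg_fin : (\int[leb]_y (Num.max (- F y) 0)%:E < +oo)%E.
Proof.
(* On the annulus [|q1| <= 2 |x - c| |z| <= 4 r] and [m = |z|^2 <= 4]. *)
have b0 : 0 < 4 * r + 4.
  by rewrite ltr_wpDl// mulr_ge0// (le_trans _ (ltW xr)) ?enorm_ge0.
have [C hC] := integral_ray_diff_neg s01 q0 b0.
have C0 : 0 <= Num.max C 0 by rewrite le_max lexx orbT.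
apply: (@le_lt_trans _ _ (2%:E * (Lam * Num.max C 0 * 4 ^+ n)%R%:E)%E); last
  first.
  by rewrite -EFinM ltry.
rewrite intN lee_pmul2l//.
apply: le_trans (int_S C0); apply: ge0_le_integral => //.
- by move=> z _; rewrite !mule_ge0 ?lee_fin ?shell_ge0 ?kz0.
- move=> z _; apply: shell_le => // /andP[z1 z2].
  apply: (@le_trans _ _ C%:E); last by rewrite lee_fin le_max lexx.
  apply: hC.
    rewrite normrN normrM ger0_norm//.
    have := dotp_enorm_le (x - c) z.
    have : enorm (x - c) * enorm z <= r * 2 by rewrite ler_pM ?enorm_ge0// ltW.
    by lra.
  rewrite sqr_ge0/=; apply: le_trans (m_le4 z2) _.
  by rewrite lerDr mulr_ge0// (le_trans _ (ltW xr)) ?enorm_ge0.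
Qed.

(** Averages [ray_diff_neg_le] over the annulus. The constant collects the 2 of [ge0_integral_rays],
    the bound [Lam] of the kernel, [|z|^2 <= 4] and the volume [4^n] of a cube around the annulus;
    it is free of [r], [c] and [x]. *)
Lemma cap_neg_le : (\int[leb]_y (Num.max (- F y) 0)%:E <=
  \int[leb]_y (Num.max (F y) 0)%:E + (2 * (Lam * (ray_const s 4 + 1) * 4 ^+
    n))%R%:E)%E.
Proof.
have /andP[s0 s1] := s01.
have inv0 : 0 <= s^-1 + (1 - s)^-1 by rewrite addr_ge0// invr_ge0 ?subr_ge0 ltW.
have K0 m : 0 <= ray_const s m by rewrite /ray_const mulr_ge0 ?powR_ge0.
have C0 : 0 <= ray_const s 4 + 1 by rewrite addr_ge0.
rewrite intN intP EFinM -muleDr//; last first.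
  by apply: ge0_adde_def; rewrite inE ?lee_fin ?mulr_ge0 ?exprn_ge0//;
   apply: integral_ge0 => z _; rewrite !mule_ge0 ?lee_fin ?shell_ge0 ?kz0.
rewrite lee_pmul2l//.
apply: (@le_trans _ _ (\int[leb]_z ((shell z)%:E * ((kz z)%:E * rayP z)) +
    \int[leb]_z ((Lam * (ray_const s 4 + 1))%R%:E * (\1_S z)%:E))%E); last
      first.
  by rewrite leeD2l// int_S.
have n1 z : setT z -> (0 <= (shell z)%:E * ((kz z)%:E * rayP z))%E.
  by move=> _; rewrite !mule_ge0 ?lee_fin ?shell_ge0 ?kz0.
have n2 z : setT z -> (0 <= (Lam * (ray_const s 4 + 1))%R%:E * (\1_S z)%:E)%E.
  by move=> _; rewrite mule_ge0 ?lee_fin ?mulr_ge0.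
rewrite -[leRHS](ge0_integralD leb measurableT n1 mrayP n2 (mind _)).
apply: ge0_le_integral => //.
- by move=> z _; rewrite !mule_ge0 ?lee_fin ?shell_ge0 ?kz0.
- by apply: emeasurable_funD.
- move=> z _; case: (boolP (1 <= enorm z <= 2)) => hz; last first.
    by rewrite {1}/shell (negbTE hz) mul0e adde_ge0 ?n1 ?n2.
  have /andP[z1 z2] := hz.
  have h := ray_diff_neg_le (- (2 * dotp (x - c) z)) s01 q0 (m_gt0 z1).
  apply: (@le_trans _ _ ((shell z)%:E * ((kz z)%:E * (rayP z + (ray_const s 4 +
    1)%R%:E)))%E).
    rewrite lee_wpmul2l ?lee_fin ?shell_ge0// lee_wpmul2l ?lee_fin ?kz0//.
    apply: le_trans h _; rewrite leeD2l// lee_fin lerD2r /ray_const ler_wpM2r//.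
    by rewrite ge0_ler_powR ?nnegrE ?(ltW s0) ?m_le4 ?sqr_ge0.
  rewrite ge0_muleDr ?lee_fin// ge0_muleDr ?mule_ge0 ?lee_fin ?kz0//.
  by rewrite leeD2l// shell_le.
Qed.

End kernel.
End cap.

(** * C^k functions *)

Section Ck.
Context {R : realType} {n : nat}.
Notation Rn := 'rV[R]_n.
Variable N : set Rn.
Hypothesis oN : open N.

(** Turns a directional derivative into a derivative in one variable, to which the chain rule on the
    real line applies. *)
Lemma is_derive_lineP (f : Rn -> R) (x v : Rn) (d : R) :
  is_derive x v f d <-> is_derive (0 : R) 1 (fun h : R => f (h *: v + x)) d.
Proof.
have e : (fun h : R => h^-1 *: ((f \o shift x) (h *: v) - f x)) =
    (fun h : R => h^-1 *: (((fun h : R => f (h *: v + x)) \o shift 0) (h *: 1)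
      - f (0 *: v + x))).
  by rewrite funeqE => h /=; rewrite addr0 scale0r add0r [_%:A]mulr1.
by split=> -[h1 h2]; split; rewrite /derivable /derive ?e// -?e.
Qed.

Lemma is_derive_powR_comp (q : Rn -> R) (x v : Rn) (p d : R) : 0 < q x ->
  is_derive x v q d ->
  is_derive x v (fun y => q y `^ p) (p * q x `^ (p - 1) * d).
Proof.
move=> q0 /is_derive_lineP dq; apply/is_derive_lineP.
have q0' : 0 < q (0 *: v + x) by rewrite scale0r add0r.
have := is_derive1_comp (is_derive1_powR p q0') dq.
by rewrite scale0r add0r.
Qed.

Lemma near_open x (P : Rn -> Prop) : N x -> (forall y, N y -> P y) ->
  \forall y \near x, P y.
Proof.
move=> Nx h; have : nbhs x N by apply: open_nbhs_nbhs.
by apply: filterS.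
Qed.

Lemma continuous_ext_open (f g : Rn -> R) (x : Rn) :
  (forall y, N y -> f y = g y) -> N x ->
  {for x, continuous f} -> {for x, continuous g}.
Proof.
move=> fg Nx cf; rewrite /prop_for /continuous_at -fg//; apply: cvg_trans cf.
apply: (@near_eq_cvg _ _ (nbhs x) (nbhs_filter x)).
exact: (near_open (P := fun y => f y = g y) Nx fg).
Qed.

Lemma Ck_ext k f g : (forall x, N x -> f x = g x) -> Ck k N f -> Ck k N g.
Proof.
elim: k f g => [|k IH] f g fg /=.
  by move=> cf x Nx; exact: continuous_ext_open fg Nx (cf x Nx).
move=> [cf df Df]; split.
- by move=> x Nx; exact: continuous_ext_open fg Nx (cf x Nx).
- move=> i x Nx; apply: near_eq_derivable (df i x Nx).
  exact: (near_open (P := fun y => f y = g y) Nx fg).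
- move=> i; apply: IH (Df i) => x Nx; apply: near_eq_derive.
  exact: (near_open (P := fun y => f y = g y) Nx fg).
Qed.

Lemma CkW k f : Ck k.+1 N f -> Ck k N f.
Proof.
elim: k f => [|k IH] f /=; first by case.
by move=> [cf df Df]; split => // i; exact: IH.
Qed.

Lemma CkD k f g : Ck k N f -> Ck k N g -> Ck k N (f + g).
Proof.
elim: k f g => [|k IH] f g /=.
  by move=> cf cg x Nx; apply: continuousD; [exact: cf|exact: cg].
move=> [cf df Df] [cg dg Dg]; split.
- by move=> x Nx; apply: continuousD; [exact: cf|exact: cg].
- by move=> i x Nx; apply: derivableD; [exact: df|exact: dg].
- move=> i; apply: Ck_ext (IH _ _ (Df i) (Dg i)) => x Nx.
  by rewrite deriveD; [|exact: df|exact: dg].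
Qed.

Lemma CkM k f g : Ck k N f -> Ck k N g -> Ck k N (f * g).
Proof.
elim: k f g => [|k IH] f g.
  by move=> cf cg x Nx; apply: continuousM; [exact: cf|exact: cg].
move=> Cf Cg; have [cf df Df] := Cf; have [cg dg Dg] := Cg; split.
- by move=> x Nx; apply: continuousM; [exact: cf|exact: cg].
- by move=> i x Nx; apply: derivableM; [exact: df|exact: dg].
- move=> i; apply: Ck_ext (CkD (IH _ _ (CkW Cf) (Dg i)) (IH _ _ (CkW Cg) (Df
  i))) => x Nx.
  by rewrite deriveM; [|exact: df|exact: dg].
Qed.

Lemma Ck_cst k (a : R) : Ck k N (cst a).
Proof.
elim: k a => [|k IH] a /=; first by move=> x Nx; exact: cst_continuous.
split => [x Nx|i x Nx|i]; [exact: cst_continuous|exact: derivable_cst|].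
by apply: Ck_ext (IH 0) => x Nx; rewrite derive_cst.
Qed.

(** The exponent varies in the induction because the derivative contains [q^(p-1)]. *)
Lemma Ck_powR k (q : Rn -> R) (p : R) : (forall x, N x -> 0 < q x) ->
  Ck k N q -> Ck k N (fun x => q x `^ p).
Proof.
move=> q0; elim: k p => [|k IH] p Cq.
  move=> x Nx; apply: (continuous_comp (f := q) (g := fun t => t `^ p)).
    exact: Cq.
  by apply: continuous_powR; exact: q0.
have [cq dq Dq] := Cq.
have D i x : N x -> is_derive x (delta_mx ord0 i) (fun y => q y `^ p)
    (p * q x `^ (p - 1) * 'D_(delta_mx ord0 i) q x).
  by move=> Nx; apply: is_derive_powR_comp; [exact: q0|exact/derivableP/dq].
split.
- move=> x Nx; apply: (continuous_comp (f := q) (g := fun t => t `^ p)).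
    exact: cq.
  by apply: continuous_powR; exact: q0.
- by move=> i x Nx; have [] := D i x Nx.
- move=> i.
  have C1 : Ck k N (cst p * (fun x => q x `^ (p - 1)) * 'D_(delta_mx ord0 i) q).
    by apply: CkM (Dq i); apply: CkM; [exact: Ck_cst|exact: IH _ (CkW Cq)].
  by apply: Ck_ext C1 => x Nx; have [_ ->] := D i x Nx.
Qed.

Lemma is_derive_coord (i : 'I_n) (x v : Rn) :
  is_derive x v (fun y : Rn => y ord0 i) (v ord0 i).
Proof.
apply/is_derive_lineP.
have e : (fun h : R => (h *: v + x) ord0 i) =1 (v ord0 i \*: (@idfun R) + cst
  (x ord0 i)).
  by move=> h; rewrite !mxE /= mulrC.
have := is_deriveD (is_deriveZ (v ord0 i) (is_derive_id (0 : R) 1))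
  (is_derive_cst (x ord0 i) (0 : R) 1).
rewrite addr0 /GRing.scale/= mulr1 => h.
by apply: is_derive_ext h _ _ => // t; rewrite !mxE /= mulrC.
Qed.

Lemma Ck_coord k (i : 'I_n) : Ck k N (fun y : Rn => y ord0 i).
Proof.
have c x : {for x, continuous (fun y : Rn => y ord0 i : R)}.
  exact: coord_continuous.
case: k => [|k] /=; first by move=> x _; exact: c.
split => [x _|j x _|j]; [exact: c| |].
  by have [] := is_derive_coord i x (delta_mx ord0 j).
apply: Ck_ext (Ck_cst k ((delta_mx ord0 j : Rn) ord0 i)) => x _.
by have [_ ->] := is_derive_coord i x (delta_mx ord0 j).
Qed.

Lemma Ck_sum k (I : Type) (s : seq I) (f : I -> Rn -> R) :
  (forall i, Ck k N (f i)) -> Ck k N (\sum_(i <- s) f i).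
Proof.
move=> Cf; elim: s => [|a s IH]; first by rewrite big_nil; exact: Ck_cst.
by rewrite big_cons; exact: CkD.
Qed.

Lemma Ck_enorm2 k (c : Rn) : Ck k N (fun y => enorm (y - c) ^+ 2).
Proof.
have Cc i : Ck k N ((fun y : Rn => y ord0 i) + cst (- c ord0 i)).
  by apply: CkD; [exact: Ck_coord|exact: Ck_cst].
apply: Ck_ext (Ck_sum (index_enum 'I_n) (fun i => CkM (Cc i) (Cc i))) => x _.
rewrite enormE2 fct_sumE; apply: eq_bigr => i _.
by rewrite !mxE.
Qed.

Lemma Ck_cap k (s r : R) (c : Rn) : (forall x, N x -> enorm (x - c) < r) ->
  Ck k N (cap s r c).
Proof.
move=> Nr.
have q0 x : N x -> 0 < r ^+ 2 - enorm (x - c) ^+ 2.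
  move=> /Nr xr; have := enorm_ge0 (x - c); rewrite subr_gt0 => h.
  by rewrite ltr_pXn2r// nnegrE (le_trans h (ltW xr)).
have C2 := CkD (Ck_cst k (r ^+ 2)) (CkM (Ck_cst k (-1)) (Ck_enorm2 k c)).
have Cq : Ck k N (fun x => r ^+ 2 - enorm (x - c) ^+ 2).
  by apply: Ck_ext C2 => x _ /=; rewrite !fctE /= mulN1r.
apply: Ck_ext (Ck_powR s q0 Cq) => x /q0 h.
by rewrite /cap max_l// ltW.
Qed.

End Ck.

(** * Lower bounds for the operators *)

Section lower.
Local Open Scope ereal_scope.
Context d (T : measurableType d) {R : realType} (m : {measure set T -> \bar R}).

(* The library integral of a function whose positive and negative parts both
   have infinite integral is [-oo], hence the finiteness assumption on [b]. *)
Lemma le_integral_sub (f a b : T -> R) (C : R) :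
  measurable_fun setT f -> measurable_fun setT a -> measurable_fun setT b ->
  (forall x, 0 <= a x)%R -> (forall x, 0 <= b x)%R -> (forall x, a x - b x <= f
    x)%R ->
  \int[m]_x (b x)%:E < +oo ->
  C%:E + \int[m]_x (b x)%:E <= \int[m]_x (a x)%:E ->
  C%:E <= \int[m]_x (f x)%:E.
Proof.
move=> mf ma mb a0 b0 fab bfin Cab.
pose fp x := Num.max (f x) 0%R; pose fn x := Num.max (- f x)%R 0%R.
have mfp : measurable_fun setT fp by exact: measurable_maxr.
have mfn : measurable_fun setT fn.
  by apply: measurable_maxr => //; exact: measurableT_comp.
have fp0 x : (0 <= fp x)%R by rewrite le_max lexx orbT.
have fn0 x : (0 <= fn x)%R by rewrite le_max lexx orbT.
have pos (g : T -> R) : (forall x, 0 <= g x)%R -> 0 <= \int[m]_x (g x)%:E.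
  by move=> g0; apply: integral_ge0 => x _; rewrite lee_fin.
have D (g h : T -> R) : measurable_fun setT g -> measurable_fun setT h ->
    (forall x, 0 <= g x)%R -> (forall x, 0 <= h x)%R ->
    \int[m]_x (g x + h x)%R%:E = \int[m]_x (g x)%:E + \int[m]_x (h x)%:E.
  move=> mg mh g0 h0; under eq_integral do rewrite EFinD.
  rewrite ge0_integralD//; try by move=> x _; rewrite lee_fin.
    exact/measurable_EFinP.
  exact/measurable_EFinP.
have bf : \int[m]_x (b x)%:E \is a fin_num by rewrite ge0_fin_numE ?pos.
have fnf : \int[m]_x (fn x)%:E \is a fin_num.
  rewrite ge0_fin_numE ?pos//; apply: le_lt_trans bfin.
  apply: ge0_le_integral => //; try exact/measurable_EFinP.
  - by move=> x _; rewrite lee_fin.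
  - move=> x _; rewrite lee_fin ge_max b0 andbT lerNl (le_trans _ (fab x))//.
    by rewrite lerDr a0.
(* [a - b <= f] is rewritten between nonnegative functions as [fn + a <= fp + b], which integrates
   without subtraction. *)
have key : \int[m]_x (fn x)%:E + \int[m]_x (a x)%:E <=
    \int[m]_x (fp x)%:E + \int[m]_x (b x)%:E.
  rewrite -!D//; apply: ge0_le_integral => //.
  - by move=> x _; rewrite lee_fin addr_ge0.
  - by apply/measurable_EFinP; exact: measurable_funD.
  - by apply/measurable_EFinP; exact: measurable_funD.
  - move=> x _; rewrite lee_fin; have := fab x.
    have [h|/ltW h] := leP 0%R (f x).
      have -> : fp x = f x by exact: max_l.
      have -> : fn x = 0%R by apply: max_r; rewrite oppr_le0.
      by rewrite add0r -lerBlDr.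
    have -> : fp x = 0%R by exact: max_r.
    have -> : fn x = (- f x)%R by apply: max_l; rewrite oppr_ge0.
    by move=> h2; lra.
have -> : \int[m]_x (f x)%:E = \int[m]_x (fp x)%:E - \int[m]_x (fn x)%:E.
  rewrite integralE; congr (_ - _); apply: eq_integral => x _.
    by rewrite /fp EFin_max funeposE.
  by rewrite /fn EFin_max funenegE EFinN.
rewrite leeBrDr//.
have [p|p] := eqVneq (\int[m]_x (fp x)%:E) +oo; first by rewrite p leey.
rewrite -(leeD2rE _ _ bf) addeAC; apply: le_trans key.
by rewrite addeC leeD2l.
Qed.

End lower.

(** * The kernels of the class and the tail of the negative part *)

Section kernel.
Context {R : realType} {n : nat}.
Notation leb := (@lebesgue_rV R n).
Notation Rn := 'rV[R]_n.
Variables (s lambda Lambda : R) (theta : Rn -> R).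
Hypothesis s01 : 0 < s < 1.
Hypothesis l0 : 0 < lambda.
Hypothesis lL : lambda <= Lambda.
Hypothesis htheta : angular_kernel lambda Lambda theta.

(** The extension of [theta] that is homogeneous of degree 0. The value 0 at the origin replaces the
    meaningless [theta 0], so that the upper bound and the sign hold everywhere. *)
Definition radial (y : Rn) : R := if 0 < enorm y then theta ((enorm y)^-1 *: y)
  else 0.

Lemma enorm_normalize (y : Rn) : 0 < enorm y -> enorm ((enorm y)^-1 *: y) = 1.
Proof. by move=> y0; rewrite enormZ gtr0_norm ?invr_gt0// mulVf// gt_eqF. Qed.

Lemma radial_ge y : 0 < enorm y -> lambda <= radial y.
Proof.
have [_ h _] := htheta; move=> y0; rewrite /radial y0.
by have /h/andP[] := enorm_normalize y0.
Qed.

Lemma radial_bound y : 0 <= radial y <= Lambda.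
Proof.
have [_ h _] := htheta.
rewrite /radial; case: ifPn => y0.
  by have /h/andP[h1 ->] := enorm_normalize y0; rewrite (le_trans _ h1)// ltW.
by rewrite lexx/= (le_trans _ lL)// ltW.
Qed.

Lemma radialZ t y : 0 < t -> radial (t *: y) = radial y.
Proof.
move=> t0; rewrite /radial enormZ gtr0_norm// pmulr_rgt0//; case: ifPn => // y0.
congr theta; rewrite scalerA; congr (_ *: _).
by field; rewrite !gt_eqF.
Qed.

Lemma measurable_radial : measurable_fun setT radial.
Proof.
have [mt _ _] := htheta.
have mS : measurable (@esphere R n).
  rewrite (_ : esphere = @enorm R n @^-1` [set 1]) //.
  by rewrite -[X in measurable X]setTI; exact: measurable_enorm.
(* [theta] is measurable on the sphere only, so it is extended by 0. At [y = 0] the rescaled vector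
   is 0, off the sphere, in agreement with [radial]. *)
rewrite (_ : radial = fun y => (theta \_ esphere) (enorm y `^ (-1) *: y)).
  apply: (measurableT_comp (f := theta \_ esphere)).
    exact/(measurable_restrictT _ mS).
  apply: measurable_rV_scale; last exact: measurable_id.
  exact: (measurableT_comp (measurable_powR (-1)) measurable_enorm).
apply/funext => y; rewrite /radial patchE powR_inv1 ?enorm_ge0//.
case: ifPn => y0.
  by rewrite mem_set//; exact: enorm_normalize.
rewrite memNset// /esphere/= (_ : y = 0) ?scaler0 ?enorm0.
  by apply/eqP; rewrite eq_sym oner_eq0.
by apply/eqP; rewrite -enorm_eq0 eq_le enorm_ge0 andbT leNgt.
Qed.

Let p0 : 0 < n%:R + 2 * s.
Proof. by have /andP[s0 s1] := s01; rewrite ltr_wpDl// mulr_gt0. Qed.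

(** The integrands could differ only at [y = 0], where the conventions [0^p = 0] and [1 / 0 = 0]
    make both vanish. *)
Lemma LopE C f x : Lop s C theta f x =
  (C%:E * \int[leb]_y (diff2 f x y * radial y / enorm y `^ (n%:R + 2 *
    s))%R%:E)%E.
Proof.
rewrite /Lop; congr (_ * _)%E; apply: eq_integral => y _; congr EFin.
rewrite /radial; case: ifPn => // y0.
have -> : enorm y = 0 by apply/eqP; rewrite eq_le enorm_ge0 andbT leNgt.
by rewrite powR0 ?gt_eqF// invr0 !mulr0.
Qed.

(** If [|z - x0| >= rho] and [|x - x0| <= rho / 2], then [1 <= (2 / rho) |z - x|] and
    [|z| <= 2 (1 + |x0| / rho) |z - x|]; the two terms are the powers of these factors. *)
Definition tailC (rho : R) (x0 : Rn) : R :=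
  (2 / rho) `^ (n%:R + 2 * s) + (2 * (1 + enorm x0 / rho)) `^ (n%:R + 2 * s).

Lemma tail_kernel_le (rho : R) (x0 x z : Rn) : 0 < rho ->
  enorm (x - x0) <= rho / 2 -> rho <= enorm (z - x0) ->
  0 < enorm (z - x) /\
  1 + enorm z `^ (n%:R + 2 * s) <= tailC rho x0 * enorm (z - x) `^ (n%:R + 2 *
    s).
Proof.
move=> rho0 xx0 zx0.
have h1 : enorm (z - x0) <= enorm (z - x) + enorm (x - x0).
  by rewrite (le_trans _ (enormD _ _))// addrA subrK.
have h2 : enorm z <= enorm (z - x0) + enorm x0.
  by rewrite (le_trans _ (enormD _ _))// subrK.
have h3 : rho / 2 <= enorm (z - x) by lra.
have h4 : enorm (z - x0) <= 2 * enorm (z - x) by lra.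
have n0 : 0 < enorm (z - x) by apply: lt_le_trans h3; rewrite divr_gt0.
split=> //; rewrite /tailC; set p := n%:R + 2 * s; rewrite mulrDl -!powRM
  ?enorm_ge0//; last 2 first.
- by rewrite mulr_ge0// addr_ge0// divr_ge0 ?enorm_ge0// ltW.
- by rewrite divr_ge0// ltW.
apply: lerD.
  apply: (@le_trans _ _ (1 `^ p)); first by rewrite powR1.
  rewrite ge0_ler_powR ?nnegrE ?(ltW p0)//.
    by rewrite mulr_ge0 ?divr_ge0 ?enorm_ge0// ltW.
  by rewrite mulrAC ler_pdivlMr// mul1r; lra.
rewrite ge0_ler_powR ?nnegrE ?(ltW p0) ?enorm_ge0//.
  by rewrite !mulr_ge0 ?addr_ge0 ?divr_ge0 ?enorm_ge0// ltW.
apply: (le_trans h2).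
have h5 : enorm x0 <= enorm x0 / rho * enorm (z - x0).
  by rewrite mulrAC ler_pdivlMr// ler_wpM2l ?enorm_ge0.
have := ler_wpM2l (_ : 0 <= 1 + enorm x0 / rho) h4.
rewrite addr_ge0 ?divr_ge0 ?enorm_ge0 ?(ltW rho0)// => /(_ isT).
lra.
Qed.

(** [um] vanishes near [x], so on its support the kernel centred at [x] is bounded by the weight of
    [L1s_norm]; the translation and the reflection each give one copy of [U]. *)
Lemma tail_integral (rho U : R) (x0 x : Rn) (um : Rn -> R) : 0 < rho ->
  enorm (x - x0) <= rho / 2 -> measurable_fun setT um ->
  (forall z, 0 <= um z) -> (forall z, enorm (z - x0) < rho -> um z = 0) ->
  (\int[leb]_z (um z / (1 + enorm z `^ (n%:R + 2 * s)))%R%:E = U%:E)%E ->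
  (\int[leb]_y ((um (x + y) + um (x - y)) * radial y / enorm y `^ (n%:R + 2 *
    s))%R%:E
    <= (2 * Lambda * tailC rho x0 * U)%R%:E)%E.
Proof.
move=> rho0 xx0 mum um0 umB hU.
have w0 (z : Rn) : 0 < 1 + enorm z `^ (n%:R + 2 * s) by rewrite ltr_wpDr//
  powR_ge0.
have T0 : 0 <= tailC rho x0 by rewrite addr_ge0 ?powR_ge0.
have L0 : 0 <= Lambda by rewrite (le_trans _ lL)// ltW.
pose g (z : Rn) := um z / (1 + enorm z `^ (n%:R + 2 * s)).
have mg : measurable_fun setT g.
  apply: measurable_funM => //.
  have mw : measurable_fun setT (fun z : Rn => 1 + enorm z `^ (n%:R + 2 * s)).
    apply: measurable_funD => //.
    exact: (measurableT_comp (measurable_powR _) measurable_enorm).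
  have := measurableT_comp (measurable_powR (-1)) mw.
  apply: eq_measurable_fun => z _ /=.
  by rewrite powR_inv1// ltW.
have g0 z : 0 <= g z by rewrite divr_ge0 ?um0// ltW.
have hg : (\int[leb]_z (g z)%:E = U%:E)%E by [].
have i1 : (\int[leb]_y (g (x + y))%:E = U%:E)%E.
  have mE : measurable_fun setT (EFin \o g) by exact/measurable_EFinP.
  have gE z : (0 <= (EFin \o g) z)%E by rewrite lee_fin.
  rewrite -hg -[RHS](ge0_integral_rV_affine x (oner_neq0 R) mE gE).
  rewrite normr1 expr1n mul1e; apply: eq_integral => y _.
  by rewrite scale1r addrC.
have i2 : (\int[leb]_y (g (x - y))%:E = U%:E)%E.
  have mE : measurable_fun setT (EFin \o g) by exact/measurable_EFinP.
  have gE z : (0 <= (EFin \o g) z)%E by rewrite lee_fin.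
  have N1 : (-1 : R) != 0 by rewrite oppr_eq0 oner_neq0.
  rewrite -hg -[RHS](ge0_integral_rV_affine x N1 mE gE).
  rewrite normrN1 expr1n mul1e; apply: eq_integral => y _.
  by rewrite scaleN1r addrC.
have key (z y : Rn) : enorm (z - x) = enorm y ->
    um z * radial y / enorm y `^ (n%:R + 2 * s) <= Lambda * tailC rho x0 * g z.
  move=> zy; have /andP[r0 rL] := radial_bound y.
  have [zr|zr] := ltP (enorm (z - x0)) rho.
    by rewrite umB// !mul0r mulr_ge0// mulr_ge0.
  have [] := tail_kernel_le rho0 xx0 zr; rewrite zy => y0 h.
  rewrite /g mulrCA -(mulrA (um z)) ler_wpM2l// -(mulrA Lambda).
  apply: ler_pM => //; first by rewrite invr_ge0 powR_ge0.
  by rewrite ler_pdivlMr// mulrC ler_pdivrMr ?powR_gt0.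
have -> : (2 * Lambda * tailC rho x0 * U)%:E =
    (\int[leb]_y ((Lambda * tailC rho x0)%R%:E * ((g (x + y))%:E + (g (x -
      y))%:E)))%E.
  rewrite ge0_integralZl_EFin ?mulr_ge0//; last 2 first.
  - by move=> y _; rewrite -EFinD lee_fin addr_ge0.
  - by apply: emeasurable_funD; apply/measurable_EFinP;
      [exact: measurable_shiftl|exact: measurable_shiftr].
  rewrite ge0_integralD//; last 4 first.
  - by move=> y _; rewrite lee_fin.
  - by apply/measurable_EFinP; exact: measurable_shiftl.
  - by move=> y _; rewrite lee_fin.
  - by apply/measurable_EFinP; exact: measurable_shiftr.
  by rewrite i1 i2 -EFinD -EFinM; congr EFin; ring.
apply: ge0_le_integral => //.
- move=> y _; have /andP[r0 _] := radial_bound y.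
  by rewrite lee_fin divr_ge0 ?powR_ge0// mulr_ge0// addr_ge0.
- apply/measurable_EFinP; apply: measurable_funM; last exact: measurable_kernel.
  apply: measurable_funM; last exact: measurable_radial.
  by apply: measurable_funD; [exact: measurable_shiftl|exact:
    measurable_shiftr].
- apply: measurable_funeM; apply: emeasurable_funD; apply/measurable_EFinP.
    exact: measurable_shiftl.
  exact: measurable_shiftr.
- move=> y _; rewrite -EFinD -EFinM lee_fin; set p := n%:R + 2 * s.
  rewrite mulrDr !mulrDl lerD//; apply: key.
    by rewrite addrAC subrr add0r.
  by rewrite addrAC subrr add0r enormN.
Qed.

End kernel.

(** * The operator on the barrier *)

Section barrier.
Context {R : realType} {n : nat}.
Notation leb := (@lebesgue_rV R n).
Notation Rn := 'rV[R]_n.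
Variables (s lambda Lambda : R) (theta : Rn -> R).
Hypothesis n0 : (0 < n)%N.
Hypothesis s01 : 0 < s < 1.
Hypothesis l0 : 0 < lambda.
Hypothesis lL : lambda <= Lambda.
Hypothesis htheta : angular_kernel lambda Lambda theta.

Let p0 : 0 < n%:R + 2 * s.
Proof. by have /andP[s0 s1] := s01; rewrite ltr_wpDl// mulr_gt0. Qed.

(* Comes from a cube of side [r / (2 n)] inside the ball of radius [r / 4],
   on which the kernel is at least [lambda (2 r)^(- n - 2 s)]. *)
Definition massC : R := (2 `^ (n%:R + 2 * s))^-1 * (2 * n%:R)^-1 ^+ n.

Lemma massC_gt0 : 0 < massC.
Proof.
by rewrite mulr_gt0 ?exprn_gt0// invr_gt0 ?powR_gt0// mulr_gt0// ltr0n.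
Qed.

Definition capK : R := 2 * (Lambda * (ray_const s 4 + 1) * 4 ^+ n).

Lemma capK_ge0 : 0 <= capK.
Proof.
have /andP[s0 s1] := s01.
have L0 : 0 <= Lambda by rewrite (le_trans _ lL)// ltW.
rewrite /capK /ray_const !mulr_ge0 ?exprn_ge0// addr_ge0// mulr_ge0 ?powR_ge0//.
by rewrite addr_ge0// invr_ge0 ?subr_ge0 ltW.
Qed.

Definition core (r al : R) (c y : Rn) : R := if enorm (y - c) <= r / 4 then al
  else 0.

Lemma core_ge0 r al c y : 0 <= al -> 0 <= core r al c y.
Proof. by move=> a0; rewrite /core; case: ifP. Qed.

Lemma measurable_enorm_sub (c : Rn) : measurable_fun setT (fun y : Rn => enorm
  (y - c)).
Proof.
have := measurableT_comp measurable_enorm (measurable_rV_affine 1 (- c)).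
by apply: eq_measurable_fun => z _ /=; rewrite scale1r.
Qed.

Lemma measurable_core r al c : measurable_fun setT (core r al c).
Proof.
apply: measurable_fun_ifT => //.
by apply: measurable_fun_ler => //; exact: measurable_enorm_sub.
Qed.

Lemma core_mass (r al : R) (c x : Rn) : 0 < r -> 0 <= al ->
  r / 2 <= enorm (x - c) < r ->
  ((al * lambda * massC * r `^ (- (2 * s)))%R%:E <=
   \int[leb]_y (core r al c (x + y) * radial theta y / enorm y `^ (n%:R + 2 *
     s))%R%:E)%E.
Proof.
move=> r0 al0 /andP[xr1 xr2].
(* Half the side of the cube: by the sum norm its points are within [n h = r / 4] of the centre. *)
pose h := r / (4 * n%:R).
have nR : 0 < n%:R :> R by rewrite ltr0n.
have h0 : 0 < h by rewrite divr_gt0// mulr_gt0.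
pose a : Rn := (c - x) - const_mx h; pose b : Rn := (c - x) + const_mx h.
pose B := [set y : Rn | forall i, y ord0 i \in `[a ord0 i, b ord0 i]].
have mB : measurable B.
  rewrite (_ : B = \bigcap_(i in [set: 'I_n])
      (fun y : 'rV[R]_n => y ord0 i) @^-1` `[a ord0 i, b ord0 i]%classic).
    apply: fin_bigcap_measurable => // i _.
    by rewrite -[X in measurable X]setTI; exact: measurable_coord.
  apply/seteqP; split=> y yB i; first by move=> _; exact: yB.
  exact: (yB i I).
have lB : leb B = ((r * (2 * n%:R)^-1) ^+ n)%:E.
  rewrite lebesgue_rV_box; last by move=> i; rewrite !mxE; lra.
  congr EFin; transitivity (\prod_(i < n) (r * (2 * n%:R)^-1)); last first.
    by rewrite prodr_const card_ord.
  apply: eq_bigr => i _.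
  by rewrite !mxE /h; field; rewrite gt_eqF.
have k0 : 0 <= al * lambda * ((2 * r) `^ (n%:R + 2 * s))^-1.
  by rewrite !mulr_ge0 ?invr_ge0 ?powR_ge0// ltW.
have -> : (al * lambda * massC * r `^ (- (2 * s)))%:E =
    (\int[leb]_y ((al * lambda * ((2 * r) `^ (n%:R + 2 * s))^-1)%R%:E * (\1_B
      y)%:E))%E.
  rewrite ge0_integralZl_EFin//; last by apply/measurable_EFinP; exact:
    measurable_indic.
  rewrite integral_indic// setIT; transitivity
    ((al * lambda * ((2 * r) `^ (n%:R + 2 * s))^-1)%R%:E * ((r * (2 * n%:R)^-1)
      ^+ n)%R%:E)%E; last by rewrite -lB.
  rewrite -EFinM; congr EFin; rewrite /massC; set q := (2 * n%:R)^-1.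
  rewrite powRM ?(ltW r0)// (invfM (2 `^ _)) (exprMn _ r q).
  have -> : r `^ (- (2 * s)) = (r `^ (n%:R + 2 * s))^-1 * r ^+ n.
    rewrite -powRN -powR_mulrn ?(ltW r0)// -powRD; last by rewrite (gt_eqF r0)
      implybT.
    by congr (_ `^ _); ring.
  by set X := r ^+ n; set Y := q ^+ n; ring.
apply: ge0_le_integral => //.
- by move=> y _; rewrite mule_ge0 ?lee_fin.
- by apply: measurable_funeM; apply/measurable_EFinP; exact: measurable_indic.
- apply/measurable_EFinP; apply: measurable_funM; last exact: measurable_kernel.
  apply: measurable_funM; last exact: (measurable_radial htheta).
  by apply: measurable_shiftl; exact: measurable_core.
move=> y _; rewrite -EFinM lee_fin.
have /andP[r1 r2] := radial_bound l0 lL htheta y.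
case: (boolP (y \in B)) => yB; last first.
  rewrite indicE (negbTE yB) mulr0 divr_ge0 ?powR_ge0// mulr_ge0//.
  exact: core_ge0.
rewrite indicE yB mulr1.
have yc : enorm (x + y - c) <= r / 4.
  apply: le_trans (enorm_le_sum _) _.
  have -> : r / 4 = \sum_(i < n) h.
    by rewrite sumr_const card_ord -[RHS]mulr_natr /h; field; rewrite gt_eqF.
  apply: ler_sum => i _; move: yB; rewrite inE => /(_ i).
  by rewrite !mxE in_itv/= ler_norml => /andP[h1 h2]; apply/andP; split; lra.
have ny : enorm y <= 2 * r.
  have := enormD (x + y - c) (- (x - c)); rewrite enormN.
  have -> : x + y - c - (x - c) = y by apply/rowP => i; rewrite !mxE; ring.
  lra.
(* As [r / 2 <= |x - c|], the cube avoids the singularity of the kernel. *)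
have y0 : 0 < enorm y.
  have := enormD (x + y - c) (- y); rewrite enormN.
  have -> : x + y - c - y = x - c by apply/rowP => i; rewrite !mxE; ring.
  lra.
rewrite /core yc; apply: ler_pM => //.
- by rewrite mulr_ge0// ltW.
- by rewrite invr_ge0 powR_ge0.
- by rewrite ler_wpM2l// (radial_ge htheta).
- rewrite lef_pV2 ?posrE ?powR_gt0 ?mulr_gt0//.
  by rewrite ge0_ler_powR ?nnegrE ?(ltW p0) ?(ltW y0)// mulr_ge0// ltW.
Qed.

(* Subtracting [m] on the ball only, instead of everywhere, can only increase
   the operator at points of the ball, and keeps the function in [L1s]. *)
Definition barrier (r kp al m : R) (c : Rn) (um : Rn -> R) (y : Rn) : R :=
  kp * cap s r c y + core r al c y - (if enorm (y - c) < r then m else 0) - um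
    y.

Lemma measurable_barrier r kp al m c um : measurable_fun setT um ->
  measurable_fun setT (barrier r kp al m c um).
Proof.
have /andP[s0 s1] := s01.
move=> mum; apply: measurable_funB => //; apply: measurable_funB.
  apply: measurable_funD; last exact: measurable_core.
  by apply: measurable_funM => //; exact: measurable_cap.
apply: measurable_fun_ifT => //.
by apply: measurable_fun_ltr => //; exact: measurable_enorm_sub.
Qed.

(** At [x] in the outer annulus both [core] and [um] vanish, so [core] enters only with a positive
    sign and [um] only through its tail; the cap costs [kp * capK]. *)
Lemma Lop_barrier_ge (C r kp al m U : R) (c x : Rn) (um : Rn -> R) :
  0 < C -> 0 < r -> 0 <= kp -> 0 <= al -> 0 <= m ->
  r / 2 <= enorm (x - c) < r ->
  measurable_fun setT um -> (forall z, 0 <= um z) -> um x = 0 ->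
  (\int[leb]_y ((um (x + y) + um (x - y)) * radial theta y / enorm y `^ (n%:R +
    2 * s))%R%:E
    <= U%:E)%E ->
  ((C * (al * lambda * massC * r `^ (- (2 * s)) - kp * capK - U))%R%:E <=
   Lop s C theta (barrier r kp al m c um) x)%E.
Proof.
move=> C0 r0 kp0 al0 m0 xr mum um0 umx hU.
have /andP[xr1 xr2] := xr; have /andP[s0 s1] := s01.
rewrite (LopE _ s01) EFinM lee_pmul2l ?lte_fin//.
set p := n%:R + 2 * s; have kap0 := radial_bound l0 lL htheta.
have mkap := measurable_radial htheta.
pose F y := diff2 (cap s r c) x y * radial theta y / enorm y `^ p.
pose E1 y := core r al c (x + y) * radial theta y / enorm y `^ p.
pose E2 y := (um (x + y) + um (x - y)) * radial theta y / enorm y `^ p.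
have mker := @measurable_kernel R n p.
have mF : measurable_fun setT F.
  apply: measurable_funM => //; apply: measurable_funM => //.
  by apply: measurable_diff2; exact: measurable_cap.
have mE1 : measurable_fun setT E1.
  apply: measurable_funM => //; apply: measurable_funM => //.
  by apply: measurable_shiftl; exact: measurable_core.
have mE2 : measurable_fun setT E2.
  apply: measurable_funM => //; apply: measurable_funM => //.
  by apply: measurable_funD; [exact: measurable_shiftl|exact:
    measurable_shiftr].
have w0 y : 0 <= radial theta y / enorm y `^ p.
  by rewrite divr_ge0 ?powR_ge0//; case/andP: (kap0 y).
have E10 y : 0 <= E1 y by rewrite /E1 -mulrA mulr_ge0 ?w0 ?core_ge0.
have E20 y : 0 <= E2 y by rewrite /E2 -mulrA mulr_ge0 ?w0 ?addr_ge0.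
pose Fp y := Num.max (F y) 0; pose Fn y := Num.max (- F y) 0.
have mFp : measurable_fun setT Fp by exact: measurable_maxr.
have mFn : measurable_fun setT Fn by apply: measurable_maxr => //; exact:
  measurableT_comp.
have Fp0 y : 0 <= Fp y by rewrite le_max lexx orbT.
have Fn0 y : 0 <= Fn y by rewrite le_max lexx orbT.
have kapZ := @radialZ R n theta.
have nfin := cap_neg_fin s01 xr2 mkap kap0 kapZ.
have nle := cap_neg_le s01 xr2 mkap kap0 kapZ.
rewrite -/capK in nle.
have D (k : R) (g h : Rn -> R) : 0 <= k -> measurable_fun setT g ->
  measurable_fun setT h ->
    (forall x, 0 <= g x)%R -> (forall x, 0 <= h x)%R ->
    (\int[leb]_x (k * g x + h x)%R%:E =
     k%:E * \int[leb]_x (g x)%:E + \int[leb]_x (h x)%:E)%E.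
  move=> k0 mg mh g0 h0; under eq_integral do rewrite EFinD EFinM.
  rewrite ge0_integralD//; last 4 first.
  - by move=> y _; rewrite mule_ge0 ?lee_fin.
  - by apply: measurable_funeM; exact/measurable_EFinP.
  - by move=> y _; rewrite lee_fin.
  - exact/measurable_EFinP.
  rewrite ge0_integralZl_EFin//; last exact/measurable_EFinP.
  by move=> y _; rewrite lee_fin.
(* The cap is split into [Fp] and [Fn], whose integrals are related by [nle]; [E1] carries the gain
   of [core] and [E2] the tail. *)
apply: (@le_integral_sub _ _ _ leb _ (fun y => kp * Fp y + E1 y) (fun y => kp *
  Fn y + E2 y)).
- apply: measurable_funM => //; apply: measurable_funM => //.
  by apply: measurable_diff2; exact: measurable_barrier.
- by apply: measurable_funD => //; exact: measurable_funM.
- by apply: measurable_funD => //; exact: measurable_funM.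
- by move=> y; rewrite addr_ge0// mulr_ge0.
- by move=> y; rewrite addr_ge0// mulr_ge0.
- move=> y.
  have FE : Fp y - Fn y = F y.
    rewrite /Fp /Fn; have [h|/ltW h] := leP 0 (F y).
      by rewrite [X in _ - X]max_r ?subr0// oppr_le0.
    by rewrite max_l ?oppr_ge0// sub0r opprK.
  have -> : kp * Fp y + E1 y - (kp * Fn y + E2 y) = kp * F y + E1 y - E2 y.
    by rewrite -FE; ring.
  rewrite -subr_ge0.
  pose I1 z : R := if enorm (z - c) < r then m else 0.
  have I1m z : I1 z <= m by rewrite /I1; case: ifP.
  have I1x : I1 x = m by rewrite /I1 xr2.
  have corex : core r al c x = 0.
    by rewrite /core ifF//; apply/negbTE; rewrite -ltNge; lra.
  have -> : diff2 (barrier r kp al m c um) x y * radial theta y / enorm y `^ p -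
     (kp * F y + E1 y - E2 y) =
     (core r al c (x - y) + (2 * m - I1 (x + y) - I1 (x - y))) *
     (radial theta y / enorm y `^ p).
    rewrite /F /E1 /E2 /diff2 /barrier -/(I1 x) -/(I1 (x + y)) -/(I1 (x - y))
      I1x corex umx.
    move: (cap s r c x) (cap s r c (x + y)) (cap s r c (x - y)) => k1 k2 k3.
    move: (core r al c (x + y)) (core r al c (x - y)) (I1 (x + y)) (I1 (x - y))
      => c2 c3 j2 j3.
    move: (um (x + y)) (um (x - y)) (radial theta y) (enorm y `^ p)^-1 => u2 u3
      w e.
    by ring.
  (* Discarded terms: the reflected half of [core], and [2 m - I1 (x + y) - I1 (x - y)], nonnegative
     because [I1] has its maximum [m] at [x]. *)
  rewrite mulr_ge0// addr_ge0 ?core_ge0//.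
  have := I1m (x + y); have := I1m (x - y); lra.
- rewrite D//; apply: lte_add_pinfty; last exact: le_lt_trans hU (ltry _).
  by apply: lte_mul_pinfty => //; rewrite ?lee_fin.
- rewrite !D//.
  have mass := core_mass r0 al0 xr.
  apply: (@le_trans _ _ ((al * lambda * massC * r `^ (- (2 * s)) - kp * capK -
    U)%R%:E +
     (kp%:E * (\int[leb]_y (Fp y)%:E + capK%:E) + U%:E))%E).
    rewrite leeD2l// leeD// lee_wpmul2l// ?lee_fin//.
  rewrite ge0_muleDr//; last 2 first.
  - by apply: integral_ge0 => y _; rewrite lee_fin.
  - by rewrite lee_fin capK_ge0.
  set X := (kp%:E * _)%E; rewrite -EFinM -(addeA X) -EFinD (addeCA _ X) -EFinD.
  rewrite leeD2l//; apply: le_trans mass; rewrite lee_fin le_eqVlt.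
  by apply/orP; left; apply/eqP; move: (_ `^ (- (2 * s))) => z; ring.
Qed.

End barrier.

(** * Comparison with the barrier *)

Section compactness.
Context {R : realType} {n : nat}.
Notation Rn := 'rV[R]_n.

Lemma open_eball (c : Rn) (r : R) : open (eball c r).
Proof.
rewrite openE => x /=; rewrite /eball /= => xr.
have d0 : 0 < r - enorm (x - c) by rewrite subr_gt0.
apply: filterS (eball_nbhs x d0) => y; rewrite /eball/= => yx.
have := enormD (y - x) (x - c); rewrite addrA subrK; lra.
Qed.

Lemma open_outer (c : Rn) (r : R) : open [set y | r < enorm (y - c)].
Proof.
rewrite openE => x /= xr.
have d0 : 0 < enorm (x - c) - r by rewrite subr_gt0.
apply: filterS (eball_nbhs x d0) => y; rewrite /eball/= => yx.
have := enormD (x - y) (y - c); rewrite addrA subrK (enormB x y); lra.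
Qed.

Lemma compact_annulus (c : Rn) (r1 r2 : R) :
  compact [set y | r1 <= enorm (y - c) <= r2].
Proof.
have cS : compact [set v : Rn | forall i, `[c ord0 i - r2, c ord0 i +
  r2]%classic (v ord0 i)].
  apply: (@rV_compact R n (fun i => `[c ord0 i - r2, c ord0 i + r2]%classic))
    => i.
  exact: segment_compact.
apply: subclosed_compact cS _.
  rewrite -openC (_ : ~` _ = eball c r1 `|` [set y | r2 < enorm (y - c)]).
    by apply: openU; [exact: open_eball|exact: open_outer].
  apply/seteqP; split => y /=; rewrite /eball /=.
    by move=> /negP; rewrite negb_and -!ltNge => /orP.
  by move=> h /andP[h1 h2]; case: h; rewrite ltNge ?h1 ?h2.
move=> y /= /andP[_ yr] i; rewrite in_itv/= -ler_distl.
by have := enorm_coord (y - c) i; rewrite !mxE => h; exact: le_trans yr.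
Qed.

(** Without a minimum the open sets [g y < g], for [y] in [K], cover [K]. In a finite subcover a
    centre with the least value of [g] belongs to none of them. *)
Lemma compact_lsc_min (K : set Rn) (g : Rn -> R) : compact K -> K !=set0 ->
  (forall a, open [set x | a < g x]) ->
  exists2 x, K x & forall y, K y -> g x <= g y.
Proof.
move=> cK [x1 Kx1] og; apply: contrapT => nomin.
have lower x : K x -> exists2 y, K y & g y < g x.
  move=> Kx; apply: contrapT => h; apply: nomin; exists x => // y Ky.
  by rewrite leNgt; apply/negP => yx; apply: h; exists y.
move: cK; rewrite compact_cover => /(_ Rn K (fun y => [set x | g y < g x])).
move=> [|x /lower[y Ky yx]|D DK KD]; first by move=> i _; exact: og.
  by exists y.
have minseq (l : seq Rn) : l != [::] -> exists2 z, z \in l & forall y, y \in l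
  -> g z <= g y.
  elim: l => // a l IH _; have [->|l0] := eqVneq l [::].
    by exists a; rewrite ?mem_head// => y; rewrite inE => /eqP->.
  have [z zl zm] := IH l0; have [az|za] := leP (g a) (g z).
    exists a; rewrite ?mem_head// => y; rewrite inE => /predU1P[->//|/zm].
    exact: le_trans.
  exists z; first by rewrite inE zl orbT.
  by move=> y; rewrite inE => /predU1P[->|/zm//]; exact: ltW.
have [y1 /= y1D _] := KD _ Kx1.
have D0 : finmap.enum_fset D != [::].
  by apply/eqP => D0; have : y1 \in finmap.enum_fset D by []; rewrite D0.
have [z zD zm] := minseq _ D0.
have zK : K z by have := DK z zD; rewrite inE.
have [y /= yD yz] := KD _ zK.
by have := zm y yD; rewrite leNgt yz.
Qed.

End compactness.

(** * Integrability of the barrier *)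

Section comparison.
Context {R : realType} {n : nat}.
Notation leb := (@lebesgue_rV R n).
Notation Rn := 'rV[R]_n.
Variable s : R.
Hypothesis s01 : 0 < s < 1.

Let w0 (z : Rn) : 0 < 1 + enorm z `^ (n%:R + 2 * s).
Proof. by rewrite ltr_wpDr// powR_ge0. Qed.

Lemma continuous_cap (r : R) (c : Rn) : continuous (cap s r c).
Proof.
have /andP[s0 s1] := s01.
move=> x; apply: (continuous_comp (f := fun y : Rn => r ^+ 2 - enorm (y - c) ^+
  2)
  (g := fun t : R => Num.max t 0 `^ s)); last exact: continuous_pospowR.
have C2 := Ck_enorm2 openT 0 c.
by apply: continuousB; [exact: cst_continuous|exact: C2].
Qed.

Lemma L1s_norm_neg_fin (u : Rn -> R) : measurable_fun setT u -> L1s s u ->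
  exists U : R, L1s_norm s (u^\-)%R = U%:E /\ 0 <= U.
Proof.
move=> mu [_ hu].
have mw : measurable_fun setT (fun z : Rn => 1 + enorm z `^ (n%:R + 2 * s)).
  by apply: measurable_funD => //; exact: (measurableT_comp (measurable_powR _)
    measurable_enorm).
have mwi : measurable_fun setT (fun z : Rn => (1 + enorm z `^ (n%:R + 2 *
  s))^-1).
  have := measurableT_comp (measurable_powR (-1)) mw.
  by apply: eq_measurable_fun => z _ /=; rewrite powR_inv1// ltW.
have mn : measurable_fun setT (u^\-).
  by apply: measurable_maxr => //; exact: measurableT_comp.
have f0 : (0 <= L1s_norm s (u^\-)%R)%E.
  by apply: integral_ge0 => x _; rewrite lee_fin divr_ge0// ltW.
have ff : (L1s_norm s (u^\-)%R < +oo)%E.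
  apply: le_lt_trans hu; apply: ge0_le_integral => //.
  - by move=> x _; rewrite lee_fin divr_ge0// ltW.
  - apply/measurable_EFinP; apply: measurable_funM => //; exact:
    measurableT_comp.
  - apply/measurable_EFinP; apply: measurable_funM => //; exact:
    measurableT_comp.
  - move=> x _; rewrite lee_fin ler_wpM2r ?invr_ge0 ?(ltW (w0 x))//.
    rewrite ger0_norm ?funrneg_ge0// /funrneg ge_max normr_ge0 andbT.
    by rewrite -normrN ler_norm.
exists (fine (L1s_norm s (u^\-)%R)); rewrite fineK ?fine_ge0//.
by rewrite ge0_fin_numE.
Qed.

(** Up to the term [u^-] the barrier is bounded and vanishes outside the ball. *)
Lemma L1s_barrier (r kp al m : R) (c : Rn) (u : Rn -> R) :
  0 < r -> 0 <= kp -> 0 <= al -> 0 <= m -> measurable_fun setT u -> L1s s u ->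
  L1s s (barrier s r kp al m c (u^\-)).
Proof.
move=> r0 kp0 al0 m0 mu Lu; have /andP[s0 s1] := s01.
have mn : measurable_fun setT (u^\-).
  by apply: measurable_maxr => //; exact: measurableT_comp.
have mb := measurable_barrier s01 r kp al m c mn.
split; first by exists (barrier s r kp al m c (u^\-)) => //; exact: aeW.
have [U [hU U0]] := L1s_norm_neg_fin mu Lu.
have mw : measurable_fun setT (fun z : Rn => 1 + enorm z `^ (n%:R + 2 * s)).
  by apply: measurable_funD => //; exact: (measurableT_comp (measurable_powR _)
    measurable_enorm).
have mwi : measurable_fun setT (fun z : Rn => (1 + enorm z `^ (n%:R + 2 *
  s))^-1).
  have := measurableT_comp (measurable_powR (-1)) mw.
  by apply: eq_measurable_fun => z _ /=; rewrite powR_inv1// ltW.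
pose B : set Rn := [set z | enorm z <= r + enorm c].
have mB : measurable B.
  rewrite (_ : B = @enorm R n @^-1` `]-oo, (r + enorm c)]%classic).
    by rewrite -[X in measurable X]setTI; exact: measurable_enorm.
  by apply/seteqP; split => z /=; rewrite in_itv.
pose k := kp * r `^ (2 * s) + al + m.
have k0 : 0 <= k by rewrite !addr_ge0// mulr_ge0 ?powR_ge0.
apply: (@le_lt_trans _ _ (\int[leb]_z (k%:E * (\1_B z)%:E +
    (`|(u^\-) z| / (1 + enorm z `^ (n%:R + 2 * s)))%R%:E))%E); last first.
  rewrite ge0_integralD//; last 4 first.
  - by move=> y _; rewrite mule_ge0 ?lee_fin.
  - by apply: measurable_funeM; apply/measurable_EFinP; exact: measurable_indic.
  - by move=> y _; rewrite lee_fin divr_ge0// ltW.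
  - by apply/measurable_EFinP; apply: measurable_funM => //; exact:
    measurableT_comp.
  apply: lte_add_pinfty; last by rewrite -/(L1s_norm s (u^\-)%R) hU ltry.
  rewrite ge0_integralZl_EFin//; last by apply/measurable_EFinP; exact:
    measurable_indic.
  apply: lte_mul_pinfty => //; rewrite integral_indic// setIT.
  apply: le_lt_trans (lebesgue_rV_enorm_le _) (ltry _).
  by rewrite addr_ge0 ?enorm_ge0// ltW.
apply: ge0_le_integral => //.
- by move=> x _; rewrite lee_fin divr_ge0// ltW.
- by apply/measurable_EFinP; apply: measurable_funM => //; exact:
  measurableT_comp.
- apply: emeasurable_funD.
    by apply: measurable_funeM; apply/measurable_EFinP; exact: measurable_indic.
  by apply/measurable_EFinP; apply: measurable_funM => //; exact:
    measurableT_comp.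
move=> z _; rewrite -EFinM -EFinD lee_fin.
have inv1 : (1 + enorm z `^ (n%:R + 2 * s))^-1 <= 1.
  by rewrite invf_le1// lerDl powR_ge0.
have inv0 : 0 <= (1 + enorm z `^ (n%:R + 2 * s))^-1 by rewrite invr_ge0 ltW.
pose A z := kp * cap s r c z + core r al c z - (if enorm (z - c) < r then m
  else 0).
have AB : `|A z| <= k * \1_B z.
  case: (boolP (z \in B)) => zB.
    rewrite indicE zB mulr1 /A (le_trans (ler_normB _ _))//.
    rewrite lerD//; last by case: ifP => _; rewrite ?normr0// ger0_norm.
    rewrite (le_trans (ler_normD _ _))// lerD//.
      by rewrite ger0_norm ?mulr_ge0 ?cap_ge0// ler_wpM2l// cap_le// ltW.
    by rewrite ger0_norm ?core_ge0// /core; case: ifP.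
  rewrite indicE (negbTE zB) mulr0.
  have zr : r < enorm (z - c).
    move: zB; rewrite notin_setE /B /= => /negP; rewrite -ltNge => h.
    by have := enormD (z - c) c; rewrite subrK; lra.
  rewrite /A (cap_out _ (ltW zr)) ?(ltW r0)// mulr0 add0r ltNge (ltW zr) /=
    subr0.
  by rewrite /core ifF ?normr0//; apply/negbTE; rewrite -ltNge; lra.
have -> : barrier s r kp al m c (u^\-) z = A z - (u^\-) z by [].
apply: (@le_trans _ _ ((`|A z| + `|(u^\-) z|) / (1 + enorm z `^ (n%:R + 2 *
  s)))).
  by rewrite ler_wpM2r// ler_normB.
rewrite mulrDl lerD2r; apply: le_trans AB.
by rewrite ler_piMr.
Qed.

End comparison.

(** * Touching from below and growth of the cap in a cone *)

Section comparison.
Context {R : realType} {n : nat}.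
Notation leb := (@lebesgue_rV R n).
Notation Rn := 'rV[R]_n.
Variables (s lambda Lambda Cns : R).
Hypothesis n0 : (0 < n)%N.
Hypothesis s01 : 0 < s < 1.
Hypothesis l0 : 0 < lambda.
Hypothesis lL : lambda <= Lambda.
Hypothesis C0 : 0 < Cns.

(** If [u - kp cap] has a minimum [- m < 0] over the closed annulus, the barrier lowered by [m] on
    the ball touches [u] from below at the minimum point. There [u <= kp cap <= al], so
    [V u >= - M al], and the last inequality assumed contradicts the viscosity inequality. The
    [2 al] on the half ball leaves room for [kp cap <= al] plus a bump of height [al]; [4 r <= rho]
    puts the ball [B_r(c)] inside [B_(rho/2)(x0)], at a distance from the support of [u^-]. *)
Lemma barrier_comparison (Omega : set Rn) (V u : Rn -> R) (x0 c : Rn)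
    (rho r M al dl U : R) :
  L1s s u -> lower_semicontinuous (EFin \o u) ->
  viscosity_supersolution s lambda Lambda Cns Omega V u ->
  (forall x, eball x0 rho x -> 0 <= u x) ->
  (forall x, (Omega `&` eball x0 rho) x -> 0 < u x) ->
  eball c r `<=` Omega -> enorm (x0 - c) = r -> 0 < r -> 4 * r <= rho ->
  (forall x, Omega x -> - V x <= M) -> 0 <= M ->
  0 < al -> (forall x, eball c (r / 2) x -> 2 * al <= u x) ->
  0 < dl <= 1 -> L1s_norm s (u^\-)%R = U%:E ->
  M * al < Cns * (al * lambda * massC (n := n) s * r `^ (- (2 * s)) -
    dl * al * r `^ (- (2 * s)) * capK (n := n) s Lambda - 2 * Lambda * tailC s
      rho x0 * U) ->
  forall y, r / 2 <= enorm (y - c) < r ->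
    dl * al * r `^ (- (2 * s)) * cap s r c y <= u y.
Proof.
move=> Lu lu visc ge0 gt0 BO x0c r0 r4 VM M0 al0 ual /andP[dl0 dl1] hU ineq.
have /andP[s0 s1] := s01.
set kp := dl * al * r `^ (- (2 * s)) in ineq *.
have kp0 : 0 <= kp by rewrite !mulr_ge0 ?powR_ge0// ltW.
have kpcap y : kp * cap s r c y <= al.
  apply: (@le_trans _ _ (kp * r `^ (2 * s))).
    by rewrite ler_wpM2l// cap_le// ltW.
  rewrite /kp -mulrA -powRD; last by rewrite (gt_eqF r0) implybT.
  by rewrite addNr powRr0 mulr1 ler_piMl// ltW.
have mu := lower_semicontinuous_measurable_rV lu.
have mn : measurable_fun setT (u^\-).
  by apply: measurable_maxr => //; exact: measurableT_comp.
have inball y : enorm (y - c) <= r -> enorm (y - x0) <= rho / 2.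
  move=> yc; have := enormD (y - c) (- (x0 - c)); rewrite enormN x0c.
  have -> : y - c - (x0 - c) = y - x0 by apply/rowP => i; rewrite !mxE; ring.
  lra.
have rho0 : 0 < rho by apply: lt_le_trans r4; rewrite mulr_gt0.
have eb y : enorm (y - c) <= r -> eball x0 rho y.
  by move=> /inball h; rewrite /eball/=; lra.
have um0 y : eball x0 rho y -> u^\- y = 0.
  by move=> /ge0 h; rewrite /funrneg max_r// oppr_le0.
pose g y := u y - kp * cap s r c y.
have og a : open [set x | a < g x].
  rewrite openE => x /= ax; rewrite /g in ax.
  pose e := (u x - kp * cap s r c x - a) / 2.
  have e0 : 0 < e by rewrite divr_gt0// subr_gt0.
  have ux : \forall y \near x, u x - e < u y.
    have lux := (lower_semicontinuousP _).1 lu (u x - e).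
    have : nbhs x [set y | ((u x - e)%:E < (EFin \o u) y)%E].
      by apply: open_nbhs_nbhs; split => //=; rewrite lte_fin gtrBl.
    by apply: filterS => y /=; rewrite lte_fin.
  have cx : \forall y \near x, kp * cap s r c y < kp * cap s r c x + e.
    have k1 : 0 < kp + 1 by rewrite ltr_wpDl.
    have /(@cvgrPdist_lt _ _ _ (nbhs x) (nbhs_filter x)) := continuous_cap s01
      (r := r) (c := c) (x := x).
    move=> /(_ (e / (kp + 1))); rewrite divr_gt0// => /(_ isT).
    apply: filterS => y; rewrite ltr_norml => /andP[h _].
    move: h; set e' := e / (kp + 1) => h.
    have h2 : cap s r c y <= cap s r c x + e'.
      by apply/ltW; rewrite -ltrBlDl; move: h; rewrite ltrNl opprB.
    apply: le_lt_trans (ler_wpM2l kp0 h2) _; rewrite /e'.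
    by rewrite mulrDr ltrD2l mulrA ltr_pdivrMr// (mulrC kp) ltr_pM2l// ltrDl.
  have aux (k1 k2 u1 u2 : R) : u1 - (u1 - k1 - a) / 2 < u2 ->
      k2 < k1 + (u1 - k1 - a) / 2 -> a < u2 - k2 by lra.
  near=> y; rewrite /g /=.
  have h1 : u x - e < u y by near: y.
  have h2 : kp * cap s r c y < kp * cap s r c x + e by near: y.
  exact: aux h1 h2.
pose K := [set y : Rn | r / 2 <= enorm (y - c) <= r].
have K0 : K !=set0 by exists x0; rewrite /K/= x0c lexx andbT; lra.
have [xh Kxh xmin] := compact_lsc_min (@compact_annulus R n c (r / 2) r) K0 og.
have [g0|gneg] := leP 0 (g xh).
  move=> y /andP[y1 y2]; rewrite -subr_ge0.
  by apply: le_trans g0 (xmin y _); rewrite /K/= y1 ltW.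
exfalso; pose m := - g xh.
have m0 : 0 < m by rewrite oppr_gt0.
have /andP[xh1 xh2] := Kxh.
(* On the outer sphere the cap vanishes and [u >= 0]. *)
have xhr : enorm (xh - c) < r.
  rewrite lt_neqAle xh2 andbT; apply/eqP => xhr; move: gneg.
  rewrite /g cap_out ?xhr ?(ltW r0)// mulr0 subr0 ltNge.
  by rewrite ge0//; apply: eb; rewrite xhr.
have xhO : Omega xh by exact: BO.
have uxh : 0 < u xh by apply: gt0; split => //; exact: eb.
pose phi := barrier s r kp al m c (u^\-).
(* The minimum point may lie on the inner sphere [|y - c| = r / 2], so the neighbourhood extends
   inwards up to the edge of the bump. *)
pose N := eball c r `&` [set y | r / 4 < enorm (y - c)].
have oN : open N by apply: openI; [exact: open_eball|exact: open_outer].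
have Nxh : N xh by split => //=; lra.
have NO : N `<=` Omega by move=> y [/BO].
have phiN y : N y -> (cst kp * cap s r c + cst (- m)) y = phi y.
  move=> [y1 y2]; rewrite !fctE /phi /barrier /core.
  have yr : enorm (y - c) < r by exact: y1.
  rewrite yr ifF ?um0 ?addr0 ?subr0//; first by apply: eb; exact: ltW.
  by apply/negbTE; rewrite -ltNge.
have CN : Ck 2 N phi.
  apply: (Ck_ext oN phiN).
  apply: (CkD oN); last exact: (Ck_cst oN).
  apply: (CkM oN); first exact: (Ck_cst oN).
  by apply: (Ck_cap oN) => y [].
have phix : phi xh = u xh.
  rewrite -phiN// !fctE /m /g; lra.
(* Outside the ball [phi = - u^-]; on the half ball [2 al] dominates; in between this is the
   minimality of [xh]. *)
have phile z : phi z <= u z.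
  rewrite /phi /barrier; have [zr|rz] := ltP (enorm (z - c)) r; last first.
    rewrite cap_out ?(ltW r0)// mulr0 add0r subr0 /core ifF; last first.
      by apply/negbTE; rewrite -ltNge; lra.
    by rewrite sub0r lerNl /funrneg le_max lexx.
  rewrite (um0 _ (eb _ (ltW zr))) subr0.
  have [z2|z2] := ltP (enorm (z - c)) (r / 2).
    have h1 : core r al c z <= al by rewrite /core; case: ifP => // _; exact:
      ltW.
    have := ual z z2; have := kpcap z; lra.
  rewrite /core ifF; last by apply/negbTE; rewrite -ltNge; lra.
  have Kz : K z by rewrite /K/= z2 ltW.
  have := xmin z Kz; rewrite {2}/g /m; lra.
have Lphi : L1s s phi.
  by apply: L1s_barrier => //; exact: ltW.
have := visc xh N phi oN Nxh NO Lphi CN phix phile.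
rewrite leNgt => /negP; apply.
pose ell := Cns * (al * lambda * massC (n := n) s * r `^ (- (2 * s)) -
    kp * capK (n := n) s Lambda - 2 * Lambda * tailC s rho x0 * U).
have Mell : (ell%:E <= Mminus s lambda Lambda Cns phi xh)%E.
  apply: le_ereal_inf_tmp => _ [theta htheta <-].
  apply: (Lop_barrier_ge (lambda := lambda) (Lambda := Lambda)) => //; try
    exact: ltW.
  - by rewrite xh1.
  - by apply: um0; exact: eb.
  - apply: (tail_integral s01 l0 lL htheta rho0 (inball _ xh2) mn) => //.
    rewrite -hU; apply: eq_integral => z _; congr ((_ / _)%:E).
    by rewrite ger0_norm// funrneg_ge0.
apply: (@lt_le_trans _ _ (ell%:E + (V xh * u xh)%:E)%E); last by rewrite leeD2r.
rewrite -EFinD lte_fin.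
have h1 : - V xh * u xh <= M * u xh by rewrite ler_wpM2r ?VM// ltW.
have h2 : M * u xh <= M * al.
  rewrite ler_wpM2l//; apply: le_trans (kpcap xh).
  by move: gneg; rewrite /g subr_lt0 => /ltW.
have : M * al < ell by [].
by rewrite mulNr in h1; lra.
Unshelve. all: by end_near. Qed.

Lemma boundary_eball (c x : Rn) (r : R) : boundary (eball c r) x -> enorm (x -
  c) = r.
Proof.
move=> [cl ni]; apply/eqP; rewrite eq_le; apply/andP; split; rewrite leNgt;
  apply/negP => h.
  have nx : nbhs x [set y | r < enorm (y - c)].
    by apply: open_nbhs_nbhs; split => //; exact: open_outer.
  have [y [/= yc yx]] := cl _ nx.
  by move: yc; rewrite /eball/= ltNge (ltW yx).
by apply: ni; apply: open_nbhs_nbhs; split; [exact: open_eball|].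
Qed.

(** [r^2 - |x - c|^2 = 2 <x - x0, c - x0> - |x - x0|^2]. The angle makes the first term at least
    [2 r sin beta |x - x0|], and half of it absorbs the square when [|x - x0| <= r sin beta]. *)
Lemma cone_cap_ge (x0 c x : Rn) (r beta : R) : 0 < r -> enorm (x0 - c) = r ->
  0 < beta < pi / 2 -> x != x0 -> cone x0 (c - x0) (pi / 2 - beta) x ->
  enorm (x - x0) <= r * sin beta ->
  (r * sin beta) `^ s * enorm (x - x0) `^ s <= cap s r c x.
Proof.
have /andP[s0 s1] := s01.
move=> r0 x0c /andP[b0 b1] xx0; rewrite /cone /= /angle enormB x0c.
set e := enorm (x - x0); set d := dotp _ _ => hang er.
have e0 : 0 < e by rewrite lt_neqAle enorm_ge0 eq_sym enorm_eq0 subr_eq0 xx0.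
have er0 : 0 < e * r by rewrite mulr_gt0.
have sb : 0 < sin beta by apply: sin_gt0_pi; rewrite b0/=; have := @pi_gt0 R;
  lra.
have dle : -1 <= d / (e * r) <= 1.
  have := dotp_enorm_le (x - x0) (c - x0); rewrite (enormB c) x0c -/d -/e
    ler_norml.
  by rewrite ler_pdivrMr// ler_pdivlMr// mul1r mulN1r.
have dsin : e * r * sin beta <= d.
  have : cos (pi / 2 - beta) < cos (acos (d / (e * r))).
    have i1 : pi / 2 - beta \in `[0, pi].
      by rewrite in_itv/= subr_ge0 (ltW b1)/= lerBlDr; have := @pi_gt0 R; lra.
    have i2 : acos (d / (e * r)) \in `[0, pi].
      by rewrite in_itv/= acos_ge0// acos_lepi.
    by rewrite ltr_cos.
  rewrite acosK ?in_itv// cosB cos_pihalf sin_pihalf mul0r add0r mul1r => h.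
  by rewrite mulrC -ler_pdivlMr// ltW.
have q : r * sin beta * e <= r ^+ 2 - enorm (x - c) ^+ 2.
  have -> : x - c = (x - x0) - (c - x0) by apply/rowP => i; rewrite !mxE; ring.
  have -> : enorm (x - x0 - (c - x0)) ^+ 2 = e ^+ 2 - 2 * d + r ^+ 2.
    rewrite /e -x0c -(enormB c x0) !enormE2 /d.
    move: (x - x0) (c - x0) => a b.
    by rewrite !(dotpDl, dotpDr, dotpNl, dotpNr) (dotpC b a); ring.
  have : e ^+ 2 <= e * (r * sin beta) by rewrite expr2 ler_wpM2l// ltW.
  lra.
have rs0 : 0 <= r * sin beta by rewrite mulr_ge0 ?ltW.
rewrite -powRM ?(ltW e0)// /cap; apply: ge0_ler_powR; first exact: ltW.
- by rewrite nnegrE mulr_ge0// ltW.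
- by rewrite nnegrE le_max lexx orbT.
- by rewrite le_max q.
Qed.

End comparison.

(** * Choice of the constants and conclusion *)

Theorem theorem3 (R : realType) (n : nat) (s lambda Lambda Cns : R)
  (hn : (0 < n)%N) (hs : 0 < s < 1) (hl : 0 < lambda) (hL : lambda <= Lambda)
  (hC : 0 < Cns)
  (Omega : set 'rV[R]_n) (hOmega : open Omega)
  (x0 : 'rV[R]_n) (hx0 : boundary Omega x0)
  (r0 : R) (hr0 : 0 < r0) (xc : R -> 'rV[R]_n)
  (hball : interior_balls Omega x0 r0 xc)
  (V : 'rV[R]_n -> R) (hV : L1loc Omega V) (hVn : bounded_neg_part Omega V)
  (rho : R) (hrho : 0 < rho) :
  exists Ct c r1 : R, [/\ 0 < Ct, 0 < c, 0 < r1 <= r0 &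
    forall u : 'rV[R]_n -> R,
      L1s s u -> lower_semicontinuous (EFin \o u) ->
      u x0 = 0 -> Linfty u^\- ->
      viscosity_supersolution s lambda Lambda Cns Omega V u ->
      (forall x, eball x0 rho x -> 0 <= u x) ->
      (forall x, (Omega `&` eball x0 rho) x -> 0 < u x) ->
      forall r : R, 0 < r <= r1 ->
        (Ct%:E * L1s_norm s (u^\-)%R <
          ereal_inf [set (u x)%:E | x in eball (xc r) (r / 2)] *
            (r `^ (2 * s))^-1%:E * c%:E)%E ->
        forall beta : R, 0 < beta < pi / 2 ->
          (0 < limf_einf (fun x => (u x / enorm (x - x0) `^ s)%:E)
            (within (Omega `&` cone x0 (xc r - x0)%R (pi / 2 - beta)%R)
              (nbhs x0)))%E].
Proof.
have /andP[s0 s1] := hs.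
have LL0 : 0 < Lambda by exact: lt_le_trans hL.
have [M0 hM0] := hVn; pose M := Num.max M0 0.
have M_ge0 : 0 <= M by rewrite le_max lexx orbT.
have VM x : Omega x -> - V x <= M.
  by move=> /hM0; rewrite /funrneg ge_max le_max => /andP[-> _].
pose v := massC (R := R) (n := n) s; pose K := capK (R := R) (n := n) s Lambda.
have v0 : 0 < v by exact: massC_gt0.
have K0 : 0 <= K by exact: (capK_ge0 hs hl hL).
pose lv := lambda * v.
have lv0 : 0 < lv by rewrite mulr_gt0.
have T0 : 0 < tailC s rho x0.
  rewrite /tailC ltr_wpDr ?powR_ge0// powR_gt0// divr_gt0//.
(* The cap may spend half of the mass [lv]; [K + 1] avoids a zero denominator. *)
pose dl := Num.min 1 (lv / (2 * (K + 1))).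
have K1 : 0 < K + 1 by rewrite ltr_wpDl.
have dl0 : 0 < dl by rewrite lt_min ltr01 divr_gt0// mulr_gt0.
have dl1 : dl <= 1 by rewrite ge_min lexx.
have dlK : dl * K <= lv / 2.
  apply: (@le_trans _ _ (dl * (K + 1))); first by rewrite ler_wpM2l ?(ltW
    dl0)// lerDl.
  rewrite -ler_pdivlMr// -mulrA -invfM; apply: le_trans (_ : _ <= lv / (2 * (K
    + 1))) _ => //.
  by rewrite ge_min lexx orbT.
(* [r^(2 s) <= tt] lets [V^-] spend at most a quarter of the mass. *)
pose tt := Cns * lv / (8 * (M + 1)).
have M1 : 0 < M + 1 by rewrite ltr_wpDl.
have tt0 : 0 < tt by apply: divr_gt0; apply: mulr_gt0.
(* The remaining quarter goes to the tail: with [al] half of the infimum [ar] of [u],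
   [ar * (lv / 8)] is [al * (lv / 4)]. *)
exists (2 * Lambda * tailC s rho x0), (lv / 8),
  (Num.min (Num.min r0 (rho / 4)) (tt `^ (2 * s)^-1)).
split.
- by rewrite !mulr_gt0.
- by rewrite divr_gt0.
- by rewrite !lt_min hr0 divr_gt0// powR_gt0//= !ge_min lexx.
move=> u Lu lu ux0 _ visc ge0 gt0 r /andP[r_gt0].
rewrite !le_min => /andP[/andP[rr0 rrho] rtt] hyp beta hbeta.
have mu := lower_semicontinuous_measurable_rV lu.
have [U [hU U0]] := L1s_norm_neg_fin mu Lu.
have [ballO bd] : eball (xc r) r `<=` Omega /\
    (boundary (eball (xc r) r) `&` boundary Omega) x0 by apply: hball; rewrite
      r_gt0.
have x0c : enorm (x0 - xc r) = r by apply: boundary_eball; case: bd.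
have rw0 : 0 < r `^ (2 * s) by exact: powR_gt0.
have rwtt : r `^ (2 * s) <= tt.
  have -> : tt = (tt `^ (2 * s)^-1) `^ (2 * s).
    rewrite -powRrM mulVf; first by rewrite powRr1// ltW.
    by rewrite mulf_neq0// gt_eqF.
  apply: ge0_ler_powR; rewrite ?nnegrE ?powR_ge0//; last exact: ltW.
  by rewrite mulr_ge0// ltW.
move: hyp; set A := ereal_inf _; rewrite hU => hyp.
have Ale x : eball (xc r) (r / 2) x -> (A <= (u x)%:E)%E.
  by move=> xB; apply: ereal_inf_lbound; exists x.
(* [A] is at most [u (xc r)], and [A = -oo] would make the right side of [hyp] equal to [-oo]. *)
have [ar AE] : exists ar : R, A = ar%:E.
  have := Ale (xc r); rewrite /eball/= subrr enorm0 divr_gt0// => /(_ isT).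
  case EA : A hyp => [a| |] //=; first by exists a.
  rewrite gt0_mulNye ?lte_fin ?invr_gt0// gt0_mulNye ?lte_fin ?divr_gt0//.
move: hyp; rewrite AE -!EFinM lte_fin => hyp.
pose rho' := (r `^ (2 * s))^-1.
have rho'0 : 0 < rho' by rewrite invr_gt0.
have ar0 : 0 < ar.
  have : 0 < ar * rho' * (lv / 8).
    by apply: le_lt_trans hyp; rewrite !mulr_ge0// ltW.
  have l8 : 0 < lv / 8 by rewrite divr_gt0.
  by rewrite (pmulr_lgt0 _ l8) (pmulr_lgt0 _ rho'0).
pose al := ar / 2.
have al0 : 0 < al by rewrite divr_gt0.
have ual x : eball (xc r) (r / 2) x -> 2 * al <= u x.
  by move=> /Ale; rewrite AE lee_fin /al mulrC divfK.
have rN : r `^ (- (2 * s)) = rho' by rewrite powRN.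
have MC : M <= Cns * rho' * lv / 4.
  have h : 1 <= rho' * tt by rewrite mulrC ler_pdivlMr// mul1r.
  move: h; rewrite /tt !mulrA ler_pdivlMr ?mulr_gt0// mul1r => h.
  rewrite ler_pdivlMr// (mulrC Cns); lra.
have ineq : M * al < Cns * (al * lambda * v * r `^ (- (2 * s)) -
    dl * al * r `^ (- (2 * s)) * K - 2 * Lambda * tailC s rho x0 * U).
  rewrite rN -(mulrA al) -/lv.
  have h1 : M * al <= Cns * (al * rho' * lv / 4).
    by have := ler_wpM2r (ltW al0) MC; lra.
  apply: le_lt_trans h1 _; rewrite ltr_pM2l//.
  have h2 : dl * al * rho' * K <= al * rho' * lv / 2.
    have alr0 : 0 <= al * rho' by rewrite mulr_ge0// ltW.
    by have := ler_wpM2l alr0 dlK; lra.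
  by move: hyp; rewrite -/rho' (_ : ar = 2 * al); [lra|rewrite /al mulrC divfK].
have dl01 : 0 < dl <= 1 by rewrite dl0.
have r4 : 4 * r <= rho by lra.
have cmp := barrier_comparison hn hs hl hL hC Lu lu visc ge0 gt0 ballO x0c
  r_gt0 r4
  VM M_ge0 al0 ual dl01 hU ineq.
rewrite rN in cmp.
have /andP[b0 b1] := hbeta.
have sb : 0 < sin beta by apply: sin_gt0_pi; rewrite b0/=; have := @pi_gt0 R;
  lra.
have rs0 : 0 < r * sin beta by rewrite mulr_gt0.
pose k := dl * al * rho' * (r * sin beta) `^ s.
have k0 : 0 < k by rewrite !mulr_gt0 ?powR_gt0.
(* [r / 2] keeps [x] out of the half ball, where [cmp] does not apply; [r sin beta] is the range of
   [cone_cap_ge]. *)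
pose del := Num.min (r / 2) (r * sin beta).
have del0 : 0 < del by rewrite lt_min divr_gt0.
rewrite limf_einfE; apply: (@lt_le_trans _ _ k%:E); first by rewrite lte_fin.
pose D := Omega `&` cone x0 (xc r - x0) (pi / 2 - beta).
pose W := D `&` eball x0 del.
(* The lower limit is a supremum over the sets of the filter, and [W] is one of them. *)
apply: (@le_trans _ _ (ereal_inf [set (u x / enorm (x - x0) `^ s)%:E | x in
  W])); last first.
  apply: ereal_sup_ubound; exists W => //.
  rewrite /within/=.
  move: (eball_nbhs x0 del0); apply: filterS => x xd Dx; split => //.
apply: le_ereal_inf_tmp => _ [x [[Ox cx] xd] <-]; rewrite lee_fin.
(* A boundary point of the open set [Omega] is not in it. *)
have xx0 : x != x0.
  apply/eqP => xE; case: hx0 => _; apply; rewrite -xE.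
  by apply: open_nbhs_nbhs; split.
have e0 : 0 < enorm (x - x0) by rewrite lt_neqAle enorm_ge0 eq_sym enorm_eq0
  subr_eq0 xx0.
move: xd; rewrite /eball/= lt_min => /andP[xd1 xd2].
have cap_ge := cone_cap_ge hs r_gt0 x0c hbeta xx0 cx (ltW xd2).
have xr1 : r / 2 <= enorm (x - xc r).
  have := enormD (x - xc r) (- (x - x0)); rewrite enormN.
  have -> : x - xc r - (x - x0) = x0 - xc r by apply/rowP => i; rewrite !mxE;
    ring.
  by rewrite x0c; lra.
(* By [cap_ge] the cap is positive at [x], which places [x] inside the ball. *)
have xr2 : enorm (x - xc r) < r.
  rewrite ltNge; apply/negP => h; move: cap_ge.
  by rewrite (cap_out s0 h (ltW r_gt0)) leNgt mulr_gt0// powR_gt0.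
have /cmp ucap : r / 2 <= enorm (x - xc r) < r by rewrite xr1.
rewrite ler_pdivlMr ?powR_gt0//; apply: le_trans ucap.
rewrite /k -(mulrA (dl * al * rho')) ler_wpM2l//.
by rewrite !mulr_ge0// ltW.
Qed.
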